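(* Let $f\in\mathbb{Z}[x]$ be an intersective polynomial of degree $2$ and let $\rho<1/\log 3$ be a real number. Then there is a constant $C>0$, depending only on $f$ and $\rho$, such that the following holds for every $N\in\mathbb{N}$ large enough that $\log\log\log\log N$ is defined (i.e. $\log\log\log N>0$). If $A\subseteq\{1,2,\dots,N\}$ satisfies $f(n)\notin A-A$ for all $n\in\mathbb{N}$ with $f(n)\neq 0$, then $$\frac{|A|}{N}\le C\,(\log N)^{-\rho\log\log\log\log N}.$$
   Context: $\mathbb{N}$ denotes the positive integers and $\log$ the natural logarithm. $A-A=\{a-a' : a,a'\in A\}$ is the difference set. A polynomial $f\in\mathbb{Z}[x]$ is called intersective if for every $q\in\mathbb{N}$ it has a root modulo $q$, i.e. there is an integer $r$ with $f(r)\equiv 0 \pmod q$. *)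

(* Defs.v *)
From HB Require Import structures.
From mathcomp Require Import all_boot all_order all_algebra finmap.

Set Implicit Arguments.
Unset Strict Implicit.
Unset Printing Implicit Defensive.

Import Order.TTheory GRing.Theory Num.Theory.
Local Open Scope ring_scope.

Definition intersective (f : {poly int}) : Prop :=
  forall q : nat, (0 < q)%N -> exists r : int, (q%:Z %| f.[r])%Z.

Definition diffset (A : {fset int}) : {fset int} :=
  [fset a - a' | a in A, a' in A]%fset.

(* Main.v *)
(* Density increment, with the Fourier-analytic step of Bloom and Maynard. If a set
   A of density de in [0, N) contains no two elements differing by a value of the
   quadratic h, then its balanced function has a large Fourier transform where the
   Weyl sum of h is large, i.e. near rationals a / s with s <= B, where that sum has
   size s^(-1/2). If A has no density increment by a factor 1 + nu on progressions
   whose step is a multiple of s, the mass of the transform near the rationals of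
   denominator s is O(nu de^2 N P). By Hoelder, a weighted sum over the major arcs
   is controlled by the additive energy of the rationals with weights s^(-1/2); the
   denominators of three rationals with sum 0 are dxy, dxz, dyz, which makes this
   energy almost diagonal. Taking the 2m-th moment gives
   de <= (C (log B)^2 nu)^m times a factor of lower order, which fails for
   nu = (log N)^(-1/2) and m of order log log log log N. Hence there is an increment,
   and iterating it the density exceeds 1.
   For the iteration, an intersective quadratic has the shape g (a x + b) (c x + d)
   with a, c coprime, and on a suitable progression of step q it is a multiple of q
   times a quadratic of the same kind. *)
Require Import Defs.
From HB Require Import structures.
From mathcomp Require Import all_boot all_order all_algebra finmap.
From mathcomp Require Import reals exp.
From mathcomp Require Import boolp topology normedtype sequences derive.
From mathcomp Require Import trigo complex zify ring lra.

Set Implicit Arguments.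
Unset Strict Implicit.
Unset Printing Implicit Defensive.

Import Order.TTheory GRing.Theory Num.Theory.
Import numFieldNormedType.Exports.
Local Open Scope ring_scope.
Local Open Scope complex_scope.
Import Normc.

(** * Exponential sums *)

(** Two devices make the moment computation finite. Frequencies live in Z/P with P = 3N, so that no
    difference wraps around; the rationals near them live in Z/B!, where every denominator up to B
    is available. Distinct sums of m + 1 such rationals are at least B^(-2(m+1)) apart modulo 1,
    more than twice the accumulated error (m+1)B/N, so a coincidence of frequencies forces a
    coincidence of rationals, and the moment is bounded by an additive energy in Z/B!. That this
    energy is nearly diagonal rests on one cancellation: for orders s = dxy, t = dxz, u = dyz,
    Cauchy-Schwarz on a triple correlation costs the factor d, and d/(st) = 1/(x^2 u). The sum over
    x then loses only powers of log B, at the price of powers of the divisor function that grow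
    linearly with the number of convolutions. The argument gives the bound with exponent 1 in place
    of rho, which is enough because 1/log 3 < 1. *)

Definition cis (R : realType) (t : R) : R[i] := cos (2 * pi * t) +i* sin (2 * pi * t).

Arguments cis : simpl never.

Lemma conjcM (R : realType) (x y : R[i]) : conjc (x * y) = conjc x * conjc y.
Proof. exact: rmorphM. Qed.

Lemma conjc_sum (R : realType) (I : Type) (s : seq I) (P : pred I) (F : I -> R[i]) :
  conjc (\sum_(i <- s | P i) F i) = \sum_(i <- s | P i) conjc (F i).
Proof. exact: rmorph_sum. Qed.

Lemma normc_sqE (R : realType) (z : R[i]) : (normc z ^+ 2)%:C = z * conjc z.
Proof.
case: z => a b /=; rewrite sqr_sqrtr ?addr_ge0 ?sqr_ge0 //.
by apply/eqP; rewrite eq_complex /=; apply/andP; split; apply/eqP; ring.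
Qed.

Lemma normc_Re_le (R : realType) (z : R[i]) : `|complex.Re z| <= normc z.
Proof.
case: z => a b /=; rewrite -sqrtr_sqr ler_sqrt ?addr_ge0 ?sqr_ge0 //.
by rewrite lerDl sqr_ge0.
Qed.

Lemma normc_ge0 (R : realType) (z : R[i]) : 0 <= normc z.
Proof. by case: z => a b /=; exact: sqrtr_ge0. Qed.

Lemma normc_real (R : realType) (x : R) : normc x%:C = `|x|.
Proof. by rewrite /= expr0n /= addr0 sqrtr_sqr. Qed.

Lemma normc_conj (R : realType) (z : R[i]) : normc (conjc z) = normc z.
Proof. by case: z => a b /=; rewrite sqrrN. Qed.

Lemma normc_sum (R : realType) (I : Type) (s : seq I) (P : pred I) (F : I -> R[i]) :
  normc (\sum_(i <- s | P i) F i) <= \sum_(i <- s | P i) normc (F i).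
Proof.
elim/big_ind2: _ => //; first by rewrite normc0.
by move=> x1 x2 y1 y2 h1 h2; apply: le_trans (le_normcD _ _) _; exact: lerD.
Qed.

Lemma normcX (R : realType) (z : R[i]) n : normc (z ^+ n) = normc z ^+ n.
Proof. by elim: n => [|n IH]; rewrite ?expr0 ?normc1 // !exprS normcM IH. Qed.

Lemma cis0 (R : realType) : cis (0 : R) = 1.
Proof. by rewrite /cis mulr0 cos0 sin0. Qed.

Lemma cisD (R : realType) (t u : R) : cis (t + u) = cis t * cis u.
Proof.
rewrite /cis mulrDr cosD sinD; apply/eqP; rewrite eq_complex /=.
by apply/andP; split; apply/eqP; ring.
Qed.

Lemma cisN (R : realType) (t : R) : cis (- t) = conjc (cis t).
Proof. by rewrite /cis mulrN cosN sinN. Qed.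

Lemma normc_cis (R : realType) (t : R) : normc (cis t) = 1.
Proof. by rewrite /= cos2Dsin2 sqrtr1. Qed.

Lemma cis_nat (R : realType) (n : nat) : cis (n%:R : R) = 1.
Proof.
elim: n => [|n IH]; first exact: cis0.
rewrite -natr1 cisD IH mul1r /cis mulr1 mulr_natl cos2pi sin2pi //.
Qed.

Lemma cis_int (R : realType) (n : int) : cis (n%:~R : R) = 1.
Proof.
case: n => n; first by rewrite -pmulrn cis_nat.
by rewrite NegzE mulrNz cisN -pmulrn cis_nat conjc1.
Qed.

Lemma cisM_nat (R : realType) (t : R) (n : nat) : cis (n%:R * t) = cis t ^+ n.
Proof.
elim: n => [|n IH]; first by rewrite mul0r cis0.
by rewrite -natr1 mulrDl mul1r cisD IH exprSr.
Qed.

Lemma normc_cisB1_sq (R : realType) (t : R) :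
  normc (cis t - 1) ^+ 2 = 2 - 2 * cos (2 * pi * t).
Proof.
rewrite /= sqr_sqrtr ?addr_ge0 ?sqr_ge0 //.
have := cos2Dsin2 (2 * pi * t); rewrite !expr2 oppr0 addr0; lra.
Qed.

Lemma normc_cisB1 (R : realType) (t : R) : normc (cis t - 1) = 2 * `|sin (pi * t)|.
Proof.
apply/eqP; rewrite -(eqrXn2 (ltn0Sn 1)) ?normc_ge0 ?mulr_ge0 //; apply/eqP.
rewrite normc_cisB1_sq exprMn real_normK ?num_real //.
have -> : 2 * pi * t = (pi * t) *+ 2 by ring.
rewrite cos_mulr2n sin2cos2; ring.
Qed.

Lemma sin_le_id (R : realType) (x : R) : 0 <= x -> sin x <= x.
Proof.
move=> x0; case: (ltgtP x 0) x0 => // [xp _|->]; last by rewrite sin0.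
have [c _] : exists2 c, c \in `]0, x[ & sin x - sin 0 = cos c * (x - 0).
  apply: MVT => //.
  by apply: continuous_subspaceT; exact: continuous_sin.
rewrite sin0 !subr0 => ->; rewrite -[leRHS]mul1r ler_wpM2r ?cos_le1 //; exact: ltW.
Qed.

Lemma normc_cisB1_le (R : realType) (t : R) : normc (cis t - 1) <= 8 * `|t|.
Proof.
have h : `|sin (pi * t)| <= pi * `|t|.
  have pi0 := pi_ge0 R; case: (ger0P t) => t0.
    rewrite ler_norml sin_le_id ?mulr_ge0 // andbT.
    have : sin (pi * t) >= - (pi * t).
      rewrite lerNl -sinN.
      have : `|sin (pi * t)| ^+ 2 <= (pi * t) ^+ 2.
        rewrite real_normK ?num_real //.
        case: (leP (pi * t) 1) => h.
          rewrite ler_sqr ?nnegrE ?mulr_ge0 ?sin_le_id ?mulr_ge0 //.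
          by apply: sin_ge0_pi; rewrite mulr_ge0 //= (le_trans h) // (le_trans _ (pi_ge2 R)) // ler1n.
        apply: (@le_trans _ _ 1); last by rewrite -[leLHS](expr1n _ 2) ler_sqr ?nnegrE ?mulr_ge0 // ltW.
        by rewrite sin2cos2; have := sqr_ge0 (cos (pi * t)); lra.
      rewrite ler_sqr ?nnegrE ?mulr_ge0 // => h; rewrite sinN.
      by apply: le_trans h; rewrite -normrN ler_norm.
    by [].
  have t1 : 0 <= - t by rewrite oppr_ge0 ltW.
  rewrite -normrN -sinN -mulrN; move: t1; set u := - t => t1.
  have : `|sin (pi * u)| ^+ 2 <= (pi * u) ^+ 2.
    rewrite real_normK ?num_real //.
    case: (leP (pi * u) 1) => h.
      rewrite ler_sqr ?nnegrE ?mulr_ge0 ?sin_le_id ?mulr_ge0 //.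
      by apply: sin_ge0_pi; rewrite mulr_ge0 //= (le_trans h) // (le_trans _ (pi_ge2 R)) // ler1n.
    apply: (@le_trans _ _ 1); last by rewrite -[leLHS](expr1n _ 2) ler_sqr ?nnegrE ?mulr_ge0 // ltW.
    by rewrite sin2cos2; have := sqr_ge0 (cos (pi * u)); lra.
  by rewrite ler_sqr ?nnegrE ?mulr_ge0.
(* This crude bound on pi is the origin of the constant 8 = 2 * 4. *)
have pi4 : pi <= 4 :> R by have := pihalf_lt2 R; lra.
rewrite normc_cisB1; have := ler_wpM2r (normr_ge0 t) pi4; lra.
Qed.

Lemma normc_cisB1_mul (R : realType) (t : R) (n : nat) :
  normc (cis (n%:R * t) - 1) <= n%:R * normc (cis t - 1).
Proof.
elim: n => [|n IH]; first by rewrite !mul0r cis0 subrr normc0.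
rewrite -natr1 mulrDl mul1r cisD.
have -> : cis (n%:R * t) * cis t - 1 = (cis (n%:R * t) - 1) * cis t + (cis t - 1) by ring.
apply: le_trans (le_normcD _ _) _; rewrite normcM normc_cis mulr1; lra.
Qed.

Lemma cisN_norm (R : realType) (t : R) : normc (cis (- t) - 1) = normc (cis t - 1).
Proof. by rewrite !normc_cisB1 mulrN sinN normrN. Qed.

Lemma cos_le0_pi (R : realType) (x : R) : pi / 2 <= x <= pi -> cos x <= 0.
Proof.
move=> /andP[h1 h2]; have := cosDpihalf (x - pi / 2); rewrite subrK => ->.
by rewrite oppr_le0; apply: sin_ge0_pi; have := pi_ge0 R; lra.
Qed.

(** Amplification instead of concavity of the sine: some multiple n t lands in [1/4, 1/2], where the
    cosine is nonpositive and so the chord is at least 1, while passing from t to n t lengthens the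
    chord by at most the factor n. The sharp constant would be 4. *)
Lemma normc_cisB1_ge (R : realType) (t : R) :
  `|t| <= 1 / 2 -> 2 * `|t| <= normc (cis t - 1).
Proof.
wlog t0 : t / 0 <= t => [hw h|].
  case: (lerP 0 t) => t0; first exact: hw.
  by rewrite -cisN_norm -normrN hw ?normrN // oppr_ge0 ltW.
rewrite ger0_norm // => t2.
case: (ltgtP t 0) t0 => // [tp _|->]; last by rewrite mulr0 normc_ge0.
have [n [n1 n2]] : exists n : nat, 1 / 4 <= n%:R * t <= 1 / 2 /\ n%:R * (2 * t) <= 1.
  case: (leP (1 / 4) t) => h; first by exists 1%N; rewrite !mul1r; lra.
  have /andP[l u] : (Num.truncn (1 / (4 * t)))%:R <= 1 / (4 * t) < (Num.truncn (1 / (4 * t))).+1%:R by apply: truncn_itv; rewrite divr_ge0 ?mulr_ge0 // ltW.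
  set k := Num.truncn _ in l u.
  have l' : k%:R * (4 * t) <= 1 by rewrite -ler_pdivlMr ?mulr_gt0.
  have u' : 1 < k.+1%:R * (4 * t) by rewrite -ltr_pdivrMr ?mulr_gt0.
  exists k.+1; move: l' u'; rewrite -[k.+1%:R]natr1 => l' u'; split; last lra.
  by apply/andP; split; lra.
have np : 0 < n%:R :> R.
  by case: n n1 {n2} => [|n] //; rewrite mul0r => /andP[]; lra.
have := normc_cisB1_mul t n; have : 1 <= normc (cis (n%:R * t) - 1).
  rewrite -(ler_sqr) ?nnegrE ?normc_ge0 // normc_cisB1_sq expr1n.
  have : cos (2 * pi * (n%:R * t)) <= 0.
    apply: cos_le0_pi; move/andP: n1 => [a b].
    have pi0 := pi_ge0 R.
    by have := ler_wpM2l pi0 a; have := ler_wpM2l pi0 b; lra.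
  lra.
move=> h1 h2; have h3 := le_trans h1 h2.
rewrite -(ler_pM2l np); lra.
Qed.

Lemma cis_geom (R : realType) (t : R) (n : nat) :
  (\sum_(j < n) cis (j%:R * t)) * (cis t - 1) = cis (n%:R * t) - 1.
Proof.
rewrite (eq_bigr (fun j : 'I_n => cis t ^+ j)); last by move=> j _; exact: cisM_nat.
by rewrite cisM_nat subrX1 mulrC.
Qed.

Lemma cis_geom_le (R : realType) (t : R) (n : nat) :
  normc (\sum_(j < n) cis (j%:R * t)) * normc (cis t - 1) <= 2.
Proof.
rewrite -normcM cis_geom; apply: le_trans (le_normcD _ _) _.
by rewrite normcN normc1 normc_cis.
Qed.

Lemma normc_cis_sum_le (R : realType) (n : nat) (F : nat -> R) :
  normc (\sum_(j < n) cis (F j)) <= n%:R.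
Proof.
apply: le_trans (normc_sum _ _ _) _.
rewrite (eq_bigr (fun _ => 1)) => [|i _]; last exact: normc_cis.
by rewrite sumr_const card_ord.
Qed.

(** A geometric sum with t = (k - l) / P. The delicate point is that [cis t = 1] forces k and l to
    be congruent: with d the difference of the residues, the lower bound for chords is applied to d
    / P or to 1 - d / P, whichever is at most 1/2. *)
Lemma cis_orth (R : realType) (P : nat) (k l : nat) : (0 < P)%N ->
  \sum_(r < P) cis ((r * k)%:R / P%:R : R) * conjc (cis ((r * l)%:R / P%:R : R))
    = if k == l %[mod P] then P%:R else 0.
Proof.
move=> P0.
have P0' : P%:R != 0 :> R by rewrite pnatr_eq0 -lt0n.
set t : R := (k%:R - l%:R) / P%:R.
have E (r : nat) : cis ((r * k)%:R / P%:R : R) * conjc (cis ((r * l)%:R / P%:R : R))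
    = cis (r%:R * t).
  by rewrite -cisN -cisD /t !natrM; congr cis; field.
rewrite (eq_bigr (fun r : 'I_P => cis (r%:R * t))) => [|r _]; last exact: E.
have h : cis (P%:R * t) = 1.
  have -> : P%:R * t = (k%:Z - l%:Z)%:~R by rewrite /t intrB -!pmulrn; field.
  exact: cis_int.
have := cis_geom t P; rewrite h subrr => /eqP; rewrite mulf_eq0.
case: ifP => [kl _|kl].
  have [n ->] : exists n : int, t = n%:~R.
    have : (P%:Z %| k%:Z - l%:Z)%Z.
      by move/eqP: kl => kl; rewrite -eqz_mod_dvd !modz_nat kl.
    case/dvdzP => n hn; exists n; rewrite /t.
    have -> : k%:R - l%:R = (k%:Z - l%:Z)%:~R :> R by rewrite intrB -!pmulrn.
    by rewrite hn intrM -pmulrn mulfK.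
  rewrite (eq_bigr (fun=> 1)) => [|r _]; first by rewrite sumr_const card_ord.
  have -> : (r : nat)%:R * n%:~R = ((r : nat)%:Z * n)%:~R :> R by rewrite intrM -pmulrn.
  exact: cis_int.
case/orP => [/eqP -> //|/eqP ht].
exfalso; move/negP: kl; apply.
have {}ht : cis t = 1 by apply/eqP; rewrite -subr_eq0 ht.
wlog kl : k l @t E h ht / (k %% P <= l %% P)%N.
  move=> hw; case: (leqP (k %% P) (l %% P)) => c; first exact: hw c.
  rewrite eq_sym; apply: hw (ltnW c).
  - by move=> r; rewrite -cisN -cisD !natrM; congr cis; field.
  - rewrite mulrC divfK //.
    have -> : l%:R - k%:R = (l%:Z - k%:Z)%:~R :> R by rewrite intrB -!pmulrn.
    exact: cis_int.
  - have -> : (l%:R - k%:R) / P%:R = - t by rewrite /t -mulNr opprB.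
    by rewrite cisN ht conjc1.
set d := (l %% P - k %% P)%N.
have dP : (d < P)%N by rewrite /d (leq_ltn_trans (leq_subr _ _)) ?ltn_pmod.
have hd : normc (cis (d%:R / P%:R : R) - 1) = 0.
  have -> : d%:R / P%:R = - t + ((l %/ P)%:Z - (k %/ P)%:Z)%:~R * -1 :> R.
    have e (n : nat) : n%:R = (n %/ P)%:R * P%:R + (n %% P)%:R :> R.
      by rewrite {1}(divn_eq n P) natrD natrM.
    by rewrite /d natrB // /t (e k) (e l) intrB -!pmulrn; field.
  by rewrite cisD cisN ht conjc1 mul1r mulrN1 cisN cis_int conjc1 subrr normc0.
have Pp : 0 < P%:R :> R by rewrite ltr0n.
rewrite eqn_leq kl /= -subn_eq0 -/d.
case: (leqP (2 * d) P) => c.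
  have : `|d%:R / P%:R : R| <= 1 / 2.
    rewrite ger0_norm ?divr_ge0 // ler_pdivrMr //.
    by move: c; rewrite -(ler_nat R) natrM; lra.
  move/normc_cisB1_ge; rewrite hd => h0.
  have : d%:R / P%:R = 0 :> R.
    by apply/eqP; rewrite -normr_le0 -(ler_pM2l (ltr0n R 2)) mulr0.
  by move/eqP; rewrite mulf_eq0 invr_eq0 (negbTE P0') orbF pnatr_eq0.
have : `|(P - d)%:R / P%:R : R| <= 1 / 2.
  rewrite ger0_norm ?divr_ge0 // ler_pdivrMr // natrB ?(ltnW dP) //.
  by move: c; rewrite -(ltr_nat R) natrM; lra.
move/normc_cisB1_ge.
have -> : (P - d)%:R / P%:R = 1 - d%:R / P%:R :> R.
  by rewrite natrB ?(ltnW dP) // mulrBl divff.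
rewrite (_ : cis (1 - _) = cis (- (d%:R / P%:R))); last first.
  by rewrite cisD (cis_nat R 1) mul1r.
rewrite cisN_norm hd => h0.
have : 1 - d%:R / P%:R = 0 :> R.
  by apply/eqP; rewrite -normr_le0 -(ler_pM2l (ltr0n R 2)) mulr0.
move/eqP; rewrite subr_eq0 => /eqP h1.
have : d%:R = P%:R :> R by rewrite -[LHS](divfK P0') -h1 mul1r.
by move/eqP; rewrite eqr_nat => /eqP h2; move: dP; rewrite h2 ltnn.
Qed.

(** Plancherel with arbitrary index types and possibly repeated positions, so that the product of a
    transform with a Weyl sum can be treated as one sum over pairs (n, x) in [correlation]. *)
Lemma dft_inner (R : realType) (P : nat) (I J : finType)
    (c : I -> R[i]) (d : J -> R[i]) (k : I -> nat) (l : J -> nat) : (0 < P)%N ->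
  \sum_(r < P) (\sum_i c i * cis ((r * k i)%:R / P%:R : R)) *
               conjc (\sum_j d j * cis ((r * l j)%:R / P%:R : R))
  = P%:R * \sum_i \sum_(j | k i == l j %[mod P]) c i * conjc (d j).
Proof.
move=> P0.
transitivity (\sum_(r < P) \sum_i \sum_j (c i * conjc (d j)) *
   (cis ((r * k i)%:R / P%:R : R) * conjc (cis ((r * l j)%:R / P%:R : R)))).
  apply: eq_bigr => r _; rewrite conjc_sum big_distrl /=.
  apply: eq_bigr => i _; rewrite big_distrr /=; apply: eq_bigr => j _.
  by rewrite conjcM mulrACA.
rewrite exchange_big big_distrr /=; apply: eq_bigr => i _.
rewrite exchange_big big_distrr [RHS]big_mkcond /=; apply: eq_bigr => j _.
rewrite -big_distrr /= cis_orth //.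
by case: ifP => _; rewrite ?mulr0 // mulrC.
Qed.

Lemma parseval (R : realType) (P : nat) (c : 'I_P -> R[i]) : (0 < P)%N ->
  \sum_(r < P) normc (\sum_x c x * cis ((r * x)%:R / P%:R : R)) ^+ 2
  = P%:R * \sum_x normc (c x) ^+ 2.
Proof.
move=> P0; apply: complexI; rewrite !rmorph_sum rmorphM /= rmorph_nat rmorph_sum /=.
under eq_bigr do rewrite normc_sqE.
rewrite (dft_inner c c (fun x : 'I_P => x : nat) (fun x : 'I_P => x : nat) P0).
congr (_ * _); apply: eq_bigr => x _.
rewrite (bigD1 x) ?eqxx //= big1 ?addr0 ?normc_sqE // => y /andP[h1 h2].
by exfalso; move: h1; rewrite !modn_small // => /eqP h; case/negP: h2; rewrite -val_eqE /= h.
Qed.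

(** * Divisor sums *)

Lemma sum_inj_le (R : numDomainType) (I J : finType) (P : pred I) (Q : pred J)
    (h : I -> J) (G : J -> R) :
  {in P &, injective h} -> (forall i, P i -> Q (h i)) -> (forall j, Q j -> 0 <= G j) ->
  \sum_(i | P i) G (h i) <= \sum_(j | Q j) G j.
Proof.
move=> hinj hPQ G0.
rewrite -(big_imset G (h := h) (A := P)) /=; last first.
  by move=> x y hx hy; apply: hinj.
rewrite [leRHS](bigID [pred j | j \in h @: P]) /=.
have -> : \sum_(j | Q j && (j \in h @: P)) G j = \sum_(j in h @: P) G j.
  apply: eq_bigl => j; case: imsetP => [[i hi ->]|_]; rewrite ?andbF ?andbT //.
  by rewrite hPQ.
by rewrite lerDl; apply: sumr_ge0 => j /andP[hj _]; exact: G0.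
Qed.

(** Lagrange's identity: the difference of the two sides is half the sum of the squares (a_i b_j -
    a_j b_i)^2. *)
Lemma sum_CS (R : realDomainType) (I : finType) (P : pred I) (a b : I -> R) :
  (\sum_(i | P i) a i * b i) ^+ 2
    <= (\sum_(i | P i) a i ^+ 2) * (\sum_(i | P i) b i ^+ 2).
Proof.
have h : 0 <= \sum_(i | P i) \sum_(j | P j) (a i * b j - a j * b i) ^+ 2.
  by apply: sumr_ge0 => i _; apply: sumr_ge0 => j _; exact: sqr_ge0.
have E : \sum_(i | P i) \sum_(j | P j) (a i * b j - a j * b i) ^+ 2 =
  2 * ((\sum_(i | P i) a i ^+ 2) * (\sum_(i | P i) b i ^+ 2)
       - (\sum_(i | P i) a i * b i) ^+ 2).
  rewrite [in RHS]expr2 !big_distrlr /= mulrBr.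
  have -> : \sum_(i | P i) \sum_(j | P j) (a i * b j - a j * b i) ^+ 2 =
    \sum_(i | P i) \sum_(j | P j) a i ^+ 2 * b j ^+ 2 +
    \sum_(i | P i) \sum_(j | P j) a j ^+ 2 * b i ^+ 2 -
    2 * \sum_(i | P i) \sum_(j | P j) a i * b i * (a j * b j).
    rewrite [X in _ - X]big_distrr /= -big_split -sumrB /=; apply: eq_bigr => i _.
    rewrite big_distrr /= -big_split -sumrB /=; apply: eq_bigr => j _; ring.
  by rewrite [X in _ + X - _]exchange_big /=; ring.
by rewrite E in h; rewrite -subr_ge0; move: h; rewrite pmulr_rge0.
Qed.

Definition tau (n : nat) : nat := size (divisors n).

Lemma tau_sum (n K : nat) : (0 < n)%N -> (n < K)%N -> tau n = (\sum_(d < K) (d %| n))%N.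
Proof.
move=> n0 nK; rewrite -(big_mkord predT (fun d => (d %| n) : nat)) -big_mkcond /= sum1_count -size_filter.
apply: perm_size; apply: uniq_perm; rewrite ?divisors_uniq ?filter_uniq ?iota_uniq //.
move=> d; rewrite mem_filter mem_index_iota -dvdn_divisors //.
case h: (d %| n)%N => //=.
by rewrite (leq_ltn_trans _ nK) // dvdn_leq.
Qed.

(** The map d -> (gcd (d, m), d / gcd (d, m)) injects the divisors of m n into the pairs of a
    divisor of m and a divisor of n. *)
Lemma tauM (m n : nat) : (0 < m)%N -> (0 < n)%N -> (tau (m * n) <= tau m * tau n)%N.
Proof.
move=> m0 n0; rewrite /tau -(size_allpairs pair).
set h := fun d => (gcdn d m, d %/ gcdn d m)%N.
rewrite -(size_map h); apply: uniq_leq_size.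
  rewrite map_inj_in_uniq ?divisors_uniq // => x y _ _ [e1 e2].
  by rewrite -(divnK (dvdn_gcdl x m)) -(divnK (dvdn_gcdl y m)) e1 -e2 e1.
move=> _ /mapP[d hd ->]; move: hd; rewrite -dvdn_divisors ?muln_gt0 ?m0 // => hd.
apply: (allpairs_f pair); rewrite -dvdn_divisors // ?dvdn_gcdr //.
have g0 : (0 < gcdn d m)%N by rewrite gcdn_gt0 m0 orbT.
rewrite -(@Gauss_dvdr _ (m %/ gcdn d m)); last first.
  by rewrite /coprime -(@eqn_pmul2l (gcdn d m)) // muln_gcdr muln1
             ![(gcdn d m * _)%N]mulnC !divnK ?dvdn_gcdl ?dvdn_gcdr.
by rewrite -(@dvdn_pmul2l (gcdn d m)) // mulnA ![(gcdn d m * (_ %/ _))%N]mulnC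
           !divnK ?dvdn_gcdl ?dvdn_gcdr.
Qed.

Lemma tau_dvd (m n : nat) : (0 < n)%N -> (m %| n)%N -> (tau m <= tau n)%N.
Proof.
move=> n0 mn; have m0 : (0 < m)%N by apply: dvdn_gt0 mn.
apply: uniq_leq_size; first exact: divisors_uniq.
move=> d; rewrite -!dvdn_divisors // => h; exact: dvdn_trans mn.
Qed.

(** The term x = 0 vanishes, since the inverse of 0 is 0. *)
Definition tausum (R : realType) (j X : nat) : R := \sum_(x < X.+1) (tau x)%:R ^+ j / x%:R.

Lemma harm_ln (R : realType) (X : nat) : (0 < X)%N ->
  \sum_(x < X.+1) (x%:R : R)^-1 <= 1 + ln X%:R.
Proof.
elim: X => // -[_ _|X IH _].
  by rewrite !big_ord_recr big_ord0 /= invr0 invr1 ln1 !add0r addr0.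
rewrite big_ord_recr /=; have {}IH := IH isT.
suff : (X.+2%:R : R)^-1 <= ln X.+2%:R - ln X.+1%:R.
  move=> h; apply: le_trans (lerD IH h) _.
  by rewrite -addrA [ln X.+1%:R + _]addrC subrK.
rewrite -ln_div ?posrE ?ltr0n //.
have -> : X.+2%:R / X.+1%:R = (1 + - (X.+2%:R)^-1 : R)^-1.
  rewrite -[X.+2%:R]natr1; set u : R := X.+1%:R.
  have u1 : u + 1 != 0 by rewrite /u natr1 pnatr_eq0.
  clearbody u.
  have -> : 1 - (u + 1)^-1 = u / (u + 1) by field.
  by rewrite invf_div.
rewrite lnV ?posrE; last first.
  by rewrite subr_gt0 invf_lt1 ?ltr0n // ltr1n.
rewrite lerNr; apply: le_ln1Dx.
by rewrite ltrN2 invf_lt1 ?ltr0n // ltr1n.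
Qed.

Lemma tausum0 (R : realType) (X : nat) : (0 < X)%N -> tausum R 0 X <= 1 + ln X%:R.
Proof.
move=> X0; apply: le_trans (harm_ln _ X0).
by apply: ler_sum => x _; rewrite expr0 mul1r.
Qed.

Lemma tausum_ge0 (R : realType) j X : 0 <= tausum R j X.
Proof. by apply: sumr_ge0 => x _; rewrite mulr_ge0 ?exprn_ge0 ?invr_ge0. Qed.

(** One factor tau(x) is opened as a count of divisors d of x; with x = d e and tau(x) <= tau(d)
    tau(e), the pairs (e, d) embed into the full square. *)
Lemma tausumS (R : realType) (j X : nat) : tausum R j.+1 X <= tausum R j X ^+ 2.
Proof.
have E : tausum R j.+1 X = \sum_(p : 'I_X.+1 * 'I_X.+1 | (0 < p.1)%N && (p.2 %| p.1)%N)
           (tau p.1)%:R ^+ j / p.1%:R.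
  rewrite -(pair_big_dep (fun x : 'I_X.+1 => (0 < x)%N)
     (fun x d : 'I_X.+1 => (d %| x)%N) (fun x d => (tau x)%:R ^+ j / x%:R)) /=.
  rewrite [RHS]big_mkcond; apply: eq_bigr => x _; rewrite lt0n; case: eqP => /= [->|x0].
    by rewrite invr0 mulr0.
  rewrite exprS -mulrA sumr_const -[X in _ = X]mulr_natl; congr (_%:R * _).
  rewrite (@tau_sum x X.+1 _ (ltn_ord x)); last by case: (nat_of_ord x) x0.
  rewrite -sum1_card [RHS]big_mkcond; apply: eq_bigr => d _ /=.
  by rewrite unfold_in /= /dvdn; case: (x %% d)%N.
rewrite E expr2 /tausum big_distrlr /= pair_big /=.
set h := fun p : 'I_X.+1 * 'I_X.+1 => ((inord (p.1 %/ p.2) : 'I_X.+1), p.2).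
have hv (p : 'I_X.+1 * 'I_X.+1) : (inord (p.1 %/ p.2) : 'I_X.+1) = (p.1 %/ p.2)%N :> nat.
  by rewrite inordK // (leq_ltn_trans (leq_div _ _)).
pose g (q : 'I_X.+1 * 'I_X.+1) : R :=
  (tau q.1)%:R ^+ j / q.1%:R * ((tau q.2)%:R ^+ j / q.2%:R).
apply: (@le_trans _ _ (\sum_(p : 'I_X.+1 * 'I_X.+1 | (0 < p.1)%N && (p.2 %| p.1)%N) g (h p))).
  apply: ler_sum => -[x d] /= /andP[x0 dx]; rewrite /g (hv (x, d)) /=.
  have d0 := dvdn_gt0 x0 dx.
  have xd0 : (0 < x %/ d)%N by rewrite divn_gt0 // dvdn_leq.
  have {1 2}-> : (x : nat) = (x %/ d * d)%N by rewrite divnK.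
  rewrite mulrACA -exprMn -!natrM -invfM -natrM ler_wpM2r ?invr_ge0 //.
  by rewrite lerXn2r ?nnegrE // ler_nat tauM.
apply: (@sum_inj_le _ _ _ _ predT h g) => //.
  move=> [x d] [y e] /andP[/= x0 dx] /andP[/= y0 ey] [/(congr1 val) /= h1 h2].
  move: h1; rewrite (hv (x, d)) (hv (y, e)) /= => h1.
  by congr (_, _) => //; apply: val_inj; rewrite /= -(divnK dx) -(divnK ey) h1 h2.
by move=> q _; rewrite /g !mulr_ge0 ?exprn_ge0 ?invr_ge0.
Qed.

Lemma tausum_le (R : realType) (j X : nat) : (0 < X)%N ->
  tausum R j X <= (1 + ln X%:R) ^+ (2 ^ j).
Proof.
move=> X0; elim: j => [|j IH]; first by rewrite expr1 tausum0.
apply: le_trans (tausumS _ _ _) _; rewrite expnSr exprM.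
by rewrite lerXn2r ?nnegrE ?tausum_ge0 // exprn_ge0 // addr_ge0 // ln_ge0 // ler1n.
Qed.

(* Orders that three elements of a cyclic group with sum 0 can have. *)
Definition allowed (s t u : nat) :=
  [&& (0 < s)%N, (0 < t)%N, (0 < u)%N, (s %| lcmn t u)%N, (t %| lcmn s u)%N & (u %| lcmn s t)%N].

(* If each of three integers divides the lcm of the other two, they are
   of the form (d x y, d x z, d y z), where d is their gcd. *)
Lemma allowed_split (s t u : nat) : allowed s t u ->
  let d := gcdn (gcdn s t) u in
  let x := gcdn (s %/ d) (t %/ d) in
  let y := gcdn (s %/ d) (u %/ d) in
  let z := gcdn (t %/ d) (u %/ d) in
  [/\ (0 < d)%N, s = d * x * y, t = d * x * z & u = d * y * z]%N.
Proof.
case/and5P => s0 t0 u0 hs /andP[ht hu] d x y z.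
have d0 : (0 < d)%N by rewrite !gcdn_gt0 s0.
have ds : (d %| s)%N by rewrite (dvdn_trans (dvdn_gcdl _ _)) ?dvdn_gcdl.
have dt : (d %| t)%N by rewrite (dvdn_trans (dvdn_gcdl _ _)) ?dvdn_gcdr.
have du : (d %| u)%N by rewrite dvdn_gcdr.
(* After division by d the three numbers have gcd 1, so gcd (a', b') and gcd (a', c') are coprime
   divisors of a'; conversely a' divides b' c', hence the product of these two gcds. *)
have key (a b c : nat) : (0 < a)%N -> (d %| a)%N -> (d %| b)%N -> (d %| c)%N ->
    (a %| lcmn b c)%N -> gcdn (gcdn a b) c = d ->
    a = (d * gcdn (a %/ d) (b %/ d) * gcdn (a %/ d) (c %/ d))%N.
  move=> a0 /dvdnP[a' ea] /dvdnP[b' eb] /dvdnP[c' ec]; subst a b c.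
  rewrite !mulnK // -muln_lcml dvdn_pmul2r // -!muln_gcdl => h1 h2.
  have {}h2 : gcdn (gcdn a' b') c' = 1%N by apply/eqP; rewrite -(eqn_pmul2r d0) h2 mul1n.
  rewrite [LHS]mulnC -mulnA; congr (_ * _)%N; apply/eqP; rewrite eqn_dvd; apply/andP; split.
    apply: (@dvdn_trans (gcdn a' (b' * c'))).
      by rewrite dvdn_gcd dvdnn (dvdn_trans h1) // dvdn_lcm dvdn_mulr // dvdn_mull.
    rewrite -[X in (_ %| X)%N]mulnC.
    have c1 : coprime (gcdn a' c') (gcdn a' b').
      by rewrite /coprime gcdnC gcdnA (gcdnC _ a') gcdnA gcdnn h2.
    set p := gcdn a' c'; set q := gcdn a' b'.
    rewrite -[X in (X %| _)%N](divnK (d := q) (m := gcdn a' (b' * c'))); last first.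
      by rewrite dvdn_gcd dvdn_gcdl /= (dvdn_trans (dvdn_gcdr _ _)) // dvdn_mulr.
    rewrite dvdn_pmul2r; last by rewrite gcdn_gt0; move: a0; rewrite muln_gt0 => /andP[->].
    have q0 : (0 < q)%N by rewrite gcdn_gt0; move: a0; rewrite muln_gt0 => /andP[->].
    rewrite dvdn_gcd; apply/andP; split.
      apply: (@dvdn_trans (gcdn a' (b' * c'))); last exact: dvdn_gcdl.
      by apply: dvdn_div; rewrite dvdn_gcd dvdn_gcdl /= (dvdn_trans (dvdn_gcdr _ _)) // dvdn_mulr.
    have : (gcdn a' (b' * c') %/ q %| b' %/ q * c')%N.
      rewrite -(dvdn_pmul2r q0) divnK; last first.
        by rewrite dvdn_gcd dvdn_gcdl /= (dvdn_trans (dvdn_gcdr _ _)) // dvdn_mulr.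
      by rewrite mulnAC divnK ?dvdn_gcdr.
    rewrite Gauss_dvdr //.
    apply: (@coprime_dvdl _ (a' %/ q)).
      rewrite -(dvdn_pmul2r q0) !divnK ?dvdn_gcdl //.
      by rewrite dvdn_gcd dvdn_gcdl /= (dvdn_trans (dvdn_gcdr _ _)) // dvdn_mulr.
    by rewrite /coprime -(eqn_pmul2r q0) muln_gcdl !divnK ?dvdn_gcdl ?dvdn_gcdr ?mul1n.
  rewrite Gauss_dvd ?dvdn_gcdl //.
  by rewrite /coprime gcdnA (gcdnC _ a') gcdnA gcdnn h2.
split=> //.
- exact: key.
- by rewrite /x (gcdnC (s %/ d)%N); apply: key; rewrite ?(gcdnC t s).
- rewrite /y /z !(gcdnC _ (u %/ d)%N); apply: key => //.
  by rewrite -gcdnA gcdnC.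
Qed.

(** * Additive energy of rational frequencies *)

(** The subgroup of Z/(L + 1) killed by n; equivalently, n clears the denominator of x / (L + 1). *)
Definition ker (L n : nat) (x : 'I_L.+1) : bool := (L.+1 %| n * x)%N.

Lemma kerD (L n : nat) (x y : 'I_L.+1) : ker n x -> ker n y -> ker n (x + y).
Proof.
by rewrite /ker /= /dvdn modnMmr mulnDr => h1 h2; rewrite -/(dvdn _ _) dvdn_add.
Qed.

Lemma kerN (L n : nat) (x : 'I_L.+1) : ker n x -> ker n (- x).
Proof.
rewrite /ker /= /dvdn modnMmr mulnBr => h; rewrite -/(dvdn _ _) dvdn_sub //.
by rewrite dvdn_mull.
Qed.

Lemma kerB (L n : nat) (x y : 'I_L.+1) : ker n x -> ker n y -> ker n (x - y).
Proof. by move=> h1 h2; rewrite kerD ?kerN. Qed.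

Lemma ker_gcd (L s t : nat) (x : 'I_L.+1) : ker s x -> ker t x -> ker (gcdn s t) x.
Proof. by rewrite /ker muln_gcdl dvdn_gcd => -> ->. Qed.

(** For a fixed x0 in X, the integer n (x - x0) / (L + 1) determines x and lies in [0, n). *)
Lemma ker_card (L n : nat) (X : pred 'I_L.+1) : (0 < n)%N ->
  (forall x y, X x -> X y -> ker n (x - y)) -> (#|X| <= n)%N.
Proof.
move=> n0 hX; case: (pickP X) => [x0 hx0|h]; last first.
  by rewrite eq_card0 // => x; rewrite unfold_in h.
have hlt (x : 'I_L.+1) : (n * x %/ L.+1 < n)%N.
  by rewrite ltn_divLR // ltn_pmul2l // ltn_ord.
rewrite -[X in (_ <= X)%N](card_ord n).
apply: (@leq_card_in _ _ (fun x => Ordinal (hlt (x - x0))) X) => x y hx hy /(congr1 val) /= e.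
apply: (addIr (- x0)); apply: val_inj => /=.
have dx := hX _ _ hx hx0; have dy := hX _ _ hy hx0; rewrite /ker /= in dx dy.
by apply/eqP; rewrite -(eqn_pmul2l n0) -(divnK dx) -(divnK dy) e.
Qed.

Definition zorder (L : nat) (x : 'I_L.+1) : nat := (L.+1 %/ gcdn L.+1 x)%N.

Lemma ker_zorder (L n : nat) (x : 'I_L.+1) : ker n x = (zorder x %| n)%N.
Proof.
rewrite /ker /zorder; set g := gcdn _ _.
have g0 : (0 < g)%N by rewrite gcdn_gt0.
have -> : (L.+1 %| n * x)%N = (L.+1 %/ g * g %| n * (x %/ g) * g)%N.
  by rewrite -mulnA !divnK ?dvdn_gcdl ?dvdn_gcdr.
rewrite dvdn_pmul2r //.
rewrite Gauss_dvdl //.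
by rewrite /coprime -(eqn_pmul2r g0) muln_gcdl !divnK ?dvdn_gcdl ?dvdn_gcdr ?mul1n.
Qed.

Lemma zorder_gt0 (L : nat) (x : 'I_L.+1) : (0 < zorder x)%N.
Proof. by rewrite divn_gt0 ?gcdn_gt0 // dvdn_leq ?dvdn_gcdl. Qed.

Lemma zorder_le (L : nat) (x : 'I_L.+1) : (zorder x < L.+2)%N.
Proof. by rewrite ltnS leq_div. Qed.

(** Each of x, y and x + y is a sum or difference of the other two, so its order divides the lcm of
    theirs. *)
Lemma allowed_zorder (L : nat) (x y : 'I_L.+1) :
  allowed (zorder x) (zorder y) (zorder (x + y)).
Proof.
rewrite /allowed !zorder_gt0 /= -!ker_zorder; apply/and3P; split.
- rewrite -[X in ker _ X](addrK y x).
  by apply: kerB; rewrite ker_zorder ?dvdn_lcml ?dvdn_lcmr.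
- have e : y = (x + y) - x by rewrite [x + y]addrC addrK.
  rewrite [X in ker _ X]e.
  by apply: kerB; rewrite ker_zorder ?dvdn_lcml ?dvdn_lcmr.
- by apply: kerD; rewrite ker_zorder ?dvdn_lcml ?dvdn_lcmr.
Qed.

(* Cauchy-Schwarz in x, then the swap g(y) w(x+y) g(y') w(x+y') =
   (g(y) w(x+y')) (g(y') w(x+y)): the pair (y, x+y') determines x up to
   the elements killed by gcd(s,t,u). *)
Lemma trilinear (R : realFieldType) (L s t u : nat) (f g w : 'I_L.+1 -> R) :
  (0 < s)%N ->
  (forall x, f x != 0 -> ker s x) -> (forall x, g x != 0 -> ker t x) ->
  (forall x, w x != 0 -> ker u x) ->
  (\sum_z \sum_x f x * g (z - x) * w z) ^+ 2
   <= (gcdn (gcdn s t) u)%:R *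
      ((\sum_x f x ^+ 2) * (\sum_x g x ^+ 2) * (\sum_x w x ^+ 2)).
Proof.
move=> s0 hf hg hw; set d := gcdn _ _.
have d0 : (0 < d)%N by rewrite !gcdn_gt0 s0.
pose K (x : 'I_L.+1) := \sum_y g y * w (x + y).
have -> : \sum_z \sum_x f x * g (z - x) * w z = \sum_(x | ker s x) f x * K x.
  rewrite exchange_big [RHS]big_mkcond; apply: eq_bigr => x _ /=.
  case hx: (ker s x); last first.
    have f0 : f x = 0 by apply/eqP; apply: contraFT hx; exact: hf.
    by rewrite big1 // => z _; rewrite f0 !mul0r.
  rewrite /K big_distrr /= (reindex_inj (addrI x)) /=; apply: eq_bigr => y _.
  by rewrite [x + y - x]addrC addKr mulrA.
apply: le_trans (sum_CS _ _ _) _.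
have h1 : \sum_(x | ker s x) f x ^+ 2 <= \sum_x f x ^+ 2.
  rewrite [leRHS](bigID (ker s)) /= lerDl; apply: sumr_ge0 => x _; exact: sqr_ge0.
suff h2 : \sum_(x | ker s x) K x ^+ 2 <= d%:R * ((\sum_x g x ^+ 2) * (\sum_x w x ^+ 2)).
  apply: le_trans (_ : (\sum_x f x ^+ 2) * (d%:R * ((\sum_x g x ^+ 2) * (\sum_x w x ^+ 2))) <= _).
    apply: ler_pM => //; apply: sumr_ge0 => x _; exact: sqr_ge0.
  by rewrite mulrCA !mulrA.
(* These support conditions are invariant under (y, z) -> (z - x, x + y), which performs the swap;
   [F] can therefore be averaged over it. *)
pose c (x y z : 'I_L.+1) := [&& ker t y, ker u z, ker t (z - x) & ker u (x + y)].
pose F (x y z : 'I_L.+1) : R := if c x y z then (g y * w z) ^+ 2 else 0.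
have Fsym x : \sum_y \sum_z F x (z - x) (x + y) = \sum_y \sum_z F x y z.
  transitivity (\sum_y \sum_z F x z (x + y)).
    apply: eq_bigr => y _; rewrite (reindex_inj (addIr x)) /=; apply: eq_bigr => z _.
    by rewrite addrK.
  rewrite exchange_big /=; apply: eq_bigr => y _.
  by rewrite -(reindex_inj (addrI x) (P := predT) (F := fun z => F x y z)).
(* Here z stands for x + y', and 2 p q <= p^2 + q^2 is applied to p = g(y) w(z) and q = g(z - x) w(x
   + y). *)
have hK x : K x ^+ 2 <= \sum_y \sum_z F x y z.
  have -> : \sum_y \sum_z F x y z =
      \sum_y \sum_z (F x y z + F x (z - x) (x + y)) / 2.
    under [RHS]eq_bigr do rewrite -big_distrl /= big_split /=.
    by rewrite -big_distrl big_split /= Fsym -mulr2n -[X in _ = X / 2]mulr_natl mulrAC divff ?mul1r ?pnatr_eq0.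
  have -> : K x ^+ 2 = \sum_y \sum_z g y * w (x + y) * (g (z - x) * w z).
    rewrite expr2 {2}/K (reindex_inj (addIr (- x))) /= /K big_distrlr /=.
    apply: eq_bigr => y _; apply: eq_bigr => z _.
    by rewrite [x + (z - x)]addrC subrK.
  apply: ler_sum => y _; apply: ler_sum => z _.
  have cs : c x (z - x) (x + y) = c x y z.
    rewrite /c [x + y - x]addrC addKr [x + (z - x)]addrC subrK.
    by apply/idP/idP => /and4P[-> -> -> ->].
  rewrite /F cs; case hc: (c x y z).
    have := sqr_ge0 (g y * w z - g (z - x) * w (x + y)); lra.
  suff -> : g y * w (x + y) * (g (z - x) * w z) = 0 by rewrite addr0 mul0r.
  apply/eqP; apply: contraFT hc; rewrite !mulf_eq0 !negb_or -andbA.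
  by case/and4P => /hg h3 /hw h4 /hg h5 /hw h6; rewrite /c h3 h4 h5 h6.
apply: le_trans (_ : \sum_(x | ker s x) \sum_y \sum_z F x y z <= _).
  by apply: ler_sum => x _; exact: hK.
rewrite exchange_big big_distrlr big_distrr /=; apply: ler_sum => y _.
rewrite exchange_big big_distrr /=; apply: ler_sum => z _.
rewrite -big_mkcondr sumr_const /= -[leLHS]mulr_natl exprMn; apply: ler_wpM2r.
  by apply: mulr_ge0; exact: sqr_ge0.
rewrite ler_nat; apply: ker_card => // x1 x2.
move=> /andP[a1 /and4P[_ _ a2 a3]] /andP[b1 /and4P[_ _ b2 b3]].
apply: ker_gcd; first apply: ker_gcd.
- exact: kerB.
- have -> : x1 - x2 = (z - x2) - (z - x1) by rewrite opprB [RHS]addrC addrA subrK.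
  exact: kerB.
- have -> : x1 - x2 = (x1 + y) - (x2 + y) by rewrite opprD addrACA subrr addr0.
  exact: kerB.
Qed.

Definition conv (R : pzRingType) (L : nat) (F H : 'I_L.+1 -> R) (z : 'I_L.+1) : R :=
  \sum_x F x * H (z - x).

Definition mass (R : pzRingType) (L : nat) (F : 'I_L.+1 -> R) (u : nat) : R :=
  \sum_(x | zorder x == u) F x ^+ 2.

Lemma conv_ge0 (R : numDomainType) (L : nat) (F H : 'I_L.+1 -> R) :
  (forall x, 0 <= F x) -> (forall x, 0 <= H x) -> forall z, 0 <= conv F H z.
Proof. by move=> hF hH z; apply: sumr_ge0 => x _; rewrite mulr_ge0. Qed.

Lemma mass_ge0 (R : numDomainType) (L : nat) (F : 'I_L.+1 -> R) u :
  (forall x, 0 <= F x) -> 0 <= mass F u.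
Proof. by move=> hF; apply: sumr_ge0 => x _; rewrite exprn_ge0. Qed.

(** For fixed u an allowed pair is s = d x y, t = d x z with d y z = u, so it is determined by x and
    the two divisors d, y of u. Its weight is 1 / x, and tau(t) <= tau(x) tau(d z) <= tau(x) tau(u);
    the choice of d and y costs two further factors tau(u). *)
Lemma allowed_sum (R : realFieldType) (K B j u : nat) :
  (0 < u)%N ->
  \sum_(s < K) \sum_(t < K | allowed s t u && (s <= B)%N)
     ((gcdn (s %/ gcdn (gcdn s t) u) (t %/ gcdn (gcdn s t) u))%:R)^-1 * (tau t)%:R ^+ j
   <= (\sum_(x < B.+1) (tau x)%:R ^+ j / x%:R) * (tau u)%:R ^+ j.+2 :> R.
Proof.
move=> u0; rewrite pair_big_dep /=.
have E : (\sum_(x < B.+1) (tau x)%:R ^+ j / x%:R) * (tau u)%:R ^+ j.+2 =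
   \sum_(q : 'I_B.+1 * ('I_u.+1 * 'I_u.+1) | (q.2.1 %| u)%N && (q.2.2 %| u)%N)
     (tau q.1)%:R ^+ j * (tau u)%:R ^+ j / q.1%:R :> R.
  rewrite -(pair_big predT (fun p : 'I_u.+1 * 'I_u.+1 => (p.1 %| u)%N && (p.2 %| u)%N)
     (fun (x : 'I_B.+1) p => (tau x)%:R ^+ j * (tau u)%:R ^+ j / x%:R)) /=.
  rewrite big_distrl /=; apply: eq_bigr => x _.
  rewrite -(pair_big (fun d : 'I_u.+1 => (d %| u)%N) (fun d : 'I_u.+1 => (d %| u)%N)
     (fun _ _ => (tau x)%:R ^+ j * (tau u)%:R ^+ j / x%:R)) /=.
  rewrite !sumr_const -!mulrnA.
  have -> : #|(fun i : 'I_u.+1 => (i %| u)%N)| = tau u.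
    rewrite (tau_sum u0 (ltnSn u)) -sum1_card [LHS]big_mkcond /=; apply: eq_bigr => i _.
    by rewrite unfold_in; case: (i %| u)%N.
  rewrite -[RHS]mulr_natl natrM [in LHS]exprS [in LHS]exprS; ring.
rewrite E.
pose d (p : 'I_K * 'I_K) := gcdn (gcdn p.1 p.2) u.
pose xx (p : 'I_K * 'I_K) := gcdn (p.1 %/ d p) (p.2 %/ d p).
pose yy (p : 'I_K * 'I_K) := gcdn (p.1 %/ d p) (u %/ d p).
pose zz (p : 'I_K * 'I_K) := gcdn (p.2 %/ d p) (u %/ d p).
pose h (p : 'I_K * 'I_K) := ((inord (xx p) : 'I_B.+1), ((inord (d p) : 'I_u.+1), (inord (yy p) : 'I_u.+1))).
have hx (p : 'I_K * 'I_K) : allowed p.1 p.2 u && (p.1 <= B)%N -> [/\ (inord (xx p) : 'I_B.+1) = xx p :> nat,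
    (inord (d p) : 'I_u.+1) = d p :> nat, (inord (yy p) : 'I_u.+1) = yy p :> nat &
    [/\ (d p %| u)%N, (yy p %| u)%N, (0 < d p)%N & [/\ (p.1 : nat) = d p * xx p * yy p,
     (p.2 : nat) = d p * xx p * zz p & u = d p * yy p * zz p]%N]].
  case/andP => ha pB; have [d0 e1 e2 e3] := allowed_split ha.
  have p10 : (0 < p.1)%N by case/andP: ha.
  have {}e1 : (p.1 : nat) = (d p * xx p * yy p)%N := e1.
  have {}e2 : (p.2 : nat) = (d p * xx p * zz p)%N := e2.
  have {}e3 : u = (d p * yy p * zz p)%N := e3.
  have du : (d p %| u)%N by rewrite dvdn_gcdr.
  have yu : (yy p %| u)%N by rewrite [X in (_ %| X)%N]e3 mulnAC dvdn_mull.
  split => //; rewrite inordK // ltnS.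
  - apply: leq_trans pB; apply: dvdn_leq => //.
    by rewrite e1 mulnAC dvdn_mull.
  - exact: dvdn_leq.
  - exact: dvdn_leq.
pose G (q : 'I_B.+1 * ('I_u.+1 * 'I_u.+1)) : R := (tau q.1)%:R ^+ j * (tau u)%:R ^+ j / q.1%:R.
apply: (@le_trans _ _ (\sum_(p : 'I_K * 'I_K | allowed p.1 p.2 u && (p.1 <= B)%N) G (h p))).
  apply: ler_sum => -[s t] hp; have [h1 h2 h3 [_ _ d0 [e1 e2 e3]]] := hx _ hp.
  rewrite /G /h /= h1 mulrC -/(d (s, t)) -[gcdn _ _]/(xx (s, t)).
  rewrite ler_wpM2r ?invr_ge0 // -exprMn lerXn2r ?nnegrE ?mulr_ge0 // -natrM ler_nat.
  have t0 : (0 < t)%N by case/andP: hp => /and5P[].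
  rewrite /= in e2; rewrite e2 mulnAC mulnC.
  move: t0; rewrite e2 !muln_gt0 => /andP[/andP[_ x0] z0].
  apply: leq_trans (tauM x0 _) _; first by rewrite muln_gt0 d0.
  rewrite leq_mul2l; apply/orP; right; apply: tau_dvd => //.
  by rewrite [X in (_ %| X)%N]e3 mulnAC dvdn_mulr.
apply: (@sum_inj_le _ _ _ _ _ h G).
- move=> p q hp hq [/(congr1 val) /= f1 /(congr1 val) /= f2 /(congr1 val) /= f3].
  have [h1 h2 h3 [_ _ d0 [e1 e2 e3]]] := hx _ hp.
  have [k1 k2 k3 [_ _ _ [l1 l2 l3]]] := hx _ hq.
  rewrite h1 k1 in f1; rewrite h2 k2 in f2; rewrite h3 k3 in f3.
  have y0 : (0 < yy p)%N by move: u0; rewrite {1}e3 !muln_gt0 => /andP[/andP[]].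
  have fz : zz p = zz q.
    apply/eqP; rewrite -(@eqn_pmul2l (d p * yy p)) ?muln_gt0 ?d0 // -e3.
    by rewrite f2 f3 -l3.
  rewrite -f1 -f2 -f3 in l1; rewrite -f1 -f2 -fz in l2.
  by case: p q e1 e2 l1 l2 {hp hq h1 h2 h3 e3 k1 k2 k3 l3 f1 f2 f3 fz d0 y0} => [p1 p2] [q1 q2] /= e1 e2 l1 l2; congr (_, _); apply: val_inj; rewrite /= ?e1 ?e2 ?l1 ?l2.
- by move=> p /hx [_ h2 h3 [g1 g2 _ _]]; rewrite /= h2 h3 g1 g2.
- by move=> q _; rewrite /G !mulr_ge0 ?exprn_ge0 ?invr_ge0.
Qed.

(** The mass W at order u is a trilinear form in F, H and the order-u part of their convolution. Cut
    by the orders s and t, each block is bounded by [trilinear]; as d / (s t) = 1 / (x^2 u), the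
    block is at most sqrt (X2 Y2 W / u) tau(t)^j / x, and [allowed_sum] adds the blocks up. Squaring
    and cancelling W finishes. *)
Lemma conv_mass_le (R : rcfType) (L B j : nat) (F H : 'I_L.+1 -> R) (X2 Y2 : R) :
  (forall x, 0 <= F x) -> (forall x, 0 <= H x) -> 0 <= X2 -> 0 <= Y2 ->
  (forall x, F x != 0 -> (zorder x <= B)%N) ->
  (forall s, (0 < s)%N -> mass F s <= X2 / s%:R) ->
  (forall t, (0 < t)%N -> mass H t <= Y2 * (tau t)%:R ^+ (2 * j) / t%:R) ->
  forall u, (0 < u)%N ->
  mass (conv F H) u <=
    X2 * Y2 * (\sum_(x < B.+1) (tau x)%:R ^+ j / x%:R) ^+ 2 * (tau u)%:R ^+ (2 * j.+2) / u%:R.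
Proof.
move=> F0 H0 X0 Y0 FB hF hH u u0.
set g := \sum_(x < B.+1) _.
have g0 : 0 <= g by apply: sumr_ge0 => x _; rewrite mulr_ge0 ?exprn_ge0 ?invr_ge0.
set W := mass _ u.
have W0 : 0 <= W by apply: mass_ge0; exact: conv_ge0.
pose K := L.+2.
pose res (f : 'I_L.+1 -> R) s x := if zorder x == s then f x else 0.
have res0 f s x : (forall x, 0 <= f x) -> 0 <= res f s x by rewrite /res; case: ifP.
have ressum f x : f x = \sum_(s < K) res f s x.
  rewrite (bigD1 (Ordinal (zorder_le x))) //= /res eqxx big1 ?addr0 // => i.
  by rewrite -val_eqE /= eq_sym => /negbTE ->.
have resmass f s : \sum_x res f s x ^+ 2 = mass f s.
  rewrite /mass [RHS]big_mkcond; apply: eq_bigr => x _; rewrite /res.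
  by case: ifP => // _; rewrite expr0n.
pose w := res (conv F H) u.
have w0 x : 0 <= w x by apply: res0; exact: conv_ge0.
pose T s t := \sum_z \sum_x res F s x * res H t (z - x) * w z.
have EW : W = \sum_(s < K) \sum_(t < K) T s t.
  rewrite /W -resmass.
  transitivity (\sum_z \sum_x \sum_(s < K) \sum_(t < K) res F s x * res H t (z - x) * w z).
    apply: eq_bigr => z _.
    transitivity (conv F H z * w z).
      by rewrite /w /res; case: ifP => _; rewrite ?expr0n ?mulr0 // expr2.
    rewrite /conv big_distrl; apply: eq_bigr => x _ /=.
    rewrite (ressum F x) (ressum H (z - x)) big_distrlr big_distrl /=; apply: eq_bigr => s _.
    by rewrite big_distrl.
  rewrite /T; under eq_bigr do rewrite exchange_big /=.
  rewrite exchange_big; apply: eq_bigr => s _ /=.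
  by under eq_bigr do rewrite exchange_big /=; rewrite exchange_big.
pose V := X2 * Y2 / u%:R.
have V0 : 0 <= V by rewrite !mulr_ge0 ?invr_ge0.
pose xx (s t : nat) : R := ((gcdn (s %/ gcdn (gcdn s t) u) (t %/ gcdn (gcdn s t) u))%:R)^-1.
have hT (s t : nat) : T s t <= if allowed s t u && (s <= B)%N
    then Num.sqrt (V * W) * (xx s t * (tau t)%:R ^+ j) else 0.
  case: ifP => ha; last first.
    rewrite /T big1 // => z _; rewrite big1 // => x _.
    apply/eqP; apply: contraFT ha; rewrite !mulf_eq0 !negb_or -andbA /w /res.
    case: (eqVneq (zorder x) s) => [es|]; last by rewrite eqxx.
    case: (eqVneq (zorder (z - x)) t) => [et|]; last by rewrite eqxx andbF.
    case: (eqVneq (zorder z) u) => [eu|]; last by rewrite eqxx !andbF.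
    case/and3P => Fx _ _; rewrite -es FB // andbT -et -eu.
    have := allowed_zorder x (z - x); by rewrite [x + _]addrC subrK.
  case/andP: ha => ha sB.
  have [d0 e1 e2 e3] := allowed_split ha.
  set d := gcdn (gcdn s t) u in d0 e1 e2 e3.
  have [s0 t0] : (0 < s)%N /\ (0 < t)%N by case/and5P: ha.
  rewrite -[leRHS]ger0_norm; last first.
    by rewrite !mulr_ge0 ?sqrtr_ge0 ?invr_ge0 ?exprn_ge0.
  apply: (le_trans (ler_norm _)).
  rewrite -ler_sqr ?nnegrE ?normr_ge0 // !real_normK ?num_real //.
  have := @trilinear R L s t u (res F s) (res H t) w s0.
  rewrite -/d !resmass => /(_ _ _ _)/le_trans; apply.
  - by move=> x; rewrite /res ker_zorder; case: ifP => [/eqP -> _|_]; rewrite ?dvdnn ?eqxx.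
  - by move=> x; rewrite /res ker_zorder; case: ifP => [/eqP -> _|_]; rewrite ?dvdnn ?eqxx.
  - by move=> x; rewrite /w /res ker_zorder; case: ifP => [/eqP -> _|_]; rewrite ?dvdnn ?eqxx.
  rewrite -/W exprMn sqr_sqrtr ?(mulr_ge0 V0 W0) //.
  apply: (@le_trans _ _ (d%:R * (X2 / s%:R * (Y2 * (tau t)%:R ^+ (2 * j) / t%:R) * W))).
    rewrite ler_wpM2l // ler_wpM2r // ler_pM ?mass_ge0 ?hF ?hH //.
  rewrite /xx -/d.
  have -> : s%:R = (d * gcdn (s %/ d) (t %/ d) * gcdn (s %/ d) (u %/ d))%:R :> R by rewrite -e1.
  have -> : (t%:R)^-1 = ((d * gcdn (s %/ d) (t %/ d) * gcdn (t %/ d) (u %/ d))%:R)^-1 :> R by rewrite -e2.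
  rewrite /V.
  have -> : (u%:R)^-1 = ((d * gcdn (s %/ d) (u %/ d) * gcdn (t %/ d) (u %/ d))%:R)^-1 :> R by rewrite -e3.
  have x0 : (0 < gcdn (s %/ d) (t %/ d))%N by move: s0; rewrite {1}e1 !muln_gt0 => /andP[/andP[]].
  have y0 : (0 < gcdn (s %/ d) (u %/ d))%N by move: s0; rewrite {1}e1 !muln_gt0 => /andP[/andP[]].
  have z0 : (0 < gcdn (t %/ d) (u %/ d))%N by move: t0; rewrite {1}e2 !muln_gt0 => /andP[/andP[]].
  move: x0 y0 z0; set x := gcdn _ _; set y := gcdn _ _; set z := gcdn _ _ => x0 y0 z0.
  rewrite !natrM exprMn -exprM [(j * 2)%N]mulnC exprVn.
  have [hd hx hy hz] : [/\ d%:R != 0 :> R, x%:R != 0 :> R, y%:R != 0 :> R & z%:R != 0 :> R].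
    by split; rewrite pnatr_eq0 -lt0n.
  move: (d%:R : R) (x%:R : R) (y%:R : R) (z%:R : R) hd hx hy hz => dr xr yr zr hd hx hy hz.
  rewrite le_eqVlt; apply/orP; left; apply/eqP; field.
  by rewrite hd hx hy hz.
have hW : W <= Num.sqrt (V * W) * (g * (tau u)%:R ^+ j.+2).
  rewrite {1}EW; apply: (@le_trans _ _ (\sum_(s < K) \sum_(t < K | allowed s t u && (s <= B)%N)
     Num.sqrt (V * W) * (xx s t * (tau t)%:R ^+ j))).
    by apply: ler_sum => i _; rewrite [leRHS]big_mkcond; apply: ler_sum => k _; exact: hT.
  under eq_bigr do rewrite -big_distrr /=.
  rewrite -big_distrr /= ler_wpM2l ?sqrtr_ge0 //; exact: allowed_sum.
have [->|Wn] := eqVneq W 0.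
  by apply: divr_ge0 => //; apply: mulr_ge0; rewrite ?exprn_ge0 // mulr_ge0 // ?mulr_ge0 // exprn_ge0.
have Wp : 0 < W by rewrite lt_def Wn.
have : W ^+ 2 <= (Num.sqrt (V * W) * (g * (tau u)%:R ^+ j.+2)) ^+ 2.
  rewrite ler_sqr ?nnegrE //; apply: mulr_ge0; first exact: sqrtr_ge0.
  by apply: mulr_ge0 => //; exact: exprn_ge0.
rewrite exprMn sqr_sqrtr ?(mulr_ge0 V0 W0) // [V * W]mulrC -[W * V * _]mulrA [W ^+ 2]expr2 ler_pM2l // => h.
apply: (le_trans h); rewrite le_eqVlt; apply/orP; left; apply/eqP.
by rewrite /V exprMn -exprM [(_ * 2)%N]mulnC; ring.
Qed.

(** The index m stands for m + 1 factors F, so index 0 is F itself and not a delta function. *)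
Fixpoint convpow (R : pzRingType) (L : nat) (F : 'I_L.+1 -> R) (m : nat) : 'I_L.+1 -> R :=
  if m is m'.+1 then conv F (convpow F m') else F.

Lemma convpow_ge0 (R : numDomainType) (L : nat) (F : 'I_L.+1 -> R) m :
  (forall x, 0 <= F x) -> forall z, 0 <= convpow F m z.
Proof. by move=> F0; elim: m => //= m IH; exact: conv_ge0. Qed.

Lemma convpow_supp (R : numDomainType) (L B : nat) (F : 'I_L.+1 -> R) m :
  (forall x, F x != 0 -> (zorder x <= B)%N) ->
  forall z, convpow F m z != 0 -> (zorder z <= B ^ m.+1)%N.
Proof.
move=> hF; elim: m => [|m IH] z /=; first by rewrite expn1; exact: hF.
apply: contraR; rewrite -ltnNge => hz; apply/eqP; apply: big1 => x _.
apply/eqP; rewrite mulf_eq0 -[_ || _]negbK negb_or; apply/negP => /andP[/hF h1 /IH h2].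
have : ker (zorder x * zorder (z - x)) z.
  have e : z = x + (z - x) by rewrite [x + _]addrC subrK.
  rewrite [X in ker _ X]e.
  by apply: kerD; rewrite ker_zorder; [exact: dvdn_mulr | exact: dvdn_mull].
rewrite ker_zorder => /dvdn_leq; rewrite muln_gt0 !zorder_gt0 => /(_ isT) h3.
by move: hz; rewrite ltnNge expnS (leq_trans h3) // leq_mul.
Qed.

(** Induction with [conv_mass_le] at j = 2 m: a convolution raises the exponent of tau(u) by 4 and
    costs the square of a divisor sum, a power 2 * 4^m of 1 + log B; the exponent 4^(m + 1) leaves
    room for all of these. *)
Lemma convpow_mass (R : realType) (L B m : nat) (F : 'I_L.+1 -> R) (X2 La : R) :
  (0 < B)%N -> 1 + ln B%:R <= La ->
  (forall x, 0 <= F x) -> 0 <= X2 ->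
  (forall x, F x != 0 -> (zorder x <= B)%N) ->
  (forall s, (0 < s)%N -> mass F s <= X2 / s%:R) ->
  forall u, (0 < u)%N ->
  mass (convpow F m) u <= X2 ^+ m.+1 * La ^+ (4 ^ m.+1) * (tau u)%:R ^+ (2 * (2 * m)) / u%:R.
Proof.
move=> B0 hL F0 X0 FB hF.
have L1 : 1 <= La by apply: le_trans hL; rewrite lerDl ln_ge0 // ler1n.
elim: m => [|m IH] u u0.
  rewrite /= expr1 !muln0 expr0 mulr1; apply: le_trans (hF _ u0) _.
  by rewrite ler_wpM2r ?invr_ge0 // ler_peMr // exprn_ege1.
have Y0 : 0 <= X2 ^+ m.+1 * La ^+ (4 ^ m.+1).
  by rewrite mulr_ge0 ?exprn_ge0 // (le_trans ler01).
apply: le_trans (conv_mass_le F0 (convpow_ge0 m F0) X0 Y0 FB hF IH u0) _.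
have -> : (2 * m.+1 = (2 * m).+2)%N by rewrite mulnS add2n.
rewrite -/(tausum R (2 * m) B).
rewrite ler_wpM2r ?invr_ge0 // ler_wpM2r ?exprn_ge0 // [X2 * (_ * _)]mulrA -exprS -[leLHS]mulrA ler_wpM2l ?exprn_ge0 //.
have h : tausum R (2 * m) B ^+ 2 <= La ^+ (2 ^ (2 * m)).+1.*2.
  rewrite -muln2 exprM lerXn2r ?nnegrE ?tausum_ge0 ?exprn_ge0 ?(le_trans ler01) //.
  apply: le_trans (tausum_le R _ B0) _.
  apply: (@le_trans _ _ (La ^+ (2 ^ (2 * m)))).
    by rewrite lerXn2r ?nnegrE ?(le_trans ler01) // lerDl ln_ge0 // ler1n.
  by apply: ler_weXn2l.
apply: le_trans (ler_wpM2l _ h) _; first by rewrite exprn_ge0 // (le_trans ler01).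
rewrite -exprD ler_weXn2l // expnM -[(2 ^ 2)%N]/4%N.
have := expn_gt0 4 m; rewrite !expnS; lia.
Qed.

(** Orders in the support reach B^(m + 1), which is why La dominates 1 + (m + 1) log B; summing
    tau(u)^(4 m) / u over them costs a power 16^m of La. *)
Lemma convpow_energy (R : realType) (L B m : nat) (F : 'I_L.+1 -> R) (X2 La : R) :
  (0 < B)%N -> 1 + m.+1%:R * ln B%:R <= La ->
  (forall x, 0 <= F x) -> 0 <= X2 ->
  (forall x, F x != 0 -> (zorder x <= B)%N) ->
  (forall s, (0 < s)%N -> mass F s <= X2 / s%:R) ->
  \sum_z convpow F m z ^+ 2 <= X2 ^+ m.+1 * La ^+ (2 * 16 ^ m.+1).
Proof.
move=> B0 hL F0 X0 FB hF.
have lB0 : 0 <= ln (B%:R : R) by rewrite ln_ge0 // ler1n.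
have L1 : 1 <= La by apply: le_trans hL; rewrite lerDl mulr_ge0.
have L0 : 0 <= La := le_trans ler01 L1.
have hL1 : 1 + ln B%:R <= La.
  by apply: le_trans hL; rewrite lerD2l ler_peMl // ler1n.
set D := (B ^ m.+1)%N.
have D0 : (0 < D)%N by rewrite expn_gt0 B0.
have -> : \sum_z convpow F m z ^+ 2 = \sum_(u < D.+1) mass (convpow F m) u.
  rewrite /mass (exchange_big_dep predT) //=; apply: eq_bigr => z _.
  have [->|zn] := eqVneq (convpow F m z) 0.
    by rewrite expr0n big1 // => i _.
  have hz := convpow_supp FB zn.
  rewrite (big_pred1 (inord (zorder z))) // => i /=.
  by rewrite -val_eqE /= inordK // eq_sym.
apply: (@le_trans _ _ (\sum_(u < D.+1) X2 ^+ m.+1 * La ^+ (4 ^ m.+1) *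
    ((tau u)%:R ^+ (2 * (2 * m)) / u%:R))).
  apply: ler_sum => u _; have [u0|u0] := posnP u.
    rewrite u0 /mass big_pred0 ?invr0 ?mulr0 // => x.
    by rewrite gtn_eqF // zorder_gt0.
  by apply: le_trans (convpow_mass m B0 hL1 F0 X0 FB hF u0) _; rewrite mulrA.
rewrite -big_distrr /= -/(tausum R _ D) -mulrA ler_wpM2l ?exprn_ge0 //.
have h : tausum R (2 * (2 * m)) D <= La ^+ (2 ^ (2 * (2 * m))).
  apply: le_trans (tausum_le R _ D0) _.
  rewrite lerXn2r ?nnegrE // ?addr_ge0 ?ln_ge0 ?ler1n //.
  by apply: le_trans hL; rewrite /D natrX lnXn ?ltr0n // mulr_natl.
apply: le_trans (ler_wpM2l _ h) _; first by rewrite exprn_ge0.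
rewrite -exprD ler_weXn2l // !expnM -[((2 ^ 2) ^ 2)%N]/16%N.
have := leq_exp2r 4 16 (ltn0Sn m); have := expn_gt0 16 m; rewrite (expnS 16); lia.
Qed.

(** * Weyl sums *)

Lemma complexReD (R : realType) (x y : R[i]) : complex.Re (x + y) = complex.Re x + complex.Re y.
Proof. by case: x y => [a b] [c d]. Qed.

Lemma normc_sqD (R : realType) (x y : R[i]) :
  normc (x + y) ^+ 2 = normc x ^+ 2 + normc y ^+ 2 + 2 * complex.Re (y * conjc x).
Proof.
case: x y => [a b] [c d] /=.
by rewrite !sqr_sqrtr ?addr_ge0 ?sqr_ge0 //; ring.
Qed.

(** Multiplied out, the diagonal gives M and the pairs with difference k + 1 occur together with
    their conjugates. The identity [E] is exact, by induction on M: the new term z(M) adds one pair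
    to every difference. *)
Lemma van_der_corput (R : realType) (z : nat -> R[i]) (M : nat) :
  (forall n, normc (z n) = 1) ->
  normc (\sum_(n < M) z n) ^+ 2 <=
    M%:R + 2 * \sum_(k < M) normc (\sum_(y < M - k.+1) z (y + k.+1)%N * conjc (z y)).
Proof.
move=> hz.
have E : normc (\sum_(n < M) z n) ^+ 2 =
    M%:R + 2 * complex.Re (\sum_(k < M) \sum_(y < M - k.+1) z (y + k.+1)%N * conjc (z y)).
  elim: M => [|M IH]; first by rewrite !big_ord0 normc0 expr0n mulr0 addr0.
  rewrite big_ord_recr normc_sqD IH hz expr1n [X in _ = _ + 2 * complex.Re X]big_ord_recr /=.
  rewrite subnn big_ord0 addr0 -natr1.
  have -> : \sum_(k < M) \sum_(y < M.+1 - k.+1) z (y + k.+1)%N * conjc (z y) =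
     \sum_(k < M) \sum_(y < M - k.+1) z (y + k.+1)%N * conjc (z y) +
     z M * conjc (\sum_(n < M) z n).
    rewrite conjc_sum big_distrr /=.
    rewrite [X in _ = _ + X](reindex_inj rev_ord_inj) -big_split /=.
    apply: eq_bigr => k _; rewrite subSS.
    have -> : (M - k = (M - k.+1).+1)%N by rewrite subnSK.
    rewrite big_ord_recr /=; congr (_ + z _ * _).
    by rewrite subnK.
  by rewrite complexReD mulrDr; ring.
rewrite E lerD2l ler_pM2l //.
apply: le_trans (ler_norm _) _; apply: le_trans (normc_Re_le _) _.
exact: normc_sum.
Qed.

Definition quad (al be ga n : nat) : nat := (al * n ^ 2 + be * n + ga)%N.

Lemma quad_diff (R : realType) (al be ga : nat) (th : R) (y k : nat) :
  cis (th * (quad al be ga (y + k))%:R) * conjc (cis (th * (quad al be ga y)%:R))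
  = cis (th * (al * k ^ 2 + be * k)%:R) * cis (y%:R * (k%:R * (2 * al%:R * th))).
Proof.
rewrite -cisN -!cisD /quad -!mulnn; congr cis.
by rewrite !(natrD, natrM); ring.
Qed.

Lemma cisDnat (R : realType) (n : nat) (t : R) : cis (n%:R + t) = cis t.
Proof. by rewrite cisD cis_nat mul1r. Qed.

(** Differencing leaves linear phases; of the resulting geometric sums only the trivial bound M and
    the bound by the chord are recorded in [G]. *)
Lemma weyl_diff (R : realType) (al be ga M : nat) (th : R) :
  exists2 G : nat -> R,
    (forall k, (0 < k)%N -> [/\ 0 <= G k, G k <= M%:R &
        G k * normc (cis (k%:R * (2 * al%:R * th)) - 1) <= 2]) &
    normc (\sum_(n < M) cis (th * (quad al be ga n)%:R)) ^+ 2 <=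
      M%:R + 2 * \sum_(k < M.+1 | (0 < k)%N) G k.
Proof.
exists (fun k => normc (\sum_(y < M - k) cis (y%:R * (k%:R * (2 * al%:R * th))))).
  move=> k k0; split; first exact: normc_ge0.
    apply: le_trans (normc_cis_sum_le (M - k) (fun y => y%:R * (k%:R * (2 * al%:R * th)))) _.
    by rewrite ler_nat leq_subr.
  exact: cis_geom_le.
apply: le_trans (van_der_corput (z := fun n => cis (th * (quad al be ga n)%:R)) M _) _.
  by move=> n; exact: normc_cis.
rewrite lerD2l ler_pM2l // [leRHS]big_mkcond big_ord_recl /= add0r.
apply: ler_sum => k _; rewrite /bump add1n.
under eq_bigr do rewrite quad_diff.
by rewrite -big_distrr /= normcM normc_cis mul1r.
Qed.

(** In each block of s consecutive k the residues of k a run once through all classes modulo s. *)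
Lemma sum_residues (R : numDomainType) (s a M : nat) (phi : nat -> R) :
  (0 < s)%N -> coprime a s -> (forall b, 0 <= phi b) ->
  \sum_(k < M) phi ((k * a) %% s)%N <= (M %/ s).+1%:R * \sum_(b < s) phi b.
Proof.
move=> s0 cas phi0.
have E q : \sum_(k < q * s) phi ((k * a) %% s)%N = q%:R * \sum_(b < s) phi b.
  elim: q => [|q IH]; first by rewrite big_ord0 mul0r.
  rewrite mulSn addnC big_split_ord /= IH -natr1 mulrDl mul1r; congr (_ + _).
  have hlt (b : 'I_s) : ((b * a) %% s < s)%N by rewrite ltn_pmod.
  rewrite (eq_bigr (fun b : 'I_s => phi (Ordinal (hlt b)))); last first.
    by move=> b _; rewrite /= mulnDl mulnAC modnMDl.
  rewrite [RHS](reindex_inj (h := fun b : 'I_s => Ordinal (hlt b))) //.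
  move=> b c /(congr1 val) /= /eqP h; apply: val_inj => /=.
  wlog bc : b c h / (b <= c)%N.
    by move=> hw; case/orP: (leq_total b c) => l; [|symmetry]; apply: hw; rewrite // eq_sym.
  move: h; rewrite eq_sym eqn_mod_dvd ?leq_mul2r ?bc ?orbT // -mulnBl Gauss_dvdl 1?coprime_sym //.
  case: (posnP (c - b)) => [/eqP|cb0 /(dvdn_leq cb0)].
    by rewrite subn_eq0 => cb _; apply/eqP; rewrite eqn_leq bc cb.
  by rewrite leqNgt (leq_ltn_trans (leq_subr _ _)).
rewrite -E.
have hM : (M <= (M %/ s).+1 * s)%N by rewrite ltnW // ltn_ceil.
rewrite -(subnKC hM) big_split_ord /= lerDl.
by apply: sumr_ge0.
Qed.

Lemma sum_shift_inv (R : realType) (X : nat) (c : R) : 0 < c ->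
  \sum_(j < X.+1 | (0 < j)%N) (j%:R + c)^-1 <= ln (1 + X%:R / c).
Proof.
move=> c0; elim: X => [|X IH].
  by rewrite big_mkcond big_ord_recl big_ord0 /= mul0r !addr0 ln1.
rewrite big_mkcond big_ord_recr /= -big_mkcond /=.
apply: le_trans (lerD IH (lexx _)) _.
have Xc : 0 < X%:R + c by rewrite ltr_wpDl.
have Xc1 : 0 < X.+1%:R + c by rewrite ltr_wpDl.
have e n : 1 + n%:R / c = (n%:R + c) / c :> R.
  by rewrite mulrDl divff ?gt_eqF // addrC.
rewrite !e !ln_div ?posrE // addrAC lerD2r -lerBrDl.
have -> : ln (X.+1%:R + c) - ln (X%:R + c) = - ln (1 - (X.+1%:R + c)^-1).
  rewrite -ln_div ?posrE // -lnV ?posrE; last first.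
    rewrite subr_gt0 invf_lt1 // -natr1; have : (0:R) <= X%:R by []; lra.
  congr ln; rewrite -[X.+1%:R]natr1; set u := X%:R + c in Xc *.
  have -> : X%:R + 1 + c = u + 1 by rewrite addrAC.
  have u1 : u + 1 != 0 by rewrite gt_eqF // ltr_wpDr.
  have -> : 1 - (u + 1)^-1 = u / (u + 1) by field.
  by rewrite invf_div.
rewrite lerNr; apply: le_ln1Dx.
by rewrite ltrN2 invf_lt1 // -natr1; have : (0:R) <= X%:R by []; lra.
Qed.

Lemma sum_multiples (R : numDomainType) (M s : nat) (b : nat -> R) :
  (0 < s)%N -> (forall j, 0 <= b j) ->
  \sum_(k < M.+1 | (0 < k)%N && (s %| k)%N) b (k %/ s)%N
    <= \sum_(j < (M %/ s).+1 | (0 < j)%N) b j.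
Proof.
move=> s0 b0.
have hlt (k : 'I_M.+1) : (k %/ s < (M %/ s).+1)%N by rewrite ltnS leq_div2r // -ltnS.
apply: (@sum_inj_le _ _ _ _ _ (fun k : 'I_M.+1 => Ordinal (hlt k)) (fun j : 'I_(M %/ s).+1 => b j)) => //.
- move=> k l /andP[_ /= sk] /andP[_ /= sl] /(congr1 val) /= e.
  by apply: val_inj; rewrite /= -(divnK sk) e divnK.
- by move=> k /andP[k0 sk] /=; rewrite divn_gt0 // dvdn_leq.
Qed.

(** Merges a trivial bound, used for z <= 1, and a logarithmic one, used for z > 1, into a single
    expression valid for all z >= 0. *)
Lemma log_decay (R : realType) (T V z : R) : 0 <= z -> 0 <= V ->
  T <= V -> (0 < z -> T <= V * (2 * ln (1 + z) / z)) ->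
  T <= V * (4 * (1 + ln (1 + z)) / (1 + z)).
Proof.
move=> z0 V0 h1 h2; have l0 : 0 <= ln (1 + z) by rewrite ln_ge0 // lerDl.
have z1 : 0 < 1 + z by rewrite ltr_wpDr.
case: (leP z 1) => hz.
  apply: (le_trans h1); rewrite ler_peMr // ler_pdivlMr //; lra.
have zp : 0 < z := lt_trans ltr01 hz.
apply: (le_trans (h2 zp)); rewrite ler_wpM2l // ler_pdivrMr // mulrAC ler_pdivlMr //.
have : 0 <= ln (1 + z) * (z - 1) by rewrite mulr_ge0 // subr_ge0 ltW.
lra.
Qed.

(** Put xi = 2 al th. For k divisible by s, k xi is within k eta of an integer; these k give the
    main term M^2 / s with decay in M^2 eta. For other k the point k a / s has distance at least 1 /
    s from the integers, and 4 s M eta <= 1 keeps the drift below 1 / (4 s), so each block of s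
    values contributes about s log s. *)
Lemma weyl_bound (R : realType) (al be ga M s a : nat) (th eta : R) :
  (0 < M)%N -> (0 < s)%N -> coprime a s ->
  eta = `|2 * al%:R * th - a%:R / s%:R| -> 4 * s%:R * (M%:R * eta) <= 1 ->
  normc (\sum_(n < M) cis (th * (quad al be ga n)%:R)) ^+ 2 <=
   M%:R + 2 * (M%:R ^+ 2 / s%:R * (4 * (1 + ln (1 + M%:R ^+ 2 * eta)) / (1 + M%:R ^+ 2 * eta))
     + (M.+1 %/ s).+1%:R * (4 * s%:R * (1 + ln s%:R))).
Proof.
move=> M0 s0 cas eeta heta.
have Mp : 0 < M%:R :> R by rewrite ltr0n.
have sp : 0 < s%:R :> R by rewrite ltr0n.
have s1 : 1 <= s%:R :> R by rewrite ler1n.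
have e0 : 0 <= eta by rewrite eeta.
have [G hG hW] := weyl_diff al be ga M th; apply: (le_trans hW).
rewrite lerD2l ler_pM2l // (bigID (fun k : 'I_M.+1 => (s %| k)%N)) /=.
set xi := 2 * al%:R * th in eeta hG.
pose d := xi - a%:R / s%:R.
have hk (k : 'I_M.+1) : `|k%:R * d| <= M%:R * eta.
  by rewrite normrM ger0_norm // /d -eeta ler_wpM2r // ler_nat -ltnS.
have Me : M%:R * eta <= 1 / 4 / s%:R by rewrite ler_pdivlMr //; lra.
have is1 : s%:R^-1 <= 1 :> R by rewrite invf_le1.
have is0 : 0 < s%:R^-1 :> R by rewrite invr_gt0.
have exi (k : nat) : k%:R * xi = ((k * a) %/ s)%:R + (((k * a) %% s)%:R / s%:R + k%:R * d).
  rewrite /d mulrBr addrA; have : (k * a)%:R / s%:R = ((k * a) %/ s)%:R + ((k * a) %% s)%:R / s%:R :> R.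
    by rewrite {1}(divn_eq (k * a) s) natrD natrM mulrDl mulfK // gt_eqF.
  by rewrite natrM => h; rewrite -h; ring.
apply: lerD.
  apply: log_decay.
  - by rewrite mulr_ge0 ?exprn_ge0.
  - by rewrite mulr_ge0 ?exprn_ge0 // ltW.
  - apply: (@le_trans _ _ (\sum_(k < M.+1 | (0 < k)%N && (s %| k)%N) M%:R)).
      by apply: ler_sum => k /andP[k0 _]; case: (hG _ k0).
    apply: le_trans (@sum_multiples R M s (fun=> M%:R) s0 _) _ => //.
    rewrite big_mkcond big_ord_recl /= add0r sumr_const card_ord -[leLHS]mulr_natl.
    rewrite expr2 mulrAC ler_wpM2r // ler_pdivlMr // -natrM ler_nat.
    exact: leq_trunc_div.
  - move=> z0.
    have ep : 0 < eta by rewrite lt_def e0 andbT; apply: contraTneq z0 => ->; rewrite mulr0 ltxx.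
    (* With this shift s eta (k / s + c) = k eta + 1 / M, so the bounds G <= M and G k eta <= 1
       merge into G <= 2 / (k eta + 1 / M). *)
    pose c := (M%:R * s%:R * eta)^-1.
    have c0 : 0 < c by rewrite invr_gt0 !mulr_gt0.
    apply: (@le_trans _ _ (\sum_(k < M.+1 | (0 < k)%N && (s %| k)%N)
        2 / (s%:R * eta) * ((k %/ s)%:R + c)^-1)).
      apply: ler_sum => k /andP[k0 sk]; have [g0 gM gn] := hG _ k0.
      have : 2 * `|k%:R * d| <= normc (cis (k%:R * xi) - 1).
        rewrite exi cisDnat (_ : (k * a) %% s = 0)%N; last by apply/eqP; rewrite -/(dvdn _ _) dvdn_mulr.
        rewrite mul0r add0r; apply: normc_cisB1_ge.
        apply: le_trans (hk k) _; apply: (le_trans Me); lra.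
      rewrite normrM ger0_norm // /d -eeta => hn.
      have {}gn : G k * (2 * (k%:R * eta)) <= 2.
        by apply: le_trans gn; rewrite ler_wpM2l.
      rewrite -mulrA -invfM ler_pdivlMr; last first.
        by rewrite mulr_gt0 ?mulr_gt0 // ltr_wpDl.
      have -> : s%:R * eta * ((k %/ s)%:R + c) = k%:R * eta + M%:R^-1.
        have {2}-> : (k : nat) = (k %/ s * s)%N by rewrite divnK.
        by rewrite natrM /c; field; rewrite ?gt_eqF.
      rewrite mulrDr.
      have : G k * M%:R^-1 <= 1 by rewrite ler_pdivrMr // mul1r.
      lra.
    rewrite -big_distrr /=.
    apply: (@le_trans _ _ (2 / (s%:R * eta) * ln (1 + M%:R ^+ 2 * eta))).
      apply: ler_wpM2l; first by apply: divr_ge0 => //; apply: mulr_ge0.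
      apply: le_trans (@sum_multiples R M s (fun j => (j%:R + c)^-1) s0 _) _.
        by move=> j; rewrite invr_ge0 addr_ge0 // ltW.
      apply: le_trans (sum_shift_inv _ c0) _.
      have c1 : 0 <= (M %/ s)%:R / c by rewrite divr_ge0 // ltW.
      have z1 : 0 <= M%:R ^+ 2 * eta by rewrite mulr_ge0 // exprn_ge0.
      rewrite ler_ln ?posrE; [|exact: ltr_wpDr|exact: ltr_wpDr].
      rewrite lerD2l /c invrK expr2 !mulrA ler_wpM2r //.
      rewrite [_ * M%:R * _]mulrAC ler_wpM2r // -natrM ler_nat; exact: leq_trunc_div.
    rewrite le_eqVlt; apply/orP; left; apply/eqP; field.
    by rewrite ?gt_eqF.
(* The nearest integer may lie on either side, so the weight adds the bounds for the distances b / s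
   and (s - b) / s. *)
pose phi (b : nat) : R := 2 * s%:R * (b%:R^-1 + (s - b)%:R^-1).
have phi0 b : 0 <= phi b by rewrite /phi !mulr_ge0 ?addr_ge0 ?invr_ge0.
apply: (@le_trans _ _ (\sum_(k < M.+1) phi ((k * a) %% s)%N)).
  rewrite big_mkcond; apply: ler_sum => k _; case: ifP => // /andP[k0 sk].
  have [g0 gM gn] := hG _ k0.
  set b := ((k * a) %% s)%N.
  have bs : (b < s)%N by rewrite ltn_pmod.
  have b0 : (0 < b)%N by rewrite lt0n -/(dvdn _ _) Gauss_dvdl // coprime_sym.
  rewrite exi cisDnat -/b in gn.
  have hb : 1 <= b%:R :> R by rewrite ler1n.
  have hsb : 1 <= (s - b)%:R :> R by rewrite ler1n subn_gt0.
  have esb : (s - b)%:R = s%:R - b%:R :> R by rewrite natrB // ltnW.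
  have bp : 0 < b%:R :> R by rewrite ltr0n.
  have sbp : 0 < (s - b)%:R :> R by rewrite ltr0n subn_gt0.
  have hd := le_trans (hk k) Me.
  move: hd gn; set e := k%:R * d; set i : R := s%:R^-1 => hd gn.
  have hd' : e <= 1 / 4 * i /\ - (1 / 4 * i) <= e by move: hd; rewrite ler_norml => /andP[].
  case: hd' => hd1 hd2.
  have bi : i <= b%:R * i by rewrite ler_peMl // ltW.
  have sbi : i <= (s - b)%:R * i by rewrite ler_peMl // ltW.
  have sbE : (s - b)%:R * i = 1 - b%:R * i by rewrite esb mulrBl divff // gt_eqF.
  have fin (x : R) : 1 <= x -> G k * (x * i) <= 2 -> G k <= 2 * s%:R * x^-1.
    move=> x1 h; have xp : 0 < x by apply: lt_le_trans x1.
    by rewrite ler_pdivlMr // -ler_pdivrMr // -mulrA.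
  case: (leP (b%:R * i + e) (1 / 2)) => ht.
    have : 2 * `|b%:R * i + e| <= normc (cis (b%:R * i + e) - 1).
      apply: normc_cisB1_ge; rewrite ger0_norm //; lra.
    rewrite ger0_norm; last by lra.
    move=> hn; have : G k <= 2 * s%:R * b%:R^-1.
      apply: fin => //; apply: le_trans gn; rewrite ler_wpM2l //; apply: le_trans hn; lra.
    by move/le_trans; apply; rewrite ler_wpM2l ?mulr_ge0 // lerDl invr_ge0.
  have : 2 * `|b%:R * i + e - 1| <= normc (cis (b%:R * i + e) - 1).
    have -> : cis (b%:R * i + e) = cis (b%:R * i + e - 1).
      by rewrite -(cisDnat 1 (b%:R * i + e - 1)) [1%:R + _]addrC subrK.
    by apply: normc_cisB1_ge; rewrite ler0_norm; lra.
  rewrite ler0_norm; last by lra.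
  move=> hn; have : G k <= 2 * s%:R * (s - b)%:R^-1.
    apply: fin => //; apply: le_trans gn; rewrite ler_wpM2l //; apply: le_trans hn; lra.
  by move/le_trans; apply; rewrite ler_wpM2l ?mulr_ge0 // lerDr invr_ge0.
apply: le_trans (sum_residues _ s0 cas phi0) _.
rewrite ler_wpM2l // /phi -big_distrr /= big_split /=.
have -> : 4 * s%:R * (1 + ln s%:R) = 2 * s%:R * ((1 + ln s%:R) + (1 + ln s%:R)) :> R by ring.
rewrite ler_wpM2l ?mulr_ge0 //; apply: lerD.
  apply: le_trans (harm_ln R s0); rewrite [leRHS]big_ord_recr /= lerDl invr_ge0 //.
rewrite (reindex_inj rev_ord_inj) /=.
apply: le_trans (harm_ln R s0); rewrite [leRHS]big_ord_recl /= invr0 add0r.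
by apply: ler_sum => i _; rewrite /bump add1n subKn.
Qed.

(** * Complete exponential sums modulo s *)

Lemma cis_eq1_dvd (R : realType) (s n : nat) : (0 < s)%N ->
  cis (n%:R / s%:R : R) = 1 -> (s %| n)%N.
Proof.
move=> s0 h; have := cis_orth R n 0 s0; rewrite mod0n -/(dvdn s n).
rewrite (eq_bigr (fun=> 1)) => [|r _]; last first.
  by rewrite muln0 mul0r cis0 conjc1 mulr1 natrM -mulrA cisM_nat h expr1n.
rewrite sumr_const card_ord; case: ifP => // _ /eqP.
by rewrite pnatr_eq0; case: s s0 h.
Qed.

Lemma sum_periodic (V : zmodType) (s k : nat) (c : nat -> V) :
  (forall n, c (n + s)%N = c n) -> \sum_(b < s) c (b + k)%N = \sum_(b < s) c b.
Proof.
move=> hc; elim: k => [|k <-]; first by apply: eq_bigr => b _; rewrite addn0.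
case: s hc => [|s] hc; first by rewrite !big_ord0.
rewrite big_ord_recr big_ord_recl /= addrC; congr (_ + _).
  by rewrite -[RHS]hc; congr c; lia.
by apply: eq_bigr => b _; congr c; rewrite /bump; lia.
Qed.

Lemma cisDdiv (R : realType) (s n k : nat) : (0 < s)%N ->
  cis ((n + k * s)%:R / s%:R : R) = cis (n%:R / s%:R).
Proof.
move=> s0; have hs : s%:R != 0 :> R by rewrite pnatr_eq0 -lt0n.
by rewrite natrD natrM mulrDl mulfK // addrC cisDnat.
Qed.

(** With G = gcd (s, 2 al), shifting b by s / G multiplies every term by one constant w, since the
    cross term 2 al b s / G is a multiple of s. The sum equals w times itself, and w = 1 would force
    G to divide 2 be. *)
Lemma complete_sum0 (R : realType) (al be ga s a : nat) :
  (0 < s)%N -> coprime a s -> ~~ (gcdn s (2 * al) %| 2 * be)%N ->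
  \sum_(b < s) cis ((a * quad al be ga b)%:R / s%:R : R) = 0.
Proof.
move=> s0 cas hG; set G := gcdn s (2 * al) in hG.
have Gs : (G %| s)%N by rewrite dvdn_gcdl.
have Ga : (G %| 2 * al)%N by rewrite dvdn_gcdr.
pose s' := (s %/ G)%N; have es : s = (G * s')%N by rewrite mulnC divnK.
pose al' := (2 * al %/ G)%N; have eal : (2 * al = G * al')%N by rewrite [RHS]mulnC divnK.
pose c n : R[i] := cis ((a * quad al be ga n)%:R / s%:R : R).
have hper n : c (n + s)%N = c n.
  rewrite /c (_ : (a * quad al be ga (n + s) =
    a * quad al be ga n + a * (2 * al * n + al * s + be) * s)%N) ?cisDdiv //.
  by rewrite /quad; lia.
pose w : R[i] := cis ((a * (al * s' ^ 2 + be * s'))%:R / s%:R : R).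
have hw n : c (n + s')%N = c n * w.
  rewrite /c /w -cisD -mulrDl -natrD.
  rewrite (_ : (a * quad al be ga (n + s') =
    a * quad al be ga n + a * (al * s' ^ 2 + be * s') + (a * al' * n) * s)%N) ?cisDdiv //.
  have -> : (a * al' * n * s = a * n * s' * (G * al'))%N by rewrite es; lia.
  by rewrite -eal /quad; lia.
have : \sum_(b < s) c b = (\sum_(b < s) c b) * w.
  rewrite -{1}(sum_periodic s' hper) big_distrl /=; apply: eq_bigr => b _; exact: hw.
move/eqP; rewrite -subr_eq0 -{1}[\sum_(b < s) c b]mulr1 -mulrBr mulf_eq0 => /orP[/eqP //|].
rewrite subr_eq0 eq_sym => /eqP/(cis_eq1_dvd s0); rewrite Gauss_dvdr 1?coprime_sym // => h.
exfalso; move/negP: hG; apply.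
have s'0 : (0 < s')%N by move: s0; rewrite es muln_gt0 => /andP[].
have : (s %| 2 * (al * s' ^ 2 + be * s'))%N by rewrite dvdn_mull.
have -> : (2 * (al * s' ^ 2 + be * s') = al' * s' * s + 2 * be * s')%N.
  have -> : (al' * s' * s = s' * s' * (G * al'))%N by rewrite es; lia.
  by rewrite -eal; lia.
rewrite dvdn_addr; last exact: dvdn_mull.
by rewrite [X in (X %| _)%N]es dvdn_pmul2r.
Qed.

Lemma quad_mono (al be ga m n : nat) : (m <= n)%N -> (quad al be ga m <= quad al be ga n)%N.
Proof. by move=> mn; rewrite /quad leq_add2r leq_add // leq_mul // leq_exp2r. Qed.

(** On a block of length s the factor [cis (bt * h)] is frozen at the start of the block, where it
    multiplies a vanishing complete sum. The variation of bt h over the blocks telescopes because h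
    is monotone; the incomplete last block gives the summand s. *)
Lemma weyl_vanish (R : realType) (al be ga M s a : nat) (bt : R) :
  (0 < s)%N -> coprime a s -> ~~ (gcdn s (2 * al) %| 2 * be)%N ->
  normc (\sum_(n < M) cis ((a%:R / s%:R + bt) * (quad al be ga n)%:R))
    <= s%:R + 8 * s%:R * `|bt| * (quad al be ga M)%:R.
Proof.
move=> s0 cas hG; have Z0 := complete_sum0 R ga s0 cas hG.
pose th := a%:R / s%:R + bt; rewrite -/th.
set h := quad al be ga in Z0 *.
have hblock (q : nat) : normc (\sum_(n < q * s) cis (th * (h n)%:R))
    <= 8 * s%:R * `|bt| * (h (q * s)%N)%:R.
  elim: q => [|q IH]; first by rewrite big_ord0 normc0 !mulr_ge0.
  rewrite mulSn [(s + _)%N]addnC big_split_ord /=; apply: le_trans (le_normcD _ _) _.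
  have hm : (h (q * s) <= h (q * s + s))%N by apply: quad_mono; rewrite leq_addr.
  suff : normc (\sum_(b < s) cis (th * (h (q * s + b)%N)%:R))
      <= 8 * s%:R * `|bt| * ((h (q * s + s)%N)%:R - (h (q * s)%N)%:R).
    by move: IH; rewrite mulrBr; lra.
  have E (b : nat) : cis (th * (h (q * s + b)%N)%:R) =
     cis ((a * h b)%:R / s%:R) * cis (bt * (h (q * s + b)%N)%:R).
    rewrite /th mulrDl cisD; congr (_ * _).
    have -> : a%:R / s%:R * (h (q * s + b)%N)%:R = (a * h (q * s + b))%:R / s%:R :> R.
      by rewrite natrM mulrAC.
    rewrite (_ : (a * h (q * s + b) = a * h b + a * (al * (q * q * s + 2 * q * b) + be * q) * s)%N) ?cisDdiv //.
    by rewrite /h /quad; lia.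
  have -> : \sum_(b < s) cis (th * (h (q * s + b)%N)%:R) =
      \sum_(b < s) cis ((a * h b)%:R / s%:R) *
        (cis (bt * (h (q * s + b)%N)%:R) - cis (bt * (h (q * s)%N)%:R)).
    under [RHS]eq_bigr do rewrite mulrBr.
    rewrite sumrB -big_distrl /= Z0 mul0r subr0; apply: eq_bigr => b _; exact: E.
  apply: le_trans (normc_sum _ _ _) _.
  apply: (@le_trans _ _ (\sum_(b < s) 8 * `|bt| * ((h (q * s + s)%N)%:R - (h (q * s)%N)%:R))).
    apply: ler_sum => b _; rewrite normcM normc_cis mul1r.
    have hb1 : (h (q * s) <= h (q * s + b))%N by apply: quad_mono; rewrite leq_addr.
    have hb2 : (h (q * s + b) <= h (q * s + s))%N by apply: quad_mono; rewrite leq_add2l ltnW.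
    have -> : cis (bt * (h (q * s + b)%N)%:R) - cis (bt * (h (q * s)%N)%:R) =
      cis (bt * (h (q * s)%N)%:R) * (cis (bt * ((h (q * s + b)%N)%:R - (h (q * s)%N)%:R)) - 1).
      by rewrite mulrBr mulr1 -cisD; congr (cis _ - _); ring.
    rewrite normcM normc_cis mul1r; apply: le_trans (normc_cisB1_le _) _.
    rewrite normrM mulrA ler_wpM2l ?mulr_ge0 // ger0_norm ?subr_ge0 ?ler_nat //.
    by rewrite lerD2r ler_nat.
  rewrite sumr_const card_ord -[leLHS]mulr_natl le_eqVlt; apply/orP; left; apply/eqP; ring.
have hM : M = (M %/ s * s + M %% s)%N by exact: divn_eq.
have -> : \sum_(n < M) cis (th * (h n)%:R) =
    \sum_(n < M %/ s * s + M %% s) cis (th * (h n)%:R) by rewrite -hM.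
rewrite big_split_ord /=; apply: le_trans (le_normcD _ _) _.
rewrite addrC; apply: lerD.
  apply: le_trans (normc_cis_sum_le _ (fun b => th * (h (M %/ s * s + b)%N)%:R)) _.
  by rewrite ler_nat ltnW // ltn_pmod.
apply: le_trans (hblock _) _; rewrite ler_wpM2l ?mulr_ge0 // ler_nat.
by apply: quad_mono; exact: leq_trunc_div.
Qed.

Lemma dirichlet (R : realType) (P r T : nat) : (0 < P)%N -> (0 < T)%N ->
  exists a s : nat, [/\ (0 < s <= T)%N, coprime a s &
    `|r%:R / P%:R - a%:R / s%:R| <= 1 / (s%:R * T%:R) :> R].
Proof.
move=> P0 T0.
have Pp : 0 < P%:R :> R by rewrite ltr0n.
have Tp : 0 < T%:R :> R by rewrite ltr0n.
(* Pigeonhole: for T + 1 values of k the residues of k r modulo P fall into T boxes of length P /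
   T. *)
have hlt (k : nat) : ((k * r) %% P * T %/ P < T)%N.
  by rewrite ltn_divLR // mulnC ltn_pmul2l // ltn_pmod.
pose c (k : 'I_T.+1) := Ordinal (hlt k).
have : ~~ injectiveb c.
  by apply/negP => /injectiveP /leq_card; rewrite !card_ord ltnn.
case/injectivePn => x [y xy /(congr1 val) /= e].
wlog lxy : x y xy e / (x < y)%N.
  move=> hw; case: (ltngtP x y) => h; first exact: (hw x y).
    by apply: (hw y x) => //; rewrite eq_sym.
  by move: xy; rewrite -val_eqE /= h eqxx.
pose s0 := (y - x)%N; pose a0 := (y * r %/ P - x * r %/ P)%N.
have s00 : (0 < s0)%N by rewrite subn_gt0.
have hle : (x * r %/ P <= y * r %/ P)%N by rewrite leq_div2r // leq_mul2r ltnW ?orbT.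
set u := ((x * r) %% P)%N in e; set v := ((y * r) %% P)%N in e.
have E : s0%:R * r%:R - a0%:R * P%:R = v%:R - u%:R :> R.
  rewrite /s0 /a0 !natrB ?(ltnW lxy) // mulrBl -!natrM.
  rewrite {1}(divn_eq (y * r) P) {1}(divn_eq (x * r) P) -/u -/v !natrD !natrM; ring.
have huv : `|v%:R - u%:R| * T%:R <= P%:R :> R.
  set m := (u * T %/ P)%N in e.
  have h1 : (m * P <= u * T)%N by exact: leq_trunc_div.
  have h2 : (u * T <= m.+1 * P)%N by rewrite ltnW // ltn_ceil.
  have h3 : (m * P <= v * T)%N by rewrite e leq_trunc_div.
  have h4 : (v * T <= m.+1 * P)%N by rewrite e ltnW // ltn_ceil.
  move: h1 h2 h3 h4; rewrite -!(ler_nat R) !natrM -(natr1 m) => h1 h2 h3 h4.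
  rewrite -[T%:R]ger0_norm // -normrM ler_norml mulrBl; apply/andP; split; lra.
(* Passing to lowest terms decreases s, which only weakens the bound 1 / (s T). *)
pose g := gcdn a0 s0.
have g0 : (0 < g)%N by rewrite gcdn_gt0 s00 orbT.
have gp : 0 < g%:R :> R by rewrite ltr0n.
have s1 : (0 < s0 %/ g)%N by rewrite divn_gt0 // dvdn_leq // dvdn_gcdr.
exists (a0 %/ g)%N, (s0 %/ g)%N; split.
- rewrite s1 (leq_trans (leq_div _ _)) // /s0.
  by rewrite (leq_trans (leq_subr _ _)) // -ltnS.
- by rewrite /coprime -(eqn_pmul2r g0) muln_gcdl !divnK ?dvdn_gcdl ?dvdn_gcdr ?mul1n.
have s1p : 0 < (s0 %/ g)%:R :> R by rewrite ltr0n.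
have s0p : 0 < s0%:R :> R by rewrite ltr0n.
have es : s0%:R = (s0 %/ g)%:R * g%:R :> R by rewrite -natrM divnK ?dvdn_gcdr.
have ea : a0%:R = (a0 %/ g)%:R * g%:R :> R by rewrite -natrM divnK ?dvdn_gcdl.
have -> : r%:R / P%:R - (a0 %/ g)%:R / (s0 %/ g)%:R = (v%:R - u%:R) / (s0%:R * P%:R) :> R.
  by rewrite -E es ea; field; rewrite ?gt_eqF.
rewrite normrM [X in _ * X]ger0_norm; last by rewrite invr_ge0 mulr_ge0.
apply: (@le_trans _ _ (1 / (s0%:R * T%:R))).
  rewrite ler_pdivrMr ?mulr_gt0 // mul1r mulrC -mulrA.
  have -> : P%:R * (s0%:R * T%:R)^-1 = P%:R / T%:R / s0%:R :> R by field; rewrite ?gt_eqF.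
  by rewrite mulrA mulrAC divff ?gt_eqF // mul1r; rewrite ler_pdivlMr.
rewrite !mul1r lef_pV2 ?posrE ?mulr_gt0 // ler_wpM2r // es ler_peMr // ?ler1n //.
Qed.

Lemma ln_le_sqrt (R : realType) (x : R) : 0 < x -> ln x <= 2 * (Num.sqrt x - 1).
Proof.
move=> x0; have s0 : 0 < Num.sqrt x by rewrite sqrtr_gt0.
rewrite -{1}(sqr_sqrtr (ltW x0)) lnXn // -[_ *+ 2]mulr_natl ler_pM2l //.
have := @le_ln1Dx R (Num.sqrt x - 1); rewrite [1 + _]addrC subrK; apply; lra.
Qed.

(** Weyl differencing sees the denominator of 2 al a / s, which is smaller than s by the factor G =
    gcd (s, 2 al). If G divides 2 be, then G <= kp and the loss is bounded; otherwise the complete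
    sum vanishes and the frequency is minor. Here y - 1 measures the distance to a / s in units of 1
    / N. *)
Lemma weyl_dichotomy (R : realType) (al be ga M N P r kp : nat) (c1 eps B : R) :
  (0 < al)%N -> (0 < M)%N -> (0 < P)%N -> (0 < kp)%N -> 1 <= c1 ->
  0 < eps <= 1 -> 1 <= B -> 32 * kp%:R * c1 / eps ^+ 2 <= Num.sqrt B ->
  (forall G, (G %| 2 * al -> G %| 2 * be -> G <= kp)%N) ->
  (quad al be ga M <= N)%N -> N%:R <= c1 * al%:R * M%:R ^+ 2 ->
  5500 * c1 ^+ 2 * al%:R ^+ 2 * B / eps ^+ 2 <= Num.sqrt M%:R ->
  let S := \sum_(n < M) cis (r%:R / P%:R * (quad al be ga n)%:R) in
  exists a s : nat, [/\ (0 < s)%N, coprime a s &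
    let y := 1 + N%:R * `|r%:R / P%:R - a%:R / s%:R| in
    normc S <= eps * M%:R \/
    s%:R * y <= B /\ normc S ^+ 2 <= 17 * kp%:R * c1 * (1 + ln B) * M%:R ^+ 2 / (s%:R * y)].
Proof.
move=> al0 M0 P0 kp0 c11 /andP[ep e1] B1 hB hcont hN hN2 hM S.
have Mp : 0 < M%:R :> R by rewrite ltr0n.
have M1 : 1 <= M%:R :> R by rewrite ler1n.
have alp : 0 < al%:R :> R by rewrite ltr0n.
have al1 : 1 <= al%:R :> R by rewrite ler1n.
have kpp : 1 <= kp%:R :> R by rewrite ler1n.
have c1p : 0 < c1 by apply: lt_le_trans c11.
have Bp : 0 < B by apply: lt_le_trans B1.
have hNge : al%:R * M%:R ^+ 2 <= N%:R :> R.
  rewrite -natrX -natrM ler_nat; apply: leq_trans hN.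
  by rewrite /quad -addnA leq_addr.
have Np : 0 < N%:R :> R by apply: lt_le_trans hNge; rewrite mulr_gt0 ?exprn_gt0.
(* This size serves two ends: X >= 8 al M yields the condition 4 s M eta <= 1 of [weyl_bound], and 8
   N / X = eps M / 2 makes the drift in [weyl_vanish] small. *)
pose X : R := 16 * N%:R / (eps * M%:R).
have X0 : 0 <= X by rewrite divr_ge0 ?mulr_ge0 // ltW.
pose T := (Num.truncn X).+1.
have T0 : (0 < T)%N by [].
have /andP[hT1 hT2] : (Num.truncn X)%:R <= X < (Num.truncn X).+1%:R by exact: truncn_itv.
have XT : X <= T%:R by exact: ltW.
have TX : T%:R <= X + 1 by rewrite -natr1 lerD2r.
have emp : 0 < eps * M%:R by rewrite mulr_gt0.
have hXN : X * (eps * M%:R) = 16 * N%:R by rewrite /X divfK // gt_eqF.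
have X8 : 8 * al%:R * M%:R <= X.
  rewrite -(ler_pM2r emp) hXN.
  have : eps * (al%:R * M%:R ^+ 2) <= al%:R * M%:R ^+ 2 by rewrite ler_piMl // mulr_ge0 ?exprn_ge0 // ltW.
  have : 8 * al%:R * M%:R * (eps * M%:R) = 8 * (eps * (al%:R * M%:R ^+ 2)) by ring.
  move=> ->; move: hNge Np; clear; lra.
have X16 : X <= 16 * c1 * al%:R * M%:R / eps.
  rewrite ler_pdivlMr // -(ler_pM2r Mp) -[leLHS]mulrA hXN.
  have -> : 16 * c1 * al%:R * M%:R * M%:R = 16 * (c1 * al%:R * M%:R ^+ 2) by ring.
  by rewrite ler_pM2l.
have alM : 1 <= al%:R * M%:R :> R by rewrite -natrM ler1n muln_gt0 al0.
pose q : R := Num.sqrt M%:R.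
have qp : 0 < q by rewrite sqrtr_gt0.
have q2 : q ^+ 2 = M%:R by rewrite sqr_sqrtr // ltW.
pose Y := c1 * al%:R / eps.
have eY : Y = c1 * al%:R / eps by [].
have eq_ : Num.sqrt M%:R = q by [].
have Y1 : 1 <= Y by rewrite ler_pdivlMr // mul1r (le_trans e1) // mulr_ege1.
clearbody q Y.
have Y0 : 0 <= Y := le_trans ler01 Y1.
have q0 : 0 <= q := ltW qp.
have B0 : 0 <= B := ltW Bp.
have ep0 : 0 <= eps := ltW ep.
have c10 : 0 <= c1 := ltW c1p.
have T17 : T%:R <= 17 * Y * q ^+ 2.
  apply: (le_trans TX); rewrite q2.
  have -> : 17 * Y * M%:R = 16 * c1 * al%:R * M%:R / eps + Y * M%:R by rewrite eY; ring.
  by rewrite lerD // mulr_ege1.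
have Tp : 0 < T%:R :> R by rewrite ltr0n.
have sT : Num.sqrt T%:R <= 5 * Y * q.
  rewrite -ler_sqr ?nnegrE ?sqrtr_ge0 ?mulr_ge0 //.
  rewrite sqr_sqrtr ?ler0n //; apply: (le_trans T17).
  have -> : (5 * Y * q) ^+ 2 = (25 * Y) * (Y * q ^+ 2) by ring.
  have : 0 <= q ^+ 2 * Y * (Y - 1) by rewrite !mulr_ge0 ?subr_ge0 //.
  have : 0 <= Y * q ^+ 2 by rewrite mulr_ge0 ?exprn_ge0 //.
  clear; lra.
have YB : 5500 * Y ^+ 2 * B <= q.
  by rewrite -eq_; apply: le_trans hM; rewrite eY expr_div_n exprMn le_eqVlt; apply/orP; left; apply/eqP; ring.
have qB : 5500 * Y <= q.
  apply: le_trans YB; rewrite -mulrA ler_pM2l // -[leLHS]mulr1 expr2 -mulrA ler_pM2l ?(lt_le_trans ltr01 Y1) //.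
  by rewrite mulr_ege1.
(* the terms of Weyl's inequality that do not come from the main arcs *)
have small (s' : nat) : (0 < s' <= T)%N ->
    M%:R + 2 * ((M.+1 %/ s').+1%:R * (4 * s'%:R * (1 + ln s'%:R))) <= M%:R ^+ 2 / (2 * B).
  case/andP=> s'0 s'T.
  have s'p : 0 < s'%:R :> R by rewrite ltr0n.
  have h1 : (M.+1 %/ s').+1%:R * s'%:R <= 2 * T%:R :> R.
    rewrite -natrM -[2 * _]natrM ler_nat mulSn.
    have : (M.+1 %/ s' * s' <= M.+1)%N by exact: leq_trunc_div.
    have : (M < T)%N.
      rewrite -(ltr_nat R); apply: lt_le_trans XT; apply: lt_le_trans X8.
      have : M%:R <= al%:R * M%:R :> R by rewrite ler_peMl // ltW.
      move: Mp; clear; lra.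
    move: s'T; clear; lia.
  have h2 : 1 + ln s'%:R <= 2 * Num.sqrt T%:R :> R.
    apply: (@le_trans _ _ (1 + ln T%:R)).
      by rewrite lerD2l ler_ln ?posrE // ler_nat.
    by have := ln_le_sqrt Tp; clear; lra.
  have l0 : 0 <= 1 + ln s'%:R :> R by rewrite addr_ge0 // ln_ge0 // ler1n.
  have h3 : (M.+1 %/ s').+1%:R * (4 * s'%:R * (1 + ln s'%:R)) <= 16 * (T%:R * Num.sqrt T%:R) :> R.
    have -> : (M.+1 %/ s').+1%:R * (4 * s'%:R * (1 + ln s'%:R)) =
      4 * (((M.+1 %/ s').+1%:R * s'%:R) * (1 + ln s'%:R)) :> R by ring.
    have -> : 16 * (T%:R * Num.sqrt T%:R) = 4 * ((2 * T%:R) * (2 * Num.sqrt T%:R)) :> R by ring.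
    by rewrite ler_pM2l // ler_pM // mulr_ge0.
  have h4 : T%:R * Num.sqrt T%:R <= 85 * Y ^+ 2 * q ^+ 3.
    have -> : 85 * Y ^+ 2 * q ^+ 3 = (17 * Y * q ^+ 2) * (5 * Y * q) by ring.
    by rewrite ler_pM ?sqrtr_ge0 // ltW.
  have B2 : 0 < 2 * B by rewrite mulr_gt0.
  rewrite ler_pdivlMr // -q2.
  have h5 : (5500 * Y ^+ 2 * B) * q ^+ 3 <= q * q ^+ 3 by rewrite ler_pM2r ?exprn_gt0.
  have h6 : 4 * B * q ^+ 2 <= 4 * B * q ^+ 2 * (Y ^+ 2 * q).
    rewrite ler_peMr ?mulr_ge0 ?exprn_ge0 // mulr_ege1 ?exprn_ege1 //.
    by apply: le_trans qB; move: Y1; clear; lra.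
  have h7 : B * (T%:R * Num.sqrt T%:R) <= B * (85 * Y ^+ 2 * q ^+ 3) by rewrite ler_pM2l.
  have h8 : B * ((M.+1 %/ s').+1%:R * (4 * s'%:R * (1 + ln s'%:R))) <= B * (16 * (T%:R * Num.sqrt T%:R)).
    by rewrite ler_pM2l.
  have h9 : 0 <= B * Y ^+ 2 * q ^+ 3 by rewrite !mulr_ge0 ?exprn_ge0 //.
  have e6 : 4 * B * q ^+ 2 * (Y ^+ 2 * q) = 4 * (B * Y ^+ 2 * q ^+ 3) by ring.
  rewrite e6 in h6.
  have e7 : (q ^+ 2) ^+ 2 = q * q ^+ 3 by ring.
  rewrite e7; move: h5 h7 h8 h6 h9; clear; lra.
have [a [s [/andP[s0 sT'] cas hbt]]] := dirichlet R r P0 T0.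
exists a, s; split => //.
set bt := r%:R / P%:R - a%:R / s%:R in hbt *; move=> y.
have sp : 0 < s%:R :> R by rewrite ltr0n.
have s1 : 1 <= s%:R :> R by rewrite ler1n.
pose G := gcdn s (2 * al).
have G0 : (0 < G)%N by rewrite gcdn_gt0 s0.
have Gs : (G %| s)%N by rewrite dvdn_gcdl.
have Ga : (G %| 2 * al)%N by rewrite dvdn_gcdr.
pose s' := (s %/ G)%N; have es : s = (s' * G)%N by rewrite divnK.
pose a' := (a * (2 * al %/ G))%N.
have s'0 : (0 < s')%N by move: s0; rewrite es muln_gt0 => /andP[].
have cas' : coprime a' s'.
  rewrite /a' coprimeMl; apply/andP; split.
    by apply: (coprime_dvdr _ cas); rewrite es dvdn_mulr.
  by rewrite coprime_sym /coprime -(eqn_pmul2r G0) muln_gcdl !divnK // mul1n.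
have Gp : 0 < G%:R :> R by rewrite ltr0n.
have s'p : 0 < s'%:R :> R by rewrite ltr0n.
have esR : s%:R = s'%:R * G%:R :> R by rewrite -natrM -es.
have eta_ : 2 * al%:R * `|bt| = `|2 * al%:R * (r%:R / P%:R) - a'%:R / s'%:R|.
  have -> : 2 * al%:R * (r%:R / P%:R) - a'%:R / s'%:R = 2 * al%:R * bt.
    rewrite /bt mulrBr; congr (_ - _).
    have -> : a'%:R = a%:R * (2 * al)%:R / G%:R :> R.
      by rewrite /a' natrM -mulrA; congr (_ * _); rewrite -{2}(divnK Ga) [in RHS]natrM mulfK // gt_eqF.
    by rewrite esR natrM; field; rewrite ?gt_eqF.
  by rewrite normrM ger0_norm // mulr_ge0 // ltW.
set eta := 2 * al%:R * `|bt| in eta_.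
have eta0 : 0 <= eta by rewrite !mulr_ge0 // ltW.
have hbt2 : s%:R * `|bt| <= 1 / T%:R.
  by move: hbt; rewrite ler_pdivlMr ?mulr_gt0 // => h; rewrite ler_pdivlMr //; move: h; clear; lra.
have ss' : s'%:R <= s%:R :> R by rewrite ler_nat leq_div.
have heta : 4 * s'%:R * (M%:R * eta) <= 1.
  have h1 : s'%:R * `|bt| <= 1 / T%:R by apply: le_trans hbt2; rewrite ler_wpM2r.
  have -> : 4 * s'%:R * (M%:R * eta) = (8 * al%:R * M%:R) * (s'%:R * `|bt|) by rewrite /eta; ring.
  apply: (@le_trans _ _ (T%:R * (1 / T%:R))); last by rewrite mul1r divff // gt_eqF.
  by apply: ler_pM => //; [rewrite !mulr_ge0 // ltW|rewrite mulr_ge0 // ltW|exact: le_trans X8 XT].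
have W := @weyl_bound R al be ga M s' a' (r%:R / P%:R) eta M0 s'0 cas' eta_ heta.
have hs'T : (0 < s' <= T)%N by rewrite s'0 (leq_trans _ sT') // leq_div.
set z := M%:R ^+ 2 * eta in W.
have z0 : 0 <= z by rewrite mulr_ge0 ?exprn_ge0 // ltW.
have z1 : 0 < 1 + z by rewrite ltr_wpDr.
pose D := (1 + ln (1 + z)) / (1 + z).
have l0 : 0 <= ln (1 + z) by rewrite ln_ge0 // lerDl.
have D0 : 0 <= D by apply: divr_ge0; [rewrite addr_ge0 | exact: ltW].
have D1 : D <= 1.
  by rewrite ler_pdivrMr // mul1r lerD2l; apply: le_ln1Dx; apply: lt_le_trans z0; rewrite ltrN10.
have {}W : normc S ^+ 2 <= M%:R ^+ 2 / (2 * B) + 8 * (M%:R ^+ 2 / s'%:R) * D.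
  apply: (le_trans W); have := small _ hs'T.
  have -> : M%:R ^+ 2 / s'%:R * (4 * (1 + ln (1 + z)) / (1 + z)) = 4 * (M%:R ^+ 2 / s'%:R * D).
    by rewrite /D; ring.
  clear; lra.
have e2p : 0 < eps ^+ 2 by rewrite exprn_gt0.
have sqB1 : 32 <= eps ^+ 2 * Num.sqrt B.
  move: hB; rewrite ler_pdivrMr // [Num.sqrt B * _]mulrC; apply: le_trans.
  by have := mulr_ege1 kpp c11; clear; lra.
have hBe : 2 <= B * eps ^+ 2.
  have : Num.sqrt B <= B.
    rewrite -{2}(sqr_sqrtr (ltW Bp)) expr2 ler_peMl ?sqrtr_ge0 //.
    rewrite -(ler_pM2l e2p) mulr1; apply: le_trans sqB1.
    by have := exprn_ile1 2 ep0 e1; clear; lra.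
  by move=> h; have := ler_wpM2l (ltW e2p) h; move: sqB1; clear; lra.
have M2p : 0 < M%:R ^+ 2 :> R by rewrite exprn_gt0.
have hMB : M%:R ^+ 2 / (2 * B) <= eps ^+ 2 * M%:R ^+ 2 / 4.
  rewrite ler_pdivrMr ?mulr_gt0 //.
  by have := ler_wpM2l (ltW M2p) hBe; clear; lra.
have S0 : 0 <= normc S := normc_ge0 S.
have fin : normc S ^+ 2 <= eps ^+ 2 * M%:R ^+ 2 -> normc S <= eps * M%:R.
  by rewrite -exprMn ler_sqr ?nnegrE // ltW.
(* Large s: even after losing a factor 2 al between s and s', the main term M^2 / s' is only of
   order al M / eps. *)
case: (lerP s%:R (eps * M%:R / 2)) => hs; last first.
  left; apply: fin; apply: (le_trans W).
  have h1 : M%:R ^+ 2 / s'%:R <= 4 * al%:R * M%:R / eps :> R.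
    have h2 : s%:R <= s'%:R * (2 * al%:R) :> R.
      by rewrite esR ler_wpM2l // -[2 * _]natrM ler_nat dvdn_leq // muln_gt0 al0.
    rewrite ler_pdivrMr // mulrAC ler_pdivlMr //.
    have h3 : M%:R * (eps * M%:R / 2) <= M%:R * (s'%:R * (2 * al%:R)).
      by rewrite ler_wpM2l // (le_trans (ltW hs)).
    have -> : M%:R ^+ 2 * eps = 2 * (M%:R * (eps * M%:R / 2)) by field.
    move: h3; clear; lra.
  have h2 : M%:R ^+ 2 / s'%:R * D <= 4 * al%:R * M%:R / eps.
    by apply: le_trans h1; rewrite ler_piMr // divr_ge0 // ltW.
  have h3 : 32 * (al%:R * M%:R / eps) <= eps ^+ 2 * M%:R ^+ 2 / 4.
    have -> : al%:R * M%:R / eps = (al%:R / eps) * M%:R by ring.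
    have -> : eps ^+ 2 * M%:R ^+ 2 / 4 = (eps ^+ 2 / 4 * M%:R) * M%:R by ring.
    rewrite mulrA ler_wpM2r //.
    have h4 : al%:R / eps <= Y by rewrite eY ler_wpM2r ?invr_ge0 ?(ltW ep) // ler_peMl // ltW.
    have h5 : (5500 * Y) * (5500 * Y ^+ 2 * B) <= M%:R.
      by rewrite -q2 expr2 ler_pM // !mulr_ge0 ?exprn_ge0 // //.
    have h6 : 2 * Y <= B * eps ^+ 2 * Y by rewrite ler_wpM2r // (le_trans ler01 Y1).
    have h7 : Y <= Y * Y ^+ 2 by rewrite ler_peMr ?exprn_ege1 // (le_trans ler01 Y1).
    have h8 : B * eps ^+ 2 * Y <= B * eps ^+ 2 * (Y * Y ^+ 2).
      by rewrite ler_wpM2l // (le_trans _ hBe).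
    have h9 := ler_wpM2l (ltW e2p) h5.
    move: Y0 h4 h6 h8 h9; clear; lra.
  have -> : 8 * (M%:R ^+ 2 / s'%:R) * D = 8 * (M%:R ^+ 2 / s'%:R * D) by ring.
  have := mulr_ge0 (ltW e2p) (ltW M2p).
  move: h2 h3 hMB; clear; lra.
(* Small s with vanishing complete sum: what is left is s and the drift, each at most eps M / 2. *)
case hG: (G %| 2 * be)%N; last first.
  left; have := @weyl_vanish R al be ga M s a bt s0 cas; rewrite -/G hG => /(_ isT).
  rewrite [a%:R / s%:R + bt](_ : _ = r%:R / P%:R); last by rewrite /bt addrC subrK.
  rewrite -/S => h; apply: (le_trans h).
  have h1 : 8 * s%:R * `|bt| * (quad al be ga M)%:R <= 8 * (1 / T%:R * N%:R).
    have -> : 8 * s%:R * `|bt| * (quad al be ga M)%:R = 8 * ((s%:R * `|bt|) * (quad al be ga M)%:R) by ring.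
    rewrite ler_pM2l //; apply: ler_pM => //; first by rewrite mulr_ge0.
    by rewrite ler_nat.
  have h2 : 8 * (1 / T%:R * N%:R) <= eps * M%:R / 2.
    have -> : 8 * (1 / T%:R * N%:R) = 8 * N%:R / T%:R :> R by ring.
    rewrite ler_pdivrMr //.
    have := ler_wpM2l (ltW emp) XT; rewrite [_ * X]mulrC hXN; clear; lra.
  move: h1 h2 hs; clear; lra.
have Gk : (G <= kp)%N by apply: hcont.
have hss : s%:R <= s'%:R * kp%:R :> R by rewrite esR ler_wpM2l // ler_nat.
have y1 : 1 <= y by rewrite lerDl mulr_ge0 // ltW.
have yp : 0 < y := lt_le_trans ltr01 y1.
have hDy : D <= c1 * (2 + ln y) / y.
  have hz1 : y <= c1 * (1 + z).
    rewrite mulrDr mulr1 /y; apply: lerD => //.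
    apply: (@le_trans _ _ (c1 * al%:R * M%:R ^+ 2 * `|bt|)); first by rewrite ler_wpM2r.
    rewrite -!mulrA ler_pM2l // /z /eta.
    have : 0 <= al%:R * (M%:R ^+ 2 * `|bt|) by rewrite !mulr_ge0 ?exprn_ge0 // ltW.
    clear; lra.
  have hz2 : 1 + z <= 2 * y.
    have : z <= 2 * (N%:R * `|bt|).
      have -> : z = 2 * (al%:R * M%:R ^+ 2 * `|bt|) by rewrite /z /eta; ring.
      by rewrite ler_pM2l // ler_wpM2r.
    by rewrite /y; move: (hNge) (mulr_ge0 (ltW Np) (normr_ge0 bt)); clear; lra.
  have hl : ln (1 + z) <= 1 + ln y.
    apply: (@le_trans _ _ (ln (2 * y))); first by rewrite ler_ln ?posrE // mulr_gt0.
    rewrite lnM ?posrE // lerD2r.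
    by have := @le_ln1Dx R 1; rewrite (_ : 1 + 1 = 2) //; apply; rewrite (lt_trans (ltrN10 R)) ?ltr01.
  have ly0 : 0 <= ln y by rewrite ln_ge0.
  rewrite /D ler_pdivrMr // mulrAC ler_pdivlMr //.
  apply: (@le_trans _ _ ((2 + ln y) * (c1 * (1 + z)))); last by rewrite mulrCA mulrA.
  by apply: ler_pM => //; [rewrite addr_ge0|exact: ltW|move: hl; clear; lra].
have ly0 : 0 <= ln y by rewrite ln_ge0.
have kc1 : 1 <= kp%:R * c1 by rewrite mulr_ege1.
have syp : 0 < s%:R * y by rewrite mulr_gt0.
have W2 : normc S ^+ 2 <= M%:R ^+ 2 / (2 * B) + 8 * (kp%:R * c1 * (2 + ln y)) * M%:R ^+ 2 / (s%:R * y).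
  apply: (le_trans W); rewrite lerD2l.
  have h1 : M%:R ^+ 2 / s'%:R <= M%:R ^+ 2 * kp%:R / s%:R :> R.
    by rewrite ler_pdivlMr // mulrAC ler_pdivrMr //; have := ler_wpM2l (ltW M2p) hss; clear; lra.
  have -> : 8 * (kp%:R * c1 * (2 + ln y)) * M%:R ^+ 2 / (s%:R * y) =
    8 * (M%:R ^+ 2 * kp%:R / s%:R) * (c1 * (2 + ln y) / y).
    by field; rewrite ?gt_eqF.
  apply: ler_pM => //; last by rewrite ler_pM2l.
  by apply: mulr_ge0 => //; apply: divr_ge0; exact: ltW.
case: (lerP (s%:R * y) B) => hsy.
  right; split => //; apply: (le_trans W2).
  have ylB : ln y <= ln B.
    by rewrite ler_ln ?posrE //; apply: le_trans hsy; rewrite ler_peMl // ltW.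
  have h1 : M%:R ^+ 2 / (2 * B) <= M%:R ^+ 2 / (s%:R * y).
    by rewrite ler_pM2l // lef_pV2 ?posrE ?mulr_gt0 //; move: hsy B0; clear; lra.
  have h2 : kp%:R * c1 * (2 + ln y) <= kp%:R * c1 * (2 + ln B).
    by rewrite ler_pM2l ?lerD2l // (lt_le_trans ltr01).
  have h3 : 1 + 8 * (kp%:R * c1 * (2 + ln y)) <= 17 * kp%:R * c1 * (1 + ln B).
    have : 0 <= kp%:R * c1 * ln B by rewrite mulr_ge0 ?ln_ge0 // (le_trans ler01).
    by move: h2 kc1; clear; lra.
  have := ler_wpM2r (ltW (divr_gt0 M2p syp)) h3.
  have -> : (1 + 8 * (kp%:R * c1 * (2 + ln y))) * (M%:R ^+ 2 / (s%:R * y)) =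
    M%:R ^+ 2 / (s%:R * y) + 8 * (kp%:R * c1 * (2 + ln y)) * M%:R ^+ 2 / (s%:R * y) by ring.
  have -> : 17 * kp%:R * c1 * (1 + ln B) * (M%:R ^+ 2 / (s%:R * y)) =
    17 * kp%:R * c1 * (1 + ln B) * M%:R ^+ 2 / (s%:R * y) by ring.
  move: h1; clear; lra.
(* Beyond s y = B the frequency is minor again: (2 + log y) / (s y) <= 2 / sqrt (s y), and sqrt B
   was assumed to exceed 32 kp c1 / eps^2. *)
left; apply: fin; apply: (le_trans W2).
have sy0 : 0 < Num.sqrt (s%:R * y) by rewrite sqrtr_gt0.
have h1 : (2 + ln y) / (s%:R * y) <= 2 / Num.sqrt (s%:R * y).
  rewrite ler_pdivrMr // -{2}(sqr_sqrtr (ltW syp)) expr2 mulrA divfK ?gt_eqF //.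
  have := ln_le_sqrt yp; have : Num.sqrt y <= Num.sqrt (s%:R * y).
    by rewrite ler_wsqrtr // ler_peMl // ltW.
  clear; lra.
have h2 : Num.sqrt B <= Num.sqrt (s%:R * y) by rewrite ler_wsqrtr // ltW.
have h3 : 8 * (kp%:R * c1 * (2 + ln y)) * M%:R ^+ 2 / (s%:R * y) =
   (8 * (kp%:R * c1) * M%:R ^+ 2) * ((2 + ln y) / (s%:R * y)) by ring.
have h4 : 32 * (kp%:R * c1) / eps ^+ 2 <= Num.sqrt (s%:R * y) by apply: le_trans h2; rewrite mulrA.
have h5 : 2 / Num.sqrt (s%:R * y) * (16 * (kp%:R * c1)) <= eps ^+ 2.
  have -> : 2 / Num.sqrt (s%:R * y) * (16 * (kp%:R * c1)) =
    32 * (kp%:R * c1) / Num.sqrt (s%:R * y) by ring.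
  by move: h4; rewrite !ler_pdivrMr // [_ * eps ^+ 2]mulrC.
have h6 : (8 * (kp%:R * c1) * M%:R ^+ 2) * ((2 + ln y) / (s%:R * y)) <=
   (8 * (kp%:R * c1) * M%:R ^+ 2) * (2 / Num.sqrt (s%:R * y)).
  by rewrite ler_wpM2l // !mulr_ge0 ?exprn_ge0 // ltW.
rewrite h3; have := ler_wpM2l (ltW M2p) h5.
move: h6 hMB (mulr_ge0 (ltW e2p) (ltW M2p)); clear; lra.
Qed.

(** * Fourier analysis of difference-avoiding sets *)

Definition density (R : realType) (N : nat) (A : nat -> bool) : R :=
  (\sum_(x < N) A x)%N%:R / N%:R.

Definition bal (R : realType) (N : nat) (A : nat -> bool) (x : nat) : R :=
  if (x < N)%N then (A x)%:R - density R N A else 0.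

Definition dft (R : realType) (P : nat) (f : nat -> R) (r : nat) : R[i] :=
  \sum_(x < P) (f x)%:C * cis ((r * x)%:R / P%:R : R).

Lemma density_itv (R : realType) (N : nat) (A : nat -> bool) :
  0 <= density R N A <= 1.
Proof.
rewrite divr_ge0 //=; case: (posnP N) => [->|N0].
  by rewrite /density big_ord0 mul0r.
rewrite ler_pdivrMr ?ltr0n // mul1r ler_nat.
apply: (@leq_trans (\sum_(x < N) 1)%N); first by apply: leq_sum => x _; case: (A x).
by rewrite sum1_card card_ord.
Qed.

Lemma densityM (R : realType) (N : nat) (A : nat -> bool) :
  density R N A * N%:R = \sum_(x < N) (A x)%:R.
Proof.
case: (posnP N) => [->|N0]; first by rewrite mulr0 big_ord0.
by rewrite /density divfK ?natr_sum // pnatr_eq0 -lt0n.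
Qed.

Lemma correlation (R : realType) (P M : nat) (f : nat -> R) (h : nat -> nat) : (0 < P)%N ->
  P%:R * `|\sum_(n < M) \sum_(x < P) \sum_(y < P | (x + h n)%N == y %[mod P]) f x * f y|
  <= \sum_(r < P) normc (dft P f r) ^+ 2 *
       normc (\sum_(n < M) cis (r%:R / P%:R * (h n)%:R)).
Proof.
move=> P0.
have E := dft_inner (fun p : 'I_M * 'I_P => (f p.2)%:C) (fun y : 'I_P => (f y)%:C)
   (fun p => p.2 + h p.1)%N (fun y : 'I_P => y : nat) P0.
set T := \sum_(n < M) _.
have ET : \sum_(i : 'I_M * 'I_P) \sum_(j : 'I_P | (i.2 + h i.1)%N == j %[mod P])
    (f i.2)%:C * conjc (f j)%:C = T%:C.
  rewrite /T rmorph_sum /=.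
  rewrite -(pair_big predT predT (fun (n : 'I_M) (x : 'I_P) =>
     \sum_(j < P | (x + h n)%N == j %[mod P]) (f x)%:C * conjc (f j)%:C)) /=.
  apply: eq_bigr => n _; rewrite rmorph_sum /=; apply: eq_bigr => x _.
  rewrite rmorph_sum /=; apply: eq_bigr => y _; rewrite rmorphM /=.
  by congr (_ * _); rewrite /= oppr0.
rewrite ET in E.
have -> : P%:R * `|T| = normc (P%:R * T%:C).
  have -> : (P%:R : R[i]) = (P%:R : R)%:C.
    by elim: (P) => [|k IH] //; rewrite -!natr1 IH; apply/eqP; rewrite eq_complex /= addr0 !eqxx.
  rewrite normcM; congr (_ * _); first by have := normc_real (P%:R : R); rewrite ger0_norm // => ->.
  by have := normc_real T => ->.
rewrite -E; apply: le_trans (normc_sum _ _ _) _; apply: ler_sum => r _.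
set S := \sum_(n < M) _.
have -> : \sum_(i : 'I_M * 'I_P) (f i.2)%:C * cis ((r * (i.2 + h i.1))%:R / P%:R) = dft P f r * S.
  rewrite /S /dft mulrC big_distrlr /= pair_big /=; apply: eq_bigr => -[n x] _ /=.
  rewrite [RHS]mulrCA -cisD; congr (_ * cis _).
  by rewrite mulnDr natrD mulrDl [X in _ + X / _ = _]natrM; ring.
by rewrite !normcM normc_conj -/(dft P f r) expr2 mulrAC.
Qed.

(** As x and x + h are never both in A, the product of balanced values is d^2 - d A(x) - d A(x + h)
    in the bulk, which would sum to - d^2 N. The two boundary hypotheses limit the loss at the ends
    to half of that, and P > 2 N rules out wrap-around. *)
Lemma bal_correlation (R : realType) (N P h H : nat) (A : nat -> bool) :
  (2 * N < P)%N -> (h <= H)%N -> (H <= N)%N ->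
  (forall x, (x < N)%N -> (x + h < N)%N -> A x -> A (x + h)%N -> False) ->
  (4 * \sum_(j < H) A j <= \sum_(x < N) A x)%N ->
  (4 * \sum_(j < H) A (N - H + j) <= \sum_(x < N) A x)%N ->
  \sum_(x < P) \sum_(y < P | (x + h)%N == y %[mod P]) bal R N A x * bal R N A y
   <= - (1 / 2 * density R N A ^+ 2 * N%:R).
Proof.
move=> NP hH HN hA hA1 hA2.
set d := density R N A; have /andP[d0 d1] : 0 <= d <= 1 := density_itv R N A.
have dN : d * N%:R = \sum_(x < N) (A x)%:R := densityM R N A.
have -> : \sum_(x < P) \sum_(y < P | (x + h)%N == y %[mod P]) bal R N A x * bal R N A y
    = \sum_(x < N) bal R N A x * bal R N A (x + h)%N.
  have NP' : (N <= P)%N by lia.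
  rewrite (big_ord_widen P (fun x => bal R N A x * bal R N A (x + h)%N) NP') [RHS]big_mkcond /=.
  apply: eq_bigr => x _; case: ifP => xN; last first.
    by rewrite big1 // => y _; rewrite /bal xN mul0r.
  have hx : (x + h < P)%N by lia.
  rewrite (big_pred1 (Ordinal hx)) //= => y; rewrite /= !modn_small //.
  by rewrite -val_eqE /= eq_sym.
apply: (@le_trans _ _ (\sum_(x < N) (d ^+ 2 - d * (A x)%:R + d * ((N <= x + h)%N && A x)%:R
    - d * ((x + h < N)%N && A (x + h)%N)%:R))).
  apply: ler_sum => x _; rewrite /bal ltn_ord -/d [(N <= _)%N]leqNgt.
  case: ifP => xh /=; last first.
    by rewrite mulr0; have := sqr_ge0 d; move: d0; clear; case: (A x) => /=; lra.
  have := hA x (ltn_ord x) xh; case: (A x); case: (A (x + h)%N) => /= hf.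
  - by exfalso; exact: hf.
  - by clear; lra.
  - by clear; lra.
  - by clear; lra.
rewrite sumrB big_split sumrB /= sumr_const card_ord -!big_distrr /= -dN.
have h1 : 4 * \sum_(x < N) ((N <= x + h)%N && A x)%:R <= d * N%:R.
  rewrite dN -!natr_sum -[4 * _]natrM ler_nat; apply: leq_trans hA2; rewrite leq_mul2l /=.
  apply: (@leq_trans (\sum_(x < N) ((N - H <= x)%N && A x))%N).
    apply: leq_sum => x _; case: (A x); rewrite ?andbF // !andbT.
    case h1 : (N <= x + h)%N => //=; suff -> : (N - H <= x)%N by []. lia.
  have -> : (\sum_(x < N) ((N - H <= x)%N && A x) = \sum_(x < N - H + H) ((N - H <= x)%N && A x))%N.
    by rewrite subnK.
  rewrite big_split_ord /= big1 ?add0n.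
    by apply: leq_sum => x _; rewrite leq_addr.
  by move=> x _; rewrite leqNgt ltn_ord.
have h2 : 3 * (d * N%:R) <= 4 * \sum_(x < N) ((x + h < N)%N && A (x + h)%N)%:R.
  rewrite dN -!natr_sum -[4 * _]natrM -[3 * _]natrM ler_nat.
  have e1 : (\sum_(x < N) A x <= \sum_(j < H) A j + \sum_(x < N) ((x + h < N)%N && A (x + h)%N))%N.
    have hN : (h <= N)%N := leq_trans hH HN.
    have -> : (\sum_(x < N) A x = \sum_(x < h + (N - h)) A x)%N by rewrite subnKC.
    rewrite big_split_ord /=; apply: leq_add.
      by rewrite -(subnKC hH) big_split_ord /= leq_addr.
    rewrite (big_ord_widen N (fun x => (A (h + x)%N : nat)) (leq_subr h N)) big_mkcond.
    apply: leq_sum => x _; case: ifP => // hx.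
    by rewrite addnC; have -> : (x + h < N)%N by lia.
  move: e1 hA1; move: (\sum_(x < N) A x)%N (\sum_(j < H) A j)%N => a b.
  move: (\sum_(x < N) _)%N => c; clear; lia.
move: h1 h2; set s1 := \sum_(x < N) ((N <= x + h)%N && A x)%:R.
set s2 := \sum_(x < N) ((x + h < N)%N && A (x + h)%N)%:R => h1 h2.
have h3 := ler_wpM2l d0 h1; have h4 := ler_wpM2l d0 h2.
rewrite -[X in X - _ + _ - _]mulr_natr.
move: h3 h4; clear; lra.
Qed.

Lemma correlation_lower (R : realType) (N P M H : nat) (A : nat -> bool) (h : nat -> nat) :
  (2 * N < P)%N -> (H <= N)%N -> (forall n, (n < M)%N -> (h n <= H)%N) ->
  (forall n x, (n < M)%N -> (x + h n < N)%N -> A x -> A (x + h n)%N -> False) ->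
  (4 * \sum_(j < H) A j <= \sum_(x < N) A x)%N ->
  (4 * \sum_(j < H) A (N - H + j) <= \sum_(x < N) A x)%N ->
  P%:R * (1 / 2 * M%:R * density R N A ^+ 2 * N%:R)
  <= \sum_(r < P) normc (dft P (bal R N A) r) ^+ 2 *
       normc (\sum_(n < M) cis (r%:R / P%:R * (h n)%:R)).
Proof.
move=> NP HN hH hA hA1 hA2; have P0 : (0 < P)%N by lia.
apply: le_trans (correlation M (bal R N A) h P0); rewrite ler_wpM2l //.
rewrite -normrN; apply: le_trans (ler_norm _); rewrite lerNr.
have -> : - (1 / 2 * M%:R * density R N A ^+ 2 * N%:R) =
    \sum_(n < M) - (1 / 2 * density R N A ^+ 2 * N%:R).
  by rewrite sumr_const card_ord -[RHS]mulr_natl; ring.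
apply: ler_sum => n _; apply: (@bal_correlation R N P (h n) H A NP (hH _ (ltn_ord n)) HN) => //.
by move=> x _; apply: hA.
Qed.

Lemma sum_shift (V : zmodType) (P N k : nat) (phi : nat -> nat -> V) :
  (N + k <= P)%N -> (forall x z, (N <= x)%N -> phi x z = 0) ->
  \sum_(z < P) (if (k <= z)%N then phi (z - k)%N z else 0) = \sum_(x < P) phi x (x + k)%N.
Proof.
move=> hP hphi.
have -> : \sum_(z < P) (if (k <= z)%N then phi (z - k)%N z else 0) =
  \sum_(z < k + (P - k)) (if (k <= z)%N then phi (z - k)%N z else 0) by rewrite subnKC //; lia.
rewrite big_split_ord /= big1 ?add0r; last by move=> x _; rewrite leqNgt ltn_ord.
have -> : \sum_(x < P) phi x (x + k)%N = \sum_(x < P - k + k) phi x (x + k)%N by rewrite subnK //; lia.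
rewrite big_split_ord /= [X in _ = _ + X]big1 ?addr0; last by move=> x _; apply: hphi; lia.
by apply: eq_bigr => x _; rewrite leq_addr addKn addnC.
Qed.

Lemma sum_itv_le (P a b : nat) : (\sum_(z < P) ((a <= z < b)%N : nat) <= b - a)%N.
Proof.
suff : (\sum_(z < P) ((a <= z < b)%N : nat) <= minn P b - a)%N by lia.
elim: P => [|P IH]; first by rewrite big_ord0.
by rewrite big_ord_recr /=; move: IH; move: (\sum_(z < P) _)%N => s; lia.
Qed.

Lemma sum_bal (R : realType) (N P : nat) (A : nat -> bool) : (N <= P)%N ->
  \sum_(x < P) bal R N A x = 0.
Proof.
move=> NP; transitivity (\sum_(x < N) ((A x)%:R - density R N A)).
  rewrite (big_ord_widen P (fun x => (A x)%:R - density R N A) NP) [RHS]big_mkcond /=.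
  by apply: eq_bigr.
by rewrite sumrB sumr_const card_ord -mulr_natr densityM subrr.
Qed.

(* Any window of l terms of an arithmetic progression meets [0, N) inside
   a full progression of length l contained in [0, N). *)
Lemma window_le (R : realDomainType) (N la l z : nat) (A : nat -> bool) (c : R) :
  (0 < la)%N -> (0 < l)%N -> (la * l <= N)%N ->
  (forall x0, (x0 + la * l.-1 < N)%N -> \sum_(j < l) (A (x0 + la * j)%N)%:R <= c) ->
  \sum_(j < l | (la * j <= z)%N && (z - la * j < N)%N) (A (z - la * j)%N)%:R <= c.
Proof.
move=> la0 l0 hl hinc.
(* [e] is the first j with z - la j < N, and [t] the term reached there; [T] further steps down,
   stopping before 0 or after l - 1 steps, lead to the start [x0]. *)
pose e := ((z + la - N) %/ la)%N.
have he1 : (la * e <= z + la - N)%N by rewrite mulnC leq_trunc_div.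
have he2 : (z + la - N < la * e.+1)%N by rewrite mulnC ltn_ceil.
pose t := (z - la * e)%N.
pose T := minn l.-1 (t %/ la).
have hT : (la * T <= t)%N.
  by apply: (@leq_trans (la * (t %/ la))%N); [rewrite leq_mul2l geq_minr orbT | rewrite mulnC leq_trunc_div].
have tN : (t < N)%N.
  rewrite /t mulnS in he2 *; lia.
pose x0 := (t - la * T)%N.
have hx0 : (x0 + la * l.-1 < N)%N.
  rewrite /x0 /T; case: (leqP l.-1 (t %/ la)%N) => h.
    rewrite subnK //.
    by apply: leq_trans (leq_trunc_div t la); rewrite mulnC leq_mul2r h orbT.
  have ht : (t - la * (t %/ la) < la)%N.
    by rewrite {1}(divn_eq t la) mulnC addKn ltn_pmod.
  have : (la + la * l.-1 = la * l)%N by rewrite -{1}[la]muln1 -mulnDr add1n prednK.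
  lia.
apply: le_trans (hinc _ hx0).
have key (j : 'I_l) : (la * j <= z)%N && (z - la * j < N)%N ->
    [/\ (e <= j)%N, (j - e <= T)%N & (x0 + la * (T - (j - e)) = z - la * j)%N].
  case/andP=> h1 h2.
  have ej : (e <= j)%N.
    rewrite -(leq_pmul2l la0) -ltnS -(ltn_pmul2l la0) // in he1 *.
    have : (la * e < la * j.+1)%N by rewrite mulnS; lia.
    by rewrite ltn_pmul2l.
  have hj : (la * j = la * e + la * (j - e))%N by rewrite -mulnDr subnKC.
  have jT : (j - e <= T)%N.
    rewrite /T leq_min leq_divRL //; apply/andP; split; first by have := ltn_ord j; lia.
    by rewrite mulnC /t; lia.
  split=> //; rewrite /x0.
  have hT2 : (la * T = la * (T - (j - e)) + la * (j - e))%N by rewrite -mulnDr subnK.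
  by rewrite /t in hT *; lia.
have hlt (j : 'I_l) : (T - (j - e) < l)%N.
  by apply: leq_ltn_trans (leq_subr _ _) _; rewrite /T; have := geq_minl l.-1 (t %/ la); lia.
pose h (j : 'I_l) := Ordinal (hlt j).
apply: (@le_trans _ _ (\sum_(j < l | (la * j <= z)%N && (z - la * j < N)%N) (A (x0 + la * h j)%N)%:R)).
  by apply: ler_sum => j /key[_ _ /= ->].
apply: (@sum_inj_le _ _ _ _ predT h (fun i : 'I_l => (A (x0 + la * i)%N)%:R)) => //.
move=> i j /key[a1 a2 _] /key[b1 b2 _] /(congr1 val) /= eq.
by apply: val_inj => /=; lia.
Qed.

(** Let g be the balanced function convolved with a progression of step la and length l. Its
    transform gains a geometric sum of size at least l / sqrt 2 on Q, so Parseval reduces the claim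
    to the square sum of g. Absence of increment bounds g only from above, but g has mean zero,
    which controls its absolute values as well. *)
Lemma major_mass (R : realType) (N P la l : nat) (A : nat -> bool) (nu : R) (Q : pred 'I_P) :
  (2 * N < P)%N -> (0 < la)%N -> (0 < l)%N -> 0 <= nu <= 1 ->
  8 * (la * l)%:R <= nu * N%:R ->
  (forall x0, (x0 + la * l.-1 < N)%N ->
     \sum_(j < l) (A (x0 + la * j)%N)%:R <= (1 + nu) * density R N A * l%:R) ->
  (forall r, Q r -> l%:R ^+ 2 <= 2 * normc (\sum_(j < l) cis ((r * (la * j))%:R / P%:R : R)) ^+ 2) ->
  \sum_(r < P | Q r) normc (dft P (bal R N A) r) ^+ 2 <= 12 * nu * density R N A ^+ 2 * N%:R * P%:R.
Proof.
move=> NP la0 l0 /andP[nu0 nu1] hlal hinc hQ.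
have P0 : (0 < P)%N by lia.
set d := density R N A in hinc *; have /andP[d0 d1] : 0 <= d <= 1 := density_itv R N A.
have lp : 0 < l%:R :> R by rewrite ltr0n.
have hlN : (la * l <= N)%N.
  rewrite -(ler_nat R); have : nu * N%:R <= N%:R by rewrite ler_piMl.
  have : 0 <= (la * l)%:R :> R by []. 
  move: hlal; clear; lra.
pose f := bal R N A.
have f0 x : (N <= x)%N -> f x = 0 by rewrite /f /bal leqNgt => /negbTE ->.
have hj (j : 'I_l) : (N + la * j <= P)%N.
  have : (la * j <= la * l)%N by rewrite leq_mul2l ltnW ?orbT.
  lia.
pose g (z : nat) := \sum_(j < l) (if (la * j <= z)%N then f (z - la * j)%N else 0).
have dftg r : dft P g r = dft P f r * \sum_(j < l) cis ((r * (la * j))%:R / P%:R : R).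
  rewrite mulrC /dft big_distrl /=.
  transitivity (\sum_(z < P) \sum_(j < l) (if (la * j <= z)%N then
      (f (z - la * j)%N)%:C * cis ((r * z)%:R / P%:R : R) else 0)).
    apply: eq_bigr => z _; rewrite /g rmorph_sum big_distrl /=; apply: eq_bigr => j _.
    by case: ifP => // _; rewrite rmorph0 mul0r.
  rewrite exchange_big /=; apply: eq_bigr => j _.
  rewrite (@sum_shift _ P N (la * j) (fun x z => (f x)%:C * cis ((r * z)%:R / P%:R : R))) //; last first.
    by move=> x z h; rewrite f0 // rmorph0 mul0r.
  rewrite big_distrr /=; apply: eq_bigr => x _.
  by rewrite mulrCA -cisD -mulrDl -natrD -mulnDr addnC.
have sumg : \sum_(z < P) g z = 0.
  rewrite /g exchange_big /= big1 // => j _.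
  rewrite (@sum_shift _ P N (la * j) (fun x _ => f x)) //; last by move=> x z; exact: f0.
  by apply: sum_bal; lia.
(* A majorant of g: nu d l in the bulk and 2 d l on two boundary windows of length la l, which are
   paid for by 8 la l <= nu N. *)
pose b (z : nat) : R := nu * d * l%:R * (z < N)%:R + 2 * d * l%:R * (z < la * l)%N%:R
    + 2 * d * l%:R * (N <= z < N + la * l)%N%:R.
have dl0 : 0 <= d * l%:R by rewrite mulr_ge0.
have ndl : 0 <= nu * d * l%:R by rewrite -mulrA mulr_ge0.
have ddl : 0 <= 2 * d * l%:R by rewrite -mulrA mulr_ge0.
have dl2 : 0 <= 2 * (d * l%:R) by apply: mulr_ge0.
have b0 z : 0 <= b z by rewrite /b; do ?apply: addr_ge0; apply: mulr_ge0.
have hcount z : \sum_(j < l | (la * j <= z)%N && (z - la * j < N)%N) (A (z - la * j)%N)%:R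
    <= (1 + nu) * d * l%:R.
  have W := @window_le R N la l z A ((1 + nu) * d * l%:R) la0 l0 hlN hinc.
  exact: W.
have hgE z : g z = \sum_(j < l | (la * j <= z)%N && (z - la * j < N)%N) ((A (z - la * j)%N)%:R - d).
  rewrite /g [RHS]big_mkcond; apply: eq_bigr => j _; rewrite /f /bal.
  by case: (la * j <= z)%N => //=; case: ifP.
have hg_lo z : - (d * l%:R) <= g z.
  rewrite hgE; apply: (@le_trans _ _ (\sum_(j < l) - d)).
    by rewrite sumr_const card_ord -[leRHS]mulr_natr mulNr.
  rewrite [leRHS]big_mkcond; apply: ler_sum => j _; case: ifP => _; last by rewrite oppr_le0.
  by rewrite lerBrDr addNr.
have hg_hi z : g z <= 2 * (d * l%:R).
  apply: (@le_trans _ _ ((1 + nu) * d * l%:R)).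
    apply: le_trans (hcount z); rewrite hgE; apply: ler_sum => j _.
    by rewrite gerBl.
  by have := ler_wpM2r dl0 nu1; clear; lra.
have hgb z : g z <= b z.
  case: (boolP [exists j : 'I_l, (la * j <= z)%N && (z - la * j < N)%N]) => [/existsP[j0 /andP[k1 k2]]|h]; last first.
    rewrite hgE big_pred0 // => j; apply/negbTE; move: h; rewrite negb_exists => /forallP; exact.
  have zlt : (z < N + la * l)%N.
    have : (la * j0 <= la * l)%N by rewrite leq_mul2l ltnW ?orbT.
    lia.
  case: (leqP (la * l) z) => hz; last first.
    rewrite /b hz [_ * true%:R]mulr1; apply: (le_trans (hg_hi z)).
    have : 0 <= nu * d * l%:R * (z < N)%:R by apply: mulr_ge0.
    have : 0 <= 2 * d * l%:R * (N <= z < N + la * l)%N%:R by apply: mulr_ge0.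
    by clear; lra.
  case: (ltnP z N) => hzN; last first.
    rewrite /b hzN zlt [_ * (true && true)%:R]mulr1; apply: (le_trans (hg_hi z)).
    have : 0 <= nu * d * l%:R * (z < N)%:R by apply: mulr_ge0.
    have : 0 <= 2 * d * l%:R * (z < la * l)%:R by apply: mulr_ge0.
    by clear; lra.
  have hall (j : 'I_l) : (la * j <= z)%N && (z - la * j < N)%N.
    have : (la * j <= la * l)%N by rewrite leq_mul2l ltnW ?orbT.
    lia.
  apply: (@le_trans _ _ (nu * d * l%:R)); last first.
    rewrite /b hzN mulr1; have : 0 <= 2 * d * l%:R * (z < la * l)%:R by apply: mulr_ge0.
    have : 0 <= 2 * d * l%:R * (N <= z < N + la * l)%N%:R by apply: mulr_ge0.
    by clear; lra.
  have := hcount z; rewrite hgE.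
  have -> : \sum_(j < l | (la * j <= z)%N && (z - la * j < N)%N) (A (z - la * j)%N)%:R =
     \sum_(j < l) (A (z - la * j)%N)%:R :> R by apply: eq_bigl.
  have -> : \sum_(j < l | (la * j <= z)%N && (z - la * j < N)%N) ((A (z - la * j)%N)%:R - d) =
     \sum_(j < l) ((A (z - la * j)%N)%:R - d) by apply: eq_bigl.
  rewrite sumrB sumr_const card_ord -[X in _ - X]mulr_natr; clear; lra.
(* 2 b - g majorises |g| for either sign of g, and its sum is twice that of b because g sums to
   0. *)
have hg2 z : g z ^+ 2 <= 2 * (d * l%:R) * (2 * b z - g z).
  case: (lerP 0 (g z)) => hz.
    apply: (@le_trans _ _ (2 * (d * l%:R) * g z)); first by rewrite expr2 ler_wpM2r.
    rewrite ler_wpM2l //; have := hgb z; move: (b z) (g z) => x y; clear. lra.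
  apply: (@le_trans _ _ (2 * (d * l%:R) * - g z)).
    rewrite -sqrrN expr2; apply: ler_wpM2r; first by rewrite oppr_ge0 ltW.
    by have := hg_lo z; move: dl0; move: (g z) (d * l%:R) => x y; clear; lra.
  by rewrite ler_wpM2l //; have := b0 z; move: hz; move: (b z) (g z) => x y; clear; lra.
have sumb : \sum_(z < P) b z <= 3 / 2 * nu * (d * l%:R) * N%:R.
  rewrite /b !big_split /= -!big_distrr /= -!natr_sum.
  have s1 : (\sum_(z < P) ((z < N)%N : nat) <= N)%N.
    by have := sum_itv_le P 0 N; rewrite subn0.
  have s2 : (\sum_(z < P) ((z < la * l)%N : nat) <= la * l)%N.
    by have := sum_itv_le P 0 (la * l); rewrite subn0.
  have s3 : (\sum_(z < P) ((N <= z < N + la * l)%N : nat) <= la * l)%N.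
    by have := sum_itv_le P N (N + la * l); rewrite addKn.
  rewrite -(ler_nat R) in s1; rewrite -(ler_nat R) in s2; rewrite -(ler_nat R) in s3.
  have ndl0 : 0 <= nu * (d * l%:R) by rewrite mulr_ge0.
  have t1 := ler_wpM2l ndl0 s1; have t2 := ler_wpM2l dl0 s2; have t3 := ler_wpM2l dl0 s3.
  have t4 := ler_wpM2l dl0 hlal.
  move: t1 t2 t3 t4; move: (\sum_(i < P) _)%N%:R (\sum_(i < P) _)%N%:R (\sum_(i < P) _)%N%:R => a1 a2 a3.
  clear; lra.
have sumg2 : \sum_(z < P) g z ^+ 2 <= 6 * nu * (d * l%:R) ^+ 2 * N%:R.
  apply: (@le_trans _ _ (\sum_(z < P) 2 * (d * l%:R) * (2 * b z - g z))); first by apply: ler_sum.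
  rewrite -big_distrr sumrB /= sumg subr0 -big_distrr /=.
  have := ler_wpM2l dl0 sumb; clear; lra.
have := parseval (fun x : 'I_P => (g x)%:C) P0.
have -> : \sum_(r < P) normc (\sum_(x < P) (g x)%:C * cis ((r * x)%:R / P%:R : R)) ^+ 2 =
   \sum_(r < P) normc (dft P f r) ^+ 2 * normc (\sum_(j < l) cis ((r * (la * j))%:R / P%:R : R)) ^+ 2.
  by apply: eq_bigr => r _; rewrite -[X in normc X]/(dft P g r) dftg normcM exprMn.
have -> : \sum_(x < P) normc (g x)%:C ^+ 2 = \sum_(z < P) g z ^+ 2.
  by apply: eq_bigr => x _; rewrite normc_real real_normK ?num_real.
move=> E.
have l2p : 0 < l%:R ^+ 2 :> R by rewrite exprn_gt0.
rewrite -(ler_pM2r l2p).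
apply: (@le_trans _ _ (2 * (P%:R * \sum_(z < P) g z ^+ 2))); last first.
  have Pp : 0 <= P%:R :> R by [].
  by have := ler_wpM2l Pp sumg2; clear; lra.
rewrite -E big_distrl big_distrr /= big_mkcond /=; apply: ler_sum => r _; case: ifP => hr.
  have n0 : 0 <= normc (dft P f r) ^+ 2 by exact: sqr_ge0.
  by have := ler_wpM2l n0 (hQ _ hr); clear; lra.
by apply: mulr_ge0 => //; apply: mulr_ge0; exact: sqr_ge0.
Qed.

(** * Moments and additive energy of the large spectrum *)

Lemma power_mean (R : realDomainType) (I : finType) (w g : I -> R) (k : nat) :
  (forall i, 0 <= w i) -> (forall i, 0 <= g i) ->
  (\sum_i w i * g i) ^+ k.+1 <= (\sum_i w i) ^+ k * \sum_i w i * g i ^+ k.+1.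
Proof.
move=> w0 g0.
have W0 : 0 <= \sum_i w i by apply: sumr_ge0.
(* Chebyshev's sum inequality for the similarly ordered g^j and g; iterated, it gives Hoelder's
   inequality with an integer exponent. *)
have cheb j : (\sum_i w i * g i ^+ j) * (\sum_i w i * g i) <=
    (\sum_i w i) * (\sum_i w i * g i ^+ j.+1).
  have h : 0 <= \sum_i \sum_l w i * w l * ((g i ^+ j - g l ^+ j) * (g i - g l)).
    apply: sumr_ge0 => i _; apply: sumr_ge0 => l _; apply: mulr_ge0; first exact: mulr_ge0.
    case: (leP (g i) (g l)) => h; last first.
      by apply: mulr_ge0; rewrite subr_ge0; [rewrite lerXn2r ?nnegrE // ltW | exact: ltW].
    by rewrite -mulrNN !opprB; apply: mulr_ge0; rewrite subr_ge0 // lerXn2r ?nnegrE.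
  rewrite -subr_ge0 -(pmulr_rge0 _ (ltr0n R 2)).
  apply: le_trans h _; rewrite !big_distrlr /= mulrBr.
  have -> : \sum_i \sum_l w i * w l * ((g i ^+ j - g l ^+ j) * (g i - g l)) =
    \sum_i \sum_l w i * (w l * g l ^+ j.+1) + \sum_i \sum_l w l * (w i * g i ^+ j.+1)
    - (\sum_i \sum_l w i * g i ^+ j * (w l * g l) + \sum_i \sum_l w l * g l ^+ j * (w i * g i)).
    rewrite -!big_split -sumrB /=; apply: eq_bigr => i _.
    rewrite -!big_split -sumrB /=; apply: eq_bigr => l _; rewrite !exprS; ring.
  rewrite [X in _ + X - _]exchange_big [X in _ - (_ + X)]exchange_big /= -!mulr2n.
  by rewrite -[X in X - _]mulr_natl -[X in _ - X <= _]mulr_natl.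
elim: k => [|k IH]; first by rewrite expr0 mul1r expr1; under [leRHS]eq_bigr do rewrite expr1.
rewrite exprSr; apply: le_trans (ler_wpM2r _ IH) _.
  by apply: sumr_ge0 => i _; exact: mulr_ge0.
by rewrite -mulrA [in leRHS]exprSr -[leRHS]mulrA; apply: ler_wpM2l (cheb k.+1); exact: exprn_ge0.
Qed.

(** Coefficients of the (m + 1)-st power of an exponential sum, recorded by the resulting frequency
    rho in Z/(P + 1) and separately by the sum tu of the labels in Z/(L + 1). The second index is
    what ties the moment to convolution powers. *)
Fixpoint ccoef (R : realType) (P L : nat) (c : 'I_L.+1 -> R[i]) (rep : 'I_L.+1 -> 'I_P.+1)
    (m : nat) (tu : 'I_L.+1) (rho : 'I_P.+1) : R[i] :=
  if m is m'.+1 then \sum_ga c ga * ccoef c rep m' (tu - ga) (rho - rep ga)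
  else if rep tu == rho then c tu else 0.

Lemma cis_mod (R : realType) (P x : nat) (r s : 'I_P.+1) :
  cis ((x * (r + s)%R)%:R / P.+1%:R : R) = cis ((x * r)%:R / P.+1%:R) * cis ((x * s)%:R / P.+1%:R).
Proof.
rewrite -cisD -mulrDl -natrD -mulnDr.
rewrite [in RHS](divn_eq (r + s) P.+1) mulnDr mulnA addnC cisDdiv //.
Qed.

Lemma ccoef_sum (R : realType) (P L m x : nat) (c : 'I_L.+1 -> R[i]) (rep : 'I_L.+1 -> 'I_P.+1) :
  (\sum_ga c ga * cis ((x * rep ga)%:R / P.+1%:R : R)) ^+ m.+1
  = \sum_rho (\sum_tu ccoef c rep m tu rho) * cis ((x * rho)%:R / P.+1%:R : R).
Proof.
elim: m => [|m IH].
  rewrite expr1; under [RHS]eq_bigr do rewrite big_distrl /=.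
  rewrite exchange_big /=; apply: eq_bigr => ga _.
  rewrite (bigD1 (rep ga)) //= eqxx big1 ?addr0 // => rho h.
  by rewrite eq_sym (negbTE h) mul0r.
rewrite exprS IH big_distrl /=.
have -> : \sum_rho (\sum_tu ccoef c rep m.+1 tu rho) * cis ((x * rho)%:R / P.+1%:R : R) =
  \sum_ga \sum_rho \sum_tu c ga * ccoef c rep m (tu - ga) (rho - rep ga) * cis ((x * rho)%:R / P.+1%:R : R).
  rewrite exchange_big /=; apply: eq_bigr => rho _.
  by rewrite big_distrl exchange_big /=; apply: eq_bigr => tu _; rewrite big_distrl.
apply: eq_bigr => ga _; rewrite big_distrr [RHS](reindex_inj (addIr (rep ga))) /=.
apply: eq_bigr => rho _; rewrite big_distrl big_distrr [RHS](reindex_inj (addIr ga)) /=.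
apply: eq_bigr => tu _; rewrite !addrK cis_mod; ring.
Qed.

Lemma ccoef_norm (R : realType) (P L m : nat) (c : 'I_L.+1 -> R[i]) (rep : 'I_L.+1 -> 'I_P.+1)
    (tu : 'I_L.+1) :
  \sum_rho normc (ccoef c rep m tu rho) <= convpow (fun g => normc (c g)) m tu.
Proof.
elim: m tu => [|m IH] tu /=.
  rewrite (bigD1 (rep tu)) //= eqxx big1 ?addr0 // => rho h.
  by rewrite eq_sym (negbTE h) normc0.
apply: (@le_trans _ _ (\sum_rho \sum_ga normc (c ga) * normc (ccoef c rep m (tu - ga) (rho - rep ga)))).
  apply: ler_sum => rho _; apply: le_trans (normc_sum _ _ _) _.
  by apply: ler_sum => ga _; rewrite normcM.
rewrite exchange_big /= /conv; apply: ler_sum => ga _.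
rewrite -big_distrr ler_wpM2l ?normc_ge0 //=.
rewrite (reindex_inj (addIr (rep ga))) /=.
by apply: le_trans (IH (tu - ga)); apply: ler_sum => rho _; rewrite addrK.
Qed.

(* [near k rho tu] stands for: the frequency rho / (P + 1) lies within
   (k + 1) eta of the rational tu / (L + 1). Expanding the power, only sums of
   frequencies near equal rationals can coincide, so the moment is at most the
   additive energy of the coefficients over Z/(L + 1). *)
Lemma moment_transfer (R : realType) (P L m : nat) (c : 'I_L.+1 -> R[i])
    (rep : 'I_L.+1 -> 'I_P.+1) (near : nat -> 'I_P.+1 -> 'I_L.+1 -> Prop) :
  (forall ga, c ga != 0 -> near 0%N (rep ga) ga) ->
  (forall k rho tu ga, near k rho tu -> c ga != 0 -> near k.+1 (rho + rep ga) (tu + ga)) ->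
  (forall rho tu tu', near m rho tu -> near m rho tu' -> tu = tu') ->
  \sum_(x < P.+1) normc (\sum_ga c ga * cis ((x * rep ga)%:R / P.+1%:R : R)) ^+ (2 * m.+1)
  <= P.+1%:R * \sum_tu convpow (fun g => normc (c g)) m tu ^+ 2.
Proof.
move=> n0 nS nU.
have supp k tu rho : ccoef c rep k tu rho != 0 -> near k rho tu.
  elim: k tu rho => [|k IH] tu rho /=.
    by case: (eqVneq (rep tu) rho) => [<-|_]; [exact: n0 | rewrite eqxx].
  move=> h; have [ga] : exists ga, c ga * ccoef c rep k (tu - ga) (rho - rep ga) != 0.
    apply/existsP; apply: contraNT h; rewrite negb_exists => /forallP h.
    by rewrite big1 // => ga _; apply/eqP; move: (h ga); rewrite negbK.
  rewrite mulf_eq0 negb_or => /andP[h1 /IH h2].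
  by have := nS _ _ _ _ h2 h1; rewrite !subrK.
have -> : \sum_(x < P.+1) normc (\sum_ga c ga * cis ((x * rep ga)%:R / P.+1%:R : R)) ^+ (2 * m.+1) =
   P.+1%:R * \sum_rho normc (\sum_tu ccoef c rep m tu rho) ^+ 2.
  rewrite -(@parseval R P.+1 (fun rho => \sum_tu ccoef c rep m tu rho)) //.
  by apply: eq_bigr => x _; rewrite mulnC exprM -normcX ccoef_sum.
rewrite ler_wpM2l //.
apply: (@le_trans _ _ (\sum_rho \sum_tu normc (ccoef c rep m tu rho) ^+ 2)).
  apply: ler_sum => rho _.
  (* By [nU] at most one tu contributes to each rho, so the sum over tu may be squared termwise. *)
  case: (pickP (fun tu => ccoef c rep m tu rho != 0)) => [tu htu|h0]; last first.
    rewrite big1 ?normc0 ?expr0n /= ?sumr_ge0 // => tu _; first exact: sqr_ge0.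
    by apply/eqP; move/negbT: (h0 tu); rewrite negbK.
  rewrite (bigD1 tu) //= [X in _ + X]big1 ?addr0 => [|tu' ne]; last first.
    apply/eqP; apply: contraNT ne => /supp h1; apply/eqP.
    by apply: (nU rho) => //; exact: supp.
  by rewrite [leRHS](bigD1 tu) //= lerDl; apply: sumr_ge0 => i _; exact: sqr_ge0.
rewrite exchange_big /=; apply: ler_sum => tu _.
apply: (@le_trans _ _ ((\sum_rho normc (ccoef c rep m tu rho)) ^+ 2)); last first.
  apply: lerXn2r; rewrite ?nnegrE; last exact: ccoef_norm.
    by apply: sumr_ge0 => i _; exact: normc_ge0.
  by apply: convpow_ge0 => g; exact: normc_ge0.
rewrite expr2 big_distrl /=; apply: ler_sum => rho _.
rewrite expr2 ler_wpM2l ?normc_ge0 // (bigD1 rho) //= lerDl.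
by apply: sumr_ge0 => i _; exact: normc_ge0.
Qed.

(* For each frequency ga of the group Z/L let rep ga maximise |dft| over the
   major r attached to ga, and test the dft against the weights
   u ga = (\sum_r |dft r|^2 / sqrt y) / |dft (rep ga)|; by Cauchy-Schwarz u ga ^ 2
   is at most La1 times the mass attached to ga. *)
Lemma spectrum_moment (R : realType) (P L m B : nat) (f : nat -> R) (key : 'I_P.+1 -> 'I_L.+1)
    (y : 'I_P.+1 -> R) (Q : pred 'I_P.+1) (S1 m2 La1 La : R)
    (near : nat -> 'I_P.+1 -> 'I_L.+1 -> Prop) :
  (0 < B)%N -> 1 + m.+1%:R * ln B%:R <= La -> 0 <= La1 -> 0 <= m2 ->
  (forall x, `|f x| <= 1) -> \sum_(x < P.+1) `|f x| <= S1 ->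
  (forall r, Q r -> (zorder (key r) <= B)%N) -> (forall r, Q r -> 1 <= y r) ->
  (forall s, (0 < s)%N ->
     \sum_(r < P.+1 | Q r && (zorder (key r) == s)) normc (\sum_(x < P.+1) (f x)%:C * cis ((r * x)%:R / P.+1%:R : R)) ^+ 2 <= m2) ->
  (forall ga, \sum_(r < P.+1 | Q r && (key r == ga)) (y r)^-1 <= La1) ->
  (forall r, Q r -> near 0%N r (key r)) ->
  (forall k rho tu r, near k rho tu -> Q r -> near k.+1 (rho + r) (tu + key r)) ->
  (forall rho tu tu', near m rho tu -> near m rho tu' -> tu = tu') ->
  (\sum_(r < P.+1 | Q r) normc (\sum_(x < P.+1) (f x)%:C * cis ((r * x)%:R / P.+1%:R : R)) ^+ 2
      / (Num.sqrt (zorder (key r))%:R * Num.sqrt (y r))) ^+ (2 * m.+1)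
  <= S1 ^+ (2 * m.+1).-1 * P.+1%:R * ((La1 * m2) ^+ m.+1 * La ^+ (2 * 16 ^ m.+1)).
Proof.
move=> B0 hLa La10 m20 f1 fS QB y1 hmass hcount n0 nS nU.
pose D r : R[i] := \sum_(x < P.+1) (f x)%:C * cis ((r * x)%:R / P.+1%:R : R).
pose F (r : 'I_P.+1) := normc (D r).
have F0 r : 0 <= F r := normc_ge0 _.
pose hit ga r := Q r && (key r == ga).
pose rep ga : 'I_P.+1 := if [pick r | hit ga r] is Some r0
  then [arg max_(r > r0 | hit ga r) F r]%O else ord0.
have repP ga r : hit ga r -> hit ga (rep ga) /\ F r <= F (rep ga).
  rewrite /rep; case: pickP => [r0 h0 hr|h0]; last by rewrite h0.
  by case: arg_maxP => // i hi hmax; split=> //; exact: hmax.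
pose Mg ga := \sum_(r | hit ga r) F r ^+ 2 / Num.sqrt (y r).
have Mg0 ga : 0 <= Mg ga.
  by apply: sumr_ge0 => r _; rewrite divr_ge0 ?sqr_ge0 ?sqrtr_ge0.
pose u ga := Mg ga / F (rep ga).
have u0 ga : 0 <= u ga by rewrite divr_ge0.
have uF ga : u ga * F (rep ga) = Mg ga.
  rewrite /u; have [h|h] := eqVneq (F (rep ga)) 0; last by rewrite divfK.
  rewrite h mulr0 /Mg big1 // => r /repP[_]; rewrite h => Fr.
  by rewrite (_ : F r = 0) ?expr0n ?mul0r //; apply/eqP; rewrite eq_le Fr F0.
have u2 ga : u ga ^+ 2 <= La1 * \sum_(r | hit ga r) F r ^+ 2.
  have H0 : 0 <= \sum_(r | hit ga r) F r ^+ 2 by apply: sumr_ge0 => r _; exact: sqr_ge0.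
  have [h|h] := eqVneq (F (rep ga)) 0.
    by rewrite /u h invr0 mulr0 expr0n mulr_ge0.
  have Fp : 0 < F (rep ga) by rewrite lt_def h F0.
  rewrite /u expr_div_n ler_pdivrMr ?exprn_gt0 //.
  have -> : Mg ga = \sum_(r | hit ga r) F r * (F r / Num.sqrt (y r)).
    by apply: eq_bigr => r _; rewrite mulrA -expr2.
  apply: le_trans (sum_CS _ _ _) _.
  rewrite [La1 * _]mulrC -mulrA ler_wpM2l //.
  apply: (@le_trans _ _ (\sum_(r | hit ga r) (y r)^-1 * F (rep ga) ^+ 2)).
    apply: ler_sum => r hr; have /andP[Qr _] := hr; have [_ hF] := repP _ _ hr.
    have yp : 0 < y r by apply: lt_le_trans (y1 _ Qr).
    rewrite expr_div_n (sqr_sqrtr (ltW yp)) mulrC ler_wpM2l ?invr_ge0 ?(ltW yp) //.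
    by rewrite lerXn2r ?nnegrE.
  by rewrite -big_distrl /= ler_wpM2r ?sqr_ge0 //; exact: hcount.
pose v ga := u ga / Num.sqrt (zorder ga)%:R.
have v0 ga : 0 <= v ga by rewrite divr_ge0 ?sqrtr_ge0.
(* The phase that turns the transform at [rep ga] into its modulus, with value 0 where the transform
   vanishes. *)
pose ph ga : R[i] := if F (rep ga) == 0 then 0 else (F (rep ga))%:C / D (rep ga).
have ph1 ga : normc (ph ga) <= 1.
  rewrite /ph; case: eqP => h; first by rewrite normc0.
  rewrite normcM normcV normc_real ger0_norm // divff //; exact/eqP.
have phD ga : ph ga * D (rep ga) = (F (rep ga))%:C.
  rewrite /ph; case: eqP => h; first by rewrite mul0r h.
  rewrite divfK //; apply/eqP => h2; apply: h; by rewrite /F h2 normc0.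
pose c ga := (v ga)%:C * ph ga.
have cv ga : normc (c ga) <= v ga.
  by rewrite normcM normc_real ger0_norm // ler_piMr.
have chit ga : c ga != 0 -> hit ga (rep ga).
  move=> h; case: (pickP (hit ga)) => [r hr|h0]; first by have [] := repP _ _ hr.
  case/negP: h; apply/eqP; have vz : v ga = 0 by rewrite /v /u /Mg big_pred0 // !mul0r.
  by rewrite /c vz rmorph0 mul0r.
set Psi := \sum_(r < P.+1 | Q r) _.
have Psi0 : 0 <= Psi.
  by apply: sumr_ge0 => r _; rewrite divr_ge0 ?sqr_ge0 // mulr_ge0 ?sqrtr_ge0.
pose G (x : nat) := \sum_ga c ga * cis ((x * rep ga)%:R / P.+1%:R : R).
have PsiE : Psi = \sum_ga v ga * F (rep ga).
  rewrite /Psi (partition_big key predT) //=; apply: eq_bigr => ga _.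
  rewrite /v mulrAC uF /Mg big_distrl /=; apply: eq_bigr => r /andP[_ /eqP <-].
  by rewrite invfM [RHS]mulrAC mulrA.
have PsiC : Psi%:C = \sum_(x < P.+1) (f x)%:C * G x.
  transitivity (\sum_ga c ga * D (rep ga)).
    rewrite PsiE rmorph_sum; apply: eq_bigr => ga _.
    by rewrite /c -mulrA phD rmorphM.
  rewrite /D; under eq_bigr do rewrite big_distrr /=.
  rewrite exchange_big /=; apply: eq_bigr => x _; rewrite /G big_distrr /=.
  by apply: eq_bigr => ga _; rewrite mulrCA [(rep ga * x)%N]mulnC.
have PsiLe : Psi <= \sum_(x < P.+1) `|f x| * normc (G x).
  rewrite -[leLHS]ger0_norm // -normc_real PsiC; apply: le_trans (normc_sum _ _ _) _.
  by apply: ler_sum => x _; rewrite normcM normc_real.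
have e2 : (2 * m.+1 = (2 * m.+1).-1.+1)%N by rewrite prednK.
apply: (@le_trans _ _ ((\sum_(x < P.+1) `|f x| * normc (G x)) ^+ (2 * m.+1))).
  by rewrite lerXn2r ?nnegrE // sumr_ge0 // => x _; rewrite mulr_ge0 ?normc_ge0.
(* Hoelder with weight |f|: the total mass of f enters with exponent 2 m + 1, and the weight left on
   the moment is at most 1. *)
rewrite {1}e2; apply: le_trans (@power_mean R _ (fun x : 'I_P.+1 => `|f x|) (fun x => normc (G x)) _ _ _) _ => //.
  by move=> x; exact: normc_ge0.
rewrite -e2 -mulrA; apply: ler_pM.
- by rewrite exprn_ge0 // sumr_ge0.
- by apply: sumr_ge0 => x _; rewrite mulr_ge0 ?exprn_ge0 ?normc_ge0.
- by rewrite lerXn2r ?nnegrE ?sumr_ge0 // (le_trans _ fS) // sumr_ge0.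
apply: (@le_trans _ _ (\sum_(x < P.+1) normc (G x) ^+ (2 * m.+1))).
  by apply: ler_sum => x _; rewrite ler_piMl ?exprn_ge0 ?normc_ge0.
apply: le_trans (@moment_transfer R P L m c rep near _ _ nU) _.
- by move=> ga /chit/andP[Qr /eqP kr]; rewrite -{2}kr; exact: n0.
- by move=> k rho tu ga h /chit/andP[Qr /eqP kr]; rewrite -{2}kr; exact: nS.
rewrite ler_wpM2l //; apply: (convpow_energy B0 hLa) => //.
- by move=> ga; exact: normc_ge0.
- by rewrite mulr_ge0.
- move=> ga h; have /andP[Qr /eqP <-] : hit ga (rep ga).
    by apply: chit; apply: contraNneq h => ->; rewrite normc0.
  exact: QB.
move=> s s0; rewrite /mass.
apply: (@le_trans _ _ (\sum_(ga | zorder ga == s) La1 * (\sum_(r | hit ga r) F r ^+ 2) / s%:R)).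
  apply: ler_sum => ga /eqP es.
  apply: (@le_trans _ _ (v ga ^+ 2)); first by rewrite lerXn2r ?nnegrE ?normc_ge0.
  by rewrite /v expr_div_n sqr_sqrtr // es ler_wpM2r ?invr_ge0.
rewrite -big_distrl -big_distrr /= ler_wpM2r ?invr_ge0 // ler_wpM2l //.
apply: le_trans (hmass s s0).
rewrite (partition_big key (fun ga => zorder ga == s)) /=; last by move=> r /andP[].
apply: ler_sum => ga /eqP es; rewrite le_eqVlt; apply/orP; left; apply/eqP.
apply: eq_bigl => r; rewrite /hit; case: (eqVneq (key r) ga) => [->|]; rewrite ?andbF //.
by rewrite es eqxx !andbT.
Qed.

(** * Rationals of bounded denominator inside a cyclic group *)

Definition zfrac (L a s : nat) : 'I_L.+1 := inZp (a * (L.+1 %/ s)).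

Lemma zfrac_eq (R : realFieldType) (L a s : nat) : (0 < s)%N -> (s %| L.+1)%N ->
  (zfrac L a s)%:R / L.+1%:R = (a %% s)%:R / s%:R :> R.
Proof.
move=> s0 sL; rewrite /zfrac /=; set e := (L.+1 %/ s)%N.
have eL : L.+1 = (e * s)%N by rewrite divnK.
have e0 : (0 < e)%N by move: (ltn0Sn L); rewrite eL muln_gt0 => /andP[].
have -> : ((a * e) %% L.+1 = (a %% s) * e)%N by rewrite eL [(e * s)%N]mulnC -muln_modl.
rewrite eL !natrM; have he : e%:R != 0 :> R by rewrite pnatr_eq0 -lt0n.
have hs : s%:R != 0 :> R by rewrite pnatr_eq0 -lt0n.
by field; rewrite hs he.
Qed.

Lemma zorder_zfrac (L a s : nat) : (0 < s)%N -> (s %| L.+1)%N -> coprime a s ->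
  zorder (zfrac L a s) = s.
Proof.
move=> s0 sL cas; rewrite /zorder /zfrac /=; set e := (L.+1 %/ s)%N.
have eL : L.+1 = (e * s)%N by rewrite divnK.
have e0 : (0 < e)%N by move: (ltn0Sn L); rewrite eL muln_gt0 => /andP[].
by rewrite gcdn_modr eL [(a * e)%N]mulnC -muln_gcdr [gcdn s a]gcdnC (eqP cas) muln1 mulKn.
Qed.

Lemma int_lt1_eq0 (R : realDomainType) (z : int) : `|z%:~R : R| < 1 -> z = 0.
Proof.
rewrite -intr_norm -[1]/(1%:~R) ltr_int => h.
by apply/eqP; rewrite -normr_le0 -ltzD1 add0r.
Qed.

Lemma zorder_int (R : realFieldType) (L : nat) (tu : 'I_L.+1) :
  exists n : nat, (zorder tu)%:R * (tu%:R / L.+1%:R) = n%:R :> R.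
Proof.
have : ker (zorder tu) tu by rewrite ker_zorder.
rewrite /ker => /dvdnP[n hn]; exists n.
rewrite mulrA -natrM hn natrM mulfK // pnatr_eq0 //.
Qed.

(** Closeness is modulo 1, hence the integer z. The bound on the order is included because
    [near_uniq] separates rationals by their denominators; both bounds grow with k so as to be
    stable under adding one major frequency. *)
Definition near (R : realFieldType) (P L B : nat) (eta : R) (k : nat) (rho : 'I_P.+1) (tu : 'I_L.+1) : Prop :=
  (zorder tu <= B ^ k.+1)%N /\
  exists z : int, `|rho%:R / P.+1%:R - tu%:R / L.+1%:R - z%:~R| <= k.+1%:R * eta.

Lemma ordD_frac (R : realFieldType) (P : nat) (r s : 'I_P.+1) :
  exists z : int, (r + s)%R%:R / P.+1%:R = r%:R / P.+1%:R + s%:R / P.+1%:R - z%:~R :> R.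
Proof.
exists ((r + s)%N %/ P.+1)%N%:Z; rewrite /= -pmulrn -mulrDl -natrD.
have e : (r + s)%N%:R = ((r + s)%N %/ P.+1)%:R * P.+1%:R + ((r + s)%N %% P.+1)%:R :> R.
  by rewrite {1}(divn_eq (r + s)%N P.+1) natrD natrM.
by rewrite e mulrDl mulfK ?pnatr_eq0 // addrAC subrr add0r.
Qed.

Lemma nearS (R : realFieldType) (P L B : nat) (eta : R) (k : nat) (rho r : 'I_P.+1) (tu ga : 'I_L.+1) :
  near B eta k rho tu -> near B eta 0 r ga -> near B eta k.+1 (rho + r) (tu + ga).
Proof.
case=> h1 [z1 hz1] [h2 [z2 hz2]]; split.
  have : ker (zorder tu * zorder ga) (tu + ga).
    by apply: kerD; rewrite ker_zorder; [exact: dvdn_mulr | exact: dvdn_mull].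
  rewrite ker_zorder => /dvdn_leq; rewrite muln_gt0 !zorder_gt0 => /(_ isT) h3.
  by rewrite expnS mulnC (leq_trans h3) // leq_mul // -[B]expn1.
have [w1 e1] := ordD_frac R rho r; have [w2 e2] := ordD_frac R tu ga.
exists (z1 + z2 - w1 + w2); rewrite e1 e2.
have -> : rho%:R / P.+1%:R + r%:R / P.+1%:R - w1%:~R - (tu%:R / L.+1%:R + ga%:R / L.+1%:R - w2%:~R)
    - (z1 + z2 - w1 + w2)%:~R =
   (rho%:R / P.+1%:R - tu%:R / L.+1%:R - z1%:~R) + (r%:R / P.+1%:R - ga%:R / L.+1%:R - z2%:~R) :> R.
  by rewrite !intrD intrN; ring.
apply: le_trans (ler_normD _ _) _; apply: le_trans (lerD hz1 hz2) _.
by rewrite -[k.+2%:R]natr1 mulrDl.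
Qed.

(** Rationals with denominators at most B^(k + 1) that differ modulo 1 are at least B^(-2 (k + 1))
    apart there, more than twice the tolerance. *)
Lemma near_uniq (R : realFieldType) (P L B : nat) (eta : R) (k : nat) (rho : 'I_P.+1) (tu tu' : 'I_L.+1) :
  (0 < B)%N -> 0 <= eta ->
  (B ^ k.+1 * B ^ k.+1)%:R * (2 * k.+1%:R * eta) < 1 ->
  near B eta k rho tu -> near B eta k rho tu' -> tu = tu'.
Proof.
move=> B0 eta0 hs [h1 [z1 hz1]] [h2 [z2 hz2]].
have [n1 e1] := zorder_int R tu; have [n2 e2] := zorder_int R tu'.
set o1 := zorder tu in h1 e1; set o2 := zorder tu' in h2 e2.
have o10 : (0 < o1)%N by exact: zorder_gt0. have o20 : (0 < o2)%N by exact: zorder_gt0.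
have o1p : 0 < o1%:R :> R by rewrite ltr0n. have o2p : 0 < o2%:R :> R by rewrite ltr0n.
pose x : R := tu%:R / L.+1%:R - tu'%:R / L.+1%:R - (z2 - z1)%:~R.
have hx : `|x| <= 2 * k.+1%:R * eta.
  have -> : x = (rho%:R / P.+1%:R - tu'%:R / L.+1%:R - z2%:~R)
     - (rho%:R / P.+1%:R - tu%:R / L.+1%:R - z1%:~R) by rewrite /x intrB; ring.
  apply: le_trans (ler_normB _ _) _; apply: le_trans (lerD hz2 hz1) _.
  by rewrite le_eqVlt; apply/orP; left; apply/eqP; ring.
have hxi : (o1 * o2)%:R * x = (n1%:Z * o2%:Z - n2%:Z * o1%:Z - (z2 - z1) * (o1 * o2)%:Z)%:~R.
  rewrite intrB [X in X - _]intrB !intrM -!pmulrn /x !natrM -e1 -e2; ring.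
have x0 : x = 0.
  have hz : `|(o1 * o2)%:R * x| < 1.
    rewrite normrM ger0_norm //; apply: le_lt_trans hs; apply: ler_pM => //.
    by rewrite ler_nat leq_mul.
  rewrite hxi in hz; have := int_lt1_eq0 hz => hz0.
  move: hxi; rewrite hz0 => /eqP; rewrite mulf_eq0 pnatr_eq0 muln_eq0 !gtn_eqF //=.
  by move/eqP.
have Lp : L.+1%:R != 0 :> R by rewrite pnatr_eq0.
have hd : (tu%:R - tu'%:R) / L.+1%:R = (z2 - z1)%:~R :> R.
  by move/eqP: x0; rewrite /x -mulrBl subr_eq0 => /eqP.
have hz : `|(z2 - z1)%:~R : R| < 1.
  rewrite -hd normrM [X in _ * X]ger0_norm ?invr_ge0 // ltr_pdivrMr ?ltr0n // mul1r.
  have a1 : tu%:R < L.+1%:R :> R by rewrite ltr_nat.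
  have a2 : tu'%:R < L.+1%:R :> R by rewrite ltr_nat.
  have a3 : 0 <= tu%:R :> R by []. have a4 : 0 <= tu'%:R :> R by [].
  by rewrite ltr_norml; move: a1 a2 a3 a4; clear; lra.
have hz0 := int_lt1_eq0 hz; move: hd; rewrite hz0 => /eqP.
rewrite mulf_eq0 invr_eq0 (negbTE Lp) orbF subr_eq0 eqr_nat => /eqP h.
exact: val_inj.
Qed.

(* The real numbers P * (r / P - a r / s) with a r in a fixed class modulo s
   differ by integers, and are pairwise distinct. *)
Lemma count_inv (R : realType) (N P B s b : nat) (a : 'I_P -> nat) (Q : pred 'I_P) :
  (0 < N)%N -> (P = 3 * N)%N -> (0 < B)%N -> (0 < s)%N ->
  (forall r, Q r -> (a r %% s = b)%N /\ 1 + N%:R * `|r%:R / P%:R - (a r)%:R / s%:R| <= B%:R :> R) ->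
  \sum_(r < P | Q r) (1 + N%:R * `|r%:R / P%:R - (a r)%:R / s%:R|)^-1 <= 18 * (1 + ln B%:R) :> R.
Proof.
move=> N0 PN B0 s0 hQ.
have Np : 0 < N%:R :> R by rewrite ltr0n.
have Pp : 0 < P%:R :> R by rewrite ltr0n PN muln_gt0.
have PNR : P%:R = 3 * N%:R :> R by rewrite PN natrM.
have sp : 0 < s%:R :> R by rewrite ltr0n.
have Bp : 0 < B%:R :> R by rewrite ltr0n.
pose d (r : 'I_P) : R := r%:R / P%:R - (a r)%:R / s%:R.
pose x (r : 'I_P) : R := P%:R * d r.
have xd r : N%:R * `|d r| = `|x r| / 3.
  by rewrite /x normrM ger0_norm ?ltW // PNR; field.
pose n (r : 'I_P) := Num.truncn `|x r|.
have hn r : (n r)%:R <= `|x r| < (n r).+1%:R by apply: truncn_itv.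
have nB r : Q r -> (n r < 3 * B)%N.
  move=> /hQ[_]; rewrite -/(d r) xd => h; have /andP[h1 _] := hn r.
  by rewrite -(ltr_nat R) natrM; move: h h1; clear; lra.
(* Two values of x with the same sign and the same integer part of |x| differ by less than 1, hence
   coincide; so each integer part occurs at most twice. *)
pose h (r : 'I_P) : 'I_(3 * B).+1 * bool := (inord (n r), 0 <= x r).
have hv r : Q r -> (inord (n r) : 'I_(3 * B).+1) = n r :> nat.
  by move=> /nB hr; rewrite inordK // ltnS ltnW.
pose G (q : 'I_(3 * B).+1 * bool) : R := 3 * (q.1.+1%:R)^-1.
apply: (@le_trans _ _ (\sum_(r < P | Q r) G (h r))).
  apply: ler_sum => r Qr; rewrite /G /= hv // -/(d r) xd.
  have /andP[h1 _] := hn r; have n0 : 0 <= (n r)%:R :> R by [].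
  have q1 : 0 < 1 + `|x r| / 3 by rewrite ltr_wpDr // divr_ge0.
  have q2 : 0 < (n r).+1%:R :> R by rewrite ltr0n.
  rewrite -div1r ler_pdivrMr // mulrAC ler_pdivlMr // -natr1; move: h1 n0; clear; lra.
apply: (@le_trans _ _ (\sum_q G q)).
  apply: (@sum_inj_le _ _ _ _ predT h G) => //; last first.
    by move=> q _; rewrite /G mulr_ge0 // invr_ge0.
  move=> r1 r2 Q1 Q2 [/(congr1 val) /=]; rewrite !hv // => en es.
  have /andP[u1 u2] := hn r1; have /andP[v1 v2] := hn r2; rewrite -en in v1 v2.
  have close : `|x r1 - x r2| < 1.
    rewrite -natr1 in u2 v2; move: es u1 u2 v1 v2; case: (lerP 0 (x r1)) => g1.
      case: (lerP 0 (x r2)) => // g2 _; rewrite (ger0_norm g1) (ger0_norm g2).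
      by move: g1 g2; clear; rewrite ltr_norml; lra.
    case: (lerP 0 (x r2)) => // g2 _; rewrite (ltr0_norm g1) (ltr0_norm g2).
    by move: g1 g2; clear; rewrite ltr_norml; lra.
  have [b1 _] := hQ _ Q1; have [b2 _] := hQ _ Q2.
  have ea (r : 'I_P) : (a r)%:R / s%:R = (a r %/ s)%:R + (a r %% s)%:R / s%:R :> R.
    by rewrite {1}(divn_eq (a r) s) natrD natrM mulrDl mulfK // gt_eqF.
  have ex : x r1 - x r2 = ((r1 : nat)%:Z - (r2 : nat)%:Z - P%:Z * ((a r1 %/ s)%:Z - (a r2 %/ s)%:Z))%:~R.
    rewrite /x /d (ea r1) (ea r2) b1 b2 !intrB intrM !intrB -!pmulrn.
    by field; rewrite ?gt_eqF.
  rewrite ex in close; have := int_lt1_eq0 close.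
  have := ltn_ord r1; have := ltn_ord r2.
  move: (a r1 %/ s)%N (a r2 %/ s)%N => t1 t2 l1 l2 e0; apply: val_inj => /=.
  move: l1 l2 e0; move: (nat_of_ord r1) (nat_of_ord r2) => i j l1 l2 e0; clear -l1 l2 e0.
  have : t1 = t2 by nia.
  by move=> et; rewrite et subrr mulr0 subr0 in e0; lia.
rewrite -(pair_big predT predT (fun (i : 'I_(3 * B).+1) (_ : bool) => 3 * (i.+1%:R)^-1)) /=.
under eq_bigr do rewrite sumr_const card_bool.
have -> : \sum_(i < (3 * B).+1) (3 * (i.+1%:R)^-1 : R) *+ 2 = 6 * \sum_(i < (3 * B).+1) (i.+1%:R)^-1.
  by rewrite big_distrr; apply: eq_bigr => i _ /=; rewrite -mulr_natl; ring.
have := harm_ln R (ltn0Sn (3 * B)); rewrite big_ord_recl /= invr0 add0r => hh.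
have {}hh : \sum_(i < (3 * B).+1) (i.+1%:R)^-1 <= 1 + ln (3 * B).+1%:R :> R.
  by apply: le_trans hh; apply: ler_sum => i _; rewrite /bump add1n.
have : ln (3 * B).+1%:R <= 2 + ln B%:R :> R.
  apply: (@le_trans _ _ (ln (4 * B)%:R)).
    by rewrite ler_ln ?posrE ?ltr0n ?muln_gt0 // ler_nat; lia.
  rewrite natrM lnM ?posrE // lerD2r.
  have -> : 4 = 2 * 2 :> R by ring.
  rewrite lnM ?posrE //.
  by have := @le_ln1Dx R 1; rewrite (_ : 1 + 1 = 2) // => /(_ (lt_trans (ltrN10 R) ltr01)); clear; lra.
have : 0 <= ln B%:R :> R by rewrite ln_ge0 // ler1n.
move: hh; clear; lra.
Qed.

Lemma bal_norm (R : realType) (N : nat) (A : nat -> bool) (x : nat) : `|bal R N A x| <= 1.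
Proof.
have /andP[d0 d1] := density_itv R N A; rewrite /bal; case: ifP => _; last by rewrite normr0.
by rewrite ler_norml; case: (A x) => /=; apply/andP; split; move: d0 d1; clear; lra.
Qed.

Lemma sum_bal_norm (R : realType) (N P : nat) (A : nat -> bool) : (N <= P)%N ->
  \sum_(x < P) `|bal R N A x| <= 2 * (density R N A * N%:R).
Proof.
move=> NP; have /andP[d0 d1] := density_itv R N A.
apply: (@le_trans _ _ (\sum_(x < N) ((A x)%:R + density R N A))).
  rewrite (big_ord_widen P (fun x => (A x)%:R + density R N A) NP) [leRHS]big_mkcond /=.
  apply: ler_sum => x _; rewrite /bal; case: ifP => _; last by rewrite normr0.
  by apply: le_trans (ler_normB _ _) _; rewrite !ger0_norm.
by rewrite big_split /= sumr_const card_ord -densityM -[X in _ + X]mulr_natr; clear; lra.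
Qed.

Lemma sum_bal_sq (R : realType) (N P : nat) (A : nat -> bool) : (N <= P)%N ->
  \sum_(x < P) bal R N A x ^+ 2 <= density R N A * N%:R.
Proof.
move=> NP; have /andP[d0 d1] := density_itv R N A; set d := density R N A in d0 d1 *.
apply: (@le_trans _ _ (\sum_(x < N) ((1 - 2 * d) * (A x)%:R + d ^+ 2))).
  rewrite (big_ord_widen P (fun x => (1 - 2 * d) * (A x)%:R + d ^+ 2) NP) [leRHS]big_mkcond /=.
  apply: ler_sum => x _; rewrite /bal; case: ifP => _; last by rewrite expr0n.
  by rewrite -/d; case: (A x) => /=; clear; lra.
rewrite big_split -big_distrr /= -densityM sumr_const card_ord -[X in _ + X]mulr_natr -/d.
have : 0 <= d ^+ 2 * N%:R by rewrite mulr_ge0 ?exprn_ge0.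
clear; lra.
Qed.

Lemma cos_quarter (R : realType) (x : R) : `|x| <= 1 / 8 -> 1 <= 2 * cos (2 * pi * x) ^+ 2.
Proof.
move=> hx.
have : 0 <= cos ((2 * pi * x) *+ 2).
  apply: cos_ge0_pihalf; have pi0 := pi_ge0 R.
  move: hx; rewrite ler_norml => /andP[h1 h2].
  have := ler_wpM2l pi0 h1; have := ler_wpM2l pi0 h2.
  by move=> k1 k2; apply/andP; split; move: k1 k2; clear; lra.
rewrite cos_mulr2n -mulr_natl; clear; lra.
Qed.

(** Every term has real part at least 1 / sqrt 2. Allowing th and u to differ by an integer disposes
    of the multiples of a / s. *)
Lemma major_geom (R : realType) (l : nat) (u : nat -> R) (th : nat -> R) :
  (forall j, (j < l)%N -> cis (th j) = cis (u j) /\ `|u j| <= 1 / 8) ->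
  l%:R ^+ 2 <= 2 * normc (\sum_(j < l) cis (th j)) ^+ 2.
Proof.
move=> hu.
have h j : (j < l)%N -> 1 <= Num.sqrt 2 * complex.Re (cis (th j)).
  move=> jl; have [-> hj] := hu j jl; have := cos_quarter hj.
  have c0 : 0 <= cos (2 * pi * u j).
    apply: cos_ge0_pihalf; have pi0 := pi_ge0 R.
    move: hj; rewrite ler_norml => /andP[h1 h2].
    have := ler_wpM2l pi0 h1; have := ler_wpM2l pi0 h2.
    by move=> k1 k2; apply/andP; split; move: k1 k2; move: pi0; clear; lra.
  move=> h; rewrite /cis /= -ler_sqr ?nnegrE ?mulr_ge0 ?sqrtr_ge0 //.
  by rewrite expr1n exprMn sqr_sqrtr.
have hRe : complex.Re (\sum_(j < l) cis (th j)) = \sum_(j < l) complex.Re (cis (th j)).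
  exact: (big_morph _ (@complexReD R) (erefl _)).
have h1 : l%:R <= Num.sqrt 2 * normc (\sum_(j < l) cis (th j)).
  apply: (@le_trans _ _ (Num.sqrt 2 * \sum_(j < l) complex.Re (cis (th j)))).
    rewrite big_distrr /=; apply: (@le_trans _ _ (\sum_(j < l) 1)).
      by rewrite sumr_const card_ord.
    by apply: ler_sum => j _; exact: h.
  rewrite ler_wpM2l ?sqrtr_ge0 // -hRe; apply: le_trans (ler_norm _) _; exact: normc_Re_le.
have : l%:R ^+ 2 <= (Num.sqrt 2 * normc (\sum_(j < l) cis (th j))) ^+ 2.
  by rewrite lerXn2r ?nnegrE ?mulr_ge0 ?sqrtr_ge0 ?normc_ge0.
by rewrite exprMn sqr_sqrtr.
Qed.

(** With the minor part subtracted, P de^2 N / 4 <= sC Psi, and the 2k-th power of this meets the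
    moment bound. Since P = 3 N all powers of N cancel, and the exponent 2 k - 1 in place of 2 k
    leaves the factor 2 de on the left. *)
Lemma density_le_of_moment (R : realFieldType) (k N M : nat) (de C1 La1 nu Z Psi sC P : R) :
  (0 < N)%N -> (0 < M)%N -> (0 < k)%N -> 0 < de -> 0 < C1 -> 0 <= La1 -> 0 <= nu -> 0 <= Z -> 0 <= Psi ->
  P = 3 * N%:R -> 0 <= sC -> sC ^+ 2 = C1 ->
  P * (1 / 2 * M%:R * de ^+ 2 * N%:R) <= de / 4 * M%:R * (P * (de * N%:R)) + sC * M%:R * Psi ->
  Psi ^+ (2 * k) <= (2 * (de * N%:R)) ^+ (2 * k).-1 * P * ((La1 * (12 * nu * de ^+ 2 * N%:R * P)) ^+ k * Z) ->
  2 * de <= 3 * (256 * C1 * La1 * nu) ^+ k * Z.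
Proof.
move=> N0 M0 k0 de0 C10 La10 nu0 Z0 Psi0 eP sC0 sC2 h1 h2.
have Np : 0 < N%:R :> R by rewrite ltr0n.
have Mp : 0 < M%:R :> R by rewrite ltr0n.
have h3 : P * de ^+ 2 * N%:R / 4 <= sC * Psi.
  rewrite -(ler_pM2r Mp); move: h1; clear; lra.
have h3' : (P * de ^+ 2 * N%:R / 4) ^+ 2 <= (sC * Psi) ^+ 2.
  apply: lerXn2r => //; rewrite nnegrE; last exact: mulr_ge0.
  by rewrite eP; do ?apply: mulr_ge0 => //; rewrite ?exprn_ge0 ?(ltW de0) ?invr_ge0.
pose U := 9 * de ^+ 4 * N%:R ^+ 4 / (16 * C1).
have U0 : 0 < U by rewrite divr_gt0 ?mulr_gt0 ?exprn_gt0.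
have hU : U <= Psi ^+ 2.
  rewrite ler_pdivrMr ?mulr_gt0 //; move: h3'; rewrite [(sC * Psi) ^+ 2]exprMn sC2 eP expr_div_n.
  have -> : (3 * N%:R * de ^+ 2 * N%:R) ^+ 2 = 9 * de ^+ 4 * N%:R ^+ 4 by ring.
  by rewrite ler_pdivrMr ?exprn_gt0 //; clear; lra.
have h4 : U ^+ k <= Psi ^+ (2 * k).
  by rewrite exprM; apply: lerXn2r; rewrite ?nnegrE ?exprn_ge0 // ltW.
have dN : 0 < 2 * (de * N%:R) by rewrite !mulr_gt0.
have h5 := le_trans h4 h2.
have h6 : 2 * (de * N%:R) * U ^+ k <= 3 * N%:R * (144 * La1 * nu * de ^+ 4 * N%:R ^+ 4) ^+ k * Z.
  apply: le_trans (ler_wpM2l (ltW dN) h5) _.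
  set D := 2 * (de * N%:R); set X := La1 * _.
  have -> : D * (D ^+ (2 * k).-1 * P * (X ^+ k * Z)) = D ^+ (2 * k).-1.+1 * P * X ^+ k * Z.
    by rewrite exprS; ring.
  rewrite prednK ?muln_gt0 // exprM.
  have -> : (D ^+ 2) ^+ k * P * X ^+ k * Z = P * (D ^+ 2 * X) ^+ k * Z.
    by rewrite [(D ^+ 2 * X) ^+ k]exprMn; clearbody D X; ring.
  have -> : D ^+ 2 * X = 144 * La1 * nu * de ^+ 4 * N%:R ^+ 4 by rewrite /D /X eP; ring.
  by rewrite eP.
have e7 : 144 * La1 * nu * de ^+ 4 * N%:R ^+ 4 = (256 * C1 * La1 * nu) * U.
  by rewrite /U; field; rewrite gt_eqF.
rewrite e7 in h6; clearbody U; rewrite [(_ * U) ^+ k]exprMn in h6.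
have Uk : 0 < U ^+ k by rewrite exprn_gt0.
rewrite -(ler_pM2r (mulr_gt0 Np Uk)).
by move: h6; move: (U ^+ k) ((256 * C1 * La1 * nu) ^+ k) => a b; clear; lra.
Qed.

(** * Density increment *)

(* If no progression of step lam s, s <= B, carries an increment, the mass of the
   transform on the frequencies of denominator s is O(nu de^2 N P); Hoelder with
   exponent 2 (m + 1) then compares the major arc contribution with the additive
   energy of the rationals of denominator at most B. *)
Lemma no_increment (R : realType) (al be ga kp M N B H m : nat) (A : nat -> bool)
    (nu c1 La : R) (lam ell : nat -> nat) (de := density R N A) :
  (0 < N)%N -> (0 < al)%N -> (0 < M)%N -> (0 < kp)%N -> (0 < B)%N -> 1 <= c1 -> 0 <= nu <= 1 -> 0 < de ->
  (forall G, (G %| 2 * al -> G %| 2 * be -> G <= kp)%N) ->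
  (quad al be ga M <= N)%N -> N%:R <= c1 * al%:R * M%:R ^+ 2 ->
  32 * kp%:R * c1 / (de / 4) ^+ 2 <= Num.sqrt (B%:R : R) ->
  5500 * c1 ^+ 2 * al%:R ^+ 2 * B%:R / (de / 4) ^+ 2 <= Num.sqrt M%:R ->
  (H <= N)%N -> (forall n, (n < M)%N -> (quad al be ga n <= H)%N) ->
  (forall n x, (n < M)%N -> (x + quad al be ga n < N)%N -> A x -> A (x + quad al be ga n)%N -> False) ->
  (4 * \sum_(j < H) A j <= \sum_(x < N) A x)%N ->
  (4 * \sum_(j < H) A (N - H + j) <= \sum_(x < N) A x)%N ->
  (forall s, (0 < s <= B)%N -> [/\ (s %| lam s)%N, (0 < lam s)%N, (0 < ell s)%N &
     8 * B%:R * (lam s * ell s)%:R <= nu * N%:R]) ->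
  (forall s x0, (0 < s <= B)%N -> (x0 + lam s * (ell s).-1 < N)%N ->
     \sum_(j < ell s) (A (x0 + lam s * j)%N)%:R <= (1 + nu) * de * (ell s)%:R) ->
  (B ^ m.+1 * B ^ m.+1)%:R * (2 * m.+1%:R * (B%:R / N%:R)) < 1 :> R ->
  1 + m.+1%:R * ln B%:R <= La ->
  2 * de <= 3 * ((256 * 17 * 18) * kp%:R * c1 * (1 + ln B%:R) ^+ 2 * nu) ^+ m.+1 * La ^+ (2 * 16 ^ m.+1).
Proof.
move=> N0 al0 M0 kp0 B0 c11 hnu de0 hcont hqN hN2 hB hM HN hH hA hA1 hA2 hlam hinc hsep hLa.
have /andP[nu0 nu1] := hnu.
have /andP[_ de1] : 0 <= de <= 1 := density_itv R N A.
have [P' eP] : exists P', (3 * N = P'.+1)%N by exists (3 * N).-1; rewrite prednK // muln_gt0.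
have [L eL] : exists L, (B`! = L.+1)%N by exists (B`!).-1; rewrite prednK // fact_gt0.
have Np : 0 < N%:R :> R by rewrite ltr0n.
have Bp : 0 < B%:R :> R by rewrite ltr0n.
have B1 : 1 <= B%:R :> R by rewrite ler1n.
have lB0 : 0 <= ln (B%:R : R) by rewrite ln_ge0.
have kpp : 0 < kp%:R :> R by rewrite ltr0n.
have c10 : 0 < c1 by apply: lt_le_trans c11.
have NP : (2 * N < P'.+1)%N by rewrite -eP ltn_pmul2r.
have NP1 : (N <= P'.+1)%N by apply: leq_trans (ltnW NP); rewrite leq_pmull.
have PR : P'.+1%:R = 3 * N%:R :> R by rewrite -eP natrM.
have Pp : 0 < P'.+1%:R :> R by rewrite ltr0n.
pose S (r : nat) : R[i] := \sum_(n < M) cis (r%:R / P'.+1%:R * (quad al be ga n)%:R).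
pose C1 : R := 17 * kp%:R * c1 * (1 + ln B%:R).
have C10 : 0 < C1 by rewrite !mulr_gt0 // ltr_wpDr.
have eps_ : 0 < de / 4 <= 1 by apply/andP; split; move: de0 de1; clear; lra.
have [g hg] : exists g : 'I_P'.+1 -> nat * nat, forall r : 'I_P'.+1,
   [/\ (0 < (g r).2)%N, coprime (g r).1 (g r).2 &
    let y := 1 + N%:R * `|(r : nat)%:R / P'.+1%:R - (g r).1%:R / (g r).2%:R| in
    normc (S r) <= de / 4 * M%:R \/
    (g r).2%:R * y <= B%:R /\ normc (S r) ^+ 2 <= C1 * M%:R ^+ 2 / ((g r).2%:R * y)].
  apply: (@fin_all_exists _ _ (fun (r : 'I_P'.+1) (q : nat * nat) => [/\ (0 < q.2)%N, coprime q.1 q.2 &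
    let y := 1 + N%:R * `|(r : nat)%:R / P'.+1%:R - q.1%:R / q.2%:R| in
    normc (S r) <= de / 4 * M%:R \/
    q.2%:R * y <= B%:R /\ normc (S r) ^+ 2 <= C1 * M%:R ^+ 2 / (q.2%:R * y)])) => r.
  have [a [s [s0 cas h]]] := @weyl_dichotomy R al be ga M N P'.+1 r kp c1 (de / 4) B%:R
    al0 M0 (ltn0Sn _) kp0 c11 eps_ B1 hB hcont hqN hN2 hM.
  by exists (a, s); split.
pose y (r : 'I_P'.+1) : R := 1 + N%:R * `|(r : nat)%:R / P'.+1%:R - (g r).1%:R / (g r).2%:R|.
have y1 r : 1 <= y r by rewrite lerDl mulr_ge0.
pose Q (r : 'I_P'.+1) := (g r).2%:R * y r <= B%:R.
pose key (r : 'I_P'.+1) : 'I_L.+1 := zfrac L (g r).1 (g r).2.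
have s1 r : 1 <= (g r).2%:R :> R by have [h _ _] := hg r; rewrite ler1n.
have Qs r : Q r -> ((g r).2 <= B)%N.
  rewrite /Q -(ler_nat R); apply: le_trans; rewrite ler_peMr // (le_trans ler01) //.
have Qy r : Q r -> y r <= B%:R.
  by rewrite /Q; apply: le_trans; rewrite ler_peMl // (le_trans ler01).
have sL r : Q r -> ((g r).2 %| L.+1)%N.
  by move=> /Qs h; rewrite -eL dvdn_fact // h andbT; have [] := hg r.
have zk r : Q r -> zorder (key r) = (g r).2.
  by move=> Qr; have [h1 h2 _] := hg r; rewrite zorder_zfrac // sL.
pose eta : R := B%:R / N%:R.
have eta0 : 0 <= eta by rewrite divr_ge0.
have Qd r : Q r -> `|(r : nat)%:R / P'.+1%:R - (g r).1%:R / (g r).2%:R| <= eta.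
  move=> /Qy; rewrite /y /eta ler_pdivlMr // mulrC; clear; lra.
have keyE r : Q r -> exists z : nat, (g r).1%:R / (g r).2%:R = (key r)%:R / L.+1%:R + z%:R :> R.
  move=> Qr; have [h1 _ _] := hg r; exists ((g r).1 %/ (g r).2)%N.
  have E := zfrac_eq R (g r).1 h1 (sL r Qr); rewrite [X in X + _]E.
  have hs : (g r).2%:R != 0 :> R by rewrite pnatr_eq0 -lt0n.
  move: (g r).1 (g r).2 hs => u v hs; rewrite {1}(divn_eq u v) natrD natrM mulrDl mulfK //.
  exact: addrC.
pose F r := normc (dft P'.+1 (bal R N A) r).
have F0 r : 0 <= F r by exact: normc_ge0.
pose Psi := \sum_(r < P'.+1 | Q r) F r ^+ 2 / (Num.sqrt (zorder (key r))%:R * Num.sqrt (y r)).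
have Psi0 : 0 <= Psi.
  by apply: sumr_ge0 => r _; rewrite divr_ge0 ?sqr_ge0 // mulr_ge0 ?sqrtr_ge0.
pose La1 : R := 18 * (1 + ln B%:R).
have m20 : 0 <= 12 * nu * de ^+ 2 * N%:R * P'.+1%:R.
  have d2 : 0 <= de ^+ 2 by rewrite exprn_ge0 // ltW.
  apply: mulr_ge0 => //; apply: mulr_ge0 => //; apply: mulr_ge0 => //.
  exact: mulr_ge0.
have La10 : 0 <= La1 by rewrite mulr_ge0 // addr_ge0.
have La0 : 0 <= La by apply: le_trans hLa; rewrite addr_ge0 // mulr_ge0.
have hS (r : 'I_P'.+1) : normc (S r) <= de / 4 * M%:R +
   (if Q r then Num.sqrt C1 * M%:R / (Num.sqrt (zorder (key r))%:R * Num.sqrt (y r)) else 0).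
  have e0 : 0 <= de / 4 * M%:R by rewrite mulr_ge0 // ltW //; case/andP: eps_.
  have [sp _ [h|[h1 h2]]] := hg r.
    apply: (le_trans h); rewrite lerDl; case: ifP => // _.
    by rewrite divr_ge0 ?mulr_ge0 ?sqrtr_ge0.
  have Qr : Q r by []. rewrite Qr zk //.
  have yp : 0 < y r := lt_le_trans ltr01 (y1 r).
  have spR : 0 < (g r).2%:R :> R by rewrite ltr0n.
  apply: (@le_trans _ _ (Num.sqrt C1 * M%:R / (Num.sqrt (g r).2%:R * Num.sqrt (y r)))); last by rewrite lerDr.
  rewrite -ler_sqr ?nnegrE ?normc_ge0 ?divr_ge0 ?mulr_ge0 ?sqrtr_ge0 //.
  apply: (le_trans h2); rewrite expr_div_n !exprMn !sqr_sqrtr ?(ltW C10) ?(ltW spR) ?(ltW yp) //.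
have hlow : P'.+1%:R * (1 / 2 * M%:R * de ^+ 2 * N%:R) <= \sum_(r < P'.+1) F r ^+ 2 * normc (S r).
  exact: (@correlation_lower R N P'.+1 M H A (fun n => quad al be ga n) NP HN hH hA hA1 hA2).
have hup : P'.+1%:R * (1 / 2 * M%:R * de ^+ 2 * N%:R) <=
   de / 4 * M%:R * (P'.+1%:R * (de * N%:R)) + Num.sqrt C1 * M%:R * Psi.
  apply: (le_trans hlow).
  apply: (@le_trans _ _ (\sum_(r < P'.+1) (de / 4 * M%:R * F r ^+ 2 +
     (if Q r then Num.sqrt C1 * M%:R * (F r ^+ 2 / (Num.sqrt (zorder (key r))%:R * Num.sqrt (y r))) else 0)))).
    apply: ler_sum => r _; apply: le_trans (ler_wpM2l (sqr_ge0 _) (hS r)) _.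
    rewrite mulrDr [F r ^+ 2 * (de / 4 * _)]mulrC lerD2l; case: ifP => _; last by rewrite mulr0.
    by rewrite le_eqVlt; apply/orP; left; apply/eqP; ring.
  rewrite big_split -big_distrr /= -big_mkcond -big_distrr /= -/Psi lerD2r.
  rewrite ler_wpM2l //; first by rewrite mulr_ge0 // ltW //; case/andP: eps_.
  have := parseval (fun x : 'I_P'.+1 => (bal R N A x)%:C) (ltn0Sn P'); rewrite -/(dft _ _ _) => ->.
  rewrite ler_wpM2l //; apply: le_trans (sum_bal_sq R A NP1).
  by apply: ler_sum => x _; rewrite normc_real real_normK ?num_real.
have hmom := @spectrum_moment R P' L m B (bal R N A) key y Q (2 * (de * N%:R))
   (12 * nu * de ^+ 2 * N%:R * P'.+1%:R) La1 La (near B eta) B0 hLa La10.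
have {}hmom : Psi ^+ (2 * m.+1) <= (2 * (de * N%:R)) ^+ (2 * m.+1).-1 * P'.+1%:R *
   ((La1 * (12 * nu * de ^+ 2 * N%:R * P'.+1%:R)) ^+ m.+1 * La ^+ (2 * 16 ^ m.+1)).
  apply: hmom.
  - exact: m20.
  - exact: bal_norm.
  - exact: sum_bal_norm.
  - by move=> r Qr; rewrite zk // Qs.
  - by move=> r _; exact: y1.
  - move=> s s0; case: (leqP s B) => sB; last first.
      rewrite big_pred0; first exact: m20.
      move=> r; apply/negbTE/negP => /andP[Qr /eqP zs]; move: sB.
      by rewrite -zs zk // ltnNge Qs.
    have sB' : (0 < s <= B)%N by rewrite s0.
    have [sl l0 e0 hl] := hlam s sB'.
    apply: (@major_mass R N P'.+1 (lam s) (ell s) A nu (fun r => Q r && (zorder (key r) == s))) => //.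
    + apply: le_trans hl; rewrite ler_wpM2r // -[leLHS]mulr1 ler_wpM2l //.
    + by move=> x0 hx0; exact: hinc.
    (* Multiples of lam, being multiples of s, turn a / s into an integer; what remains is b lam j,
       at most eta lam ell <= 1/8. *)
    + move=> r /andP[Qr /eqP zs]; have [sp _ _] := hg r.
      have es : (g r).2 = s by rewrite -zk.
      pose b : R := (r : nat)%:R / P'.+1%:R - (g r).1%:R / (g r).2%:R.
      apply: (@major_geom R (ell s) (fun j => b * (lam s * j)%:R)
        (fun j => (r * (lam s * j))%:R / P'.+1%:R)) => j jl; split.
        have [q hq] := dvdnP sl.
        have -> : (r * (lam s * j))%:R / P'.+1%:R = ((g r).1 * q * j)%:R + b * (lam s * j)%:R :> R.
          have sR : s%:R != 0 :> R by rewrite pnatr_eq0 -lt0n.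
          have PR0 : P'.+1%:R != 0 :> R by rewrite gt_eqF.
          rewrite /b es hq !natrM; move: (P'.+1%:R : R) (s%:R : R) PR0 sR => p u hp hu.
          by field; rewrite hp hu.
        by rewrite cisDnat.
      rewrite normrM [X in _ * X]ger0_norm //.
      apply: (@le_trans _ _ (eta * (lam s * ell s)%:R)).
        by apply: ler_pM => //; [exact: Qd | rewrite ler_nat leq_mul2l ltnW ?orbT].
      rewrite /eta mulrAC ler_pdivrMr //.
      have : nu * N%:R <= N%:R by rewrite ler_piMl.
      by move: hl; clear; lra.
  (* Major frequencies attached to one group element share the denominator s and the class of a
     modulo s, as [count_inv] requires. *)
  - move=> ga'; case: (pickP (fun r => Q r && (key r == ga'))) => [r0 /andP[Q0 /eqP k0]|h0]; last first.
      by rewrite big_pred0.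
    have [sp0 _ _] := hg r0; have zg : zorder ga' = (g r0).2 by rewrite -k0 zk.
    set s := (g r0).2 in sp0 zg.
    have hs r : Q r && (key r == ga') -> (g r).2 = s.
      by move=> /andP[Qr /eqP kr]; rewrite -zk // kr zg.
    have := @count_inv R N P'.+1 B s ((g r0).1 %% s) (fun r => (g r).1) (fun r => Q r && (key r == ga'))
      N0 (esym eP) B0 sp0.
    have hy r : Q r && (key r == ga') -> 1 + N%:R * `|(r : nat)%:R / P'.+1%:R - (g r).1%:R / s%:R| = y r.
      by move=> h; rewrite /y hs.
    rewrite (eq_bigr (fun r => (y r)^-1)) => [|r /hy -> //]; apply => r hr.
    split; last by rewrite hy // Qy //; case/andP: hr.
    have sLs : (s %| L.+1)%N by exact: sL.
    have /andP[Qr /eqP kr] := hr.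
    have := zfrac_eq R (g r).1 sp0 sLs; have := zfrac_eq R (g r0).1 sp0 sLs.
    have -> : zfrac L (g r).1 s = ga' by rewrite -kr /key hs.
    have -> : zfrac L (g r0).1 s = ga' by rewrite -k0.
    move=> -> /(congr1 (fun x => x * s%:R)); rewrite !divfK ?pnatr_eq0 -?lt0n //.
    by move=> /eqP; rewrite eqr_nat => /eqP.
  - move=> r Qr; split; first by rewrite expn1 zk // Qs.
    have [z hz] := keyE r Qr; exists z%:Z; rewrite mul1r -pmulrn.
    have -> : (r : nat)%:R / P'.+1%:R - (key r)%:R / L.+1%:R - z%:R =
      (r : nat)%:R / P'.+1%:R - (g r).1%:R / (g r).2%:R :> R by rewrite hz opprD addrA.
    exact: Qd.
  - move=> k rho tu r h Qr; apply: nearS => //; split; first by rewrite expn1 zk // Qs.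
    have [z hz] := keyE r Qr; exists z%:Z; rewrite mul1r -pmulrn.
    have -> : (r : nat)%:R / P'.+1%:R - (key r)%:R / L.+1%:R - z%:R =
      (r : nat)%:R / P'.+1%:R - (g r).1%:R / (g r).2%:R :> R by rewrite hz opprD addrA.
    exact: Qd.
  - by move=> rho tu tu'; apply: near_uniq.
have := @density_le_of_moment R m.+1 N M de C1 La1 nu (La ^+ (2 * 16 ^ m.+1)) Psi (Num.sqrt C1) P'.+1%:R
  N0 M0 (ltn0Sn m) de0 C10 La10 nu0.
move=> /(_ _ _ PR _ _ hup hmom).
have -> : 256 * C1 * La1 * nu = (256 * 17 * 18) * kp%:R * c1 * (1 + ln B%:R) ^+ 2 * nu by rewrite /C1 /La1; ring.
apply => //; first by rewrite exprn_ge0.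
- exact: sqrtr_ge0.
- by rewrite sqr_sqrtr // ltW.
Qed.

(* [C al be ga] says that al n^2 + be n + ga belongs to the family: restricted to
   a progression of step q such a quadratic is, up to a factor lam divisible by q,
   again in the family, while kp bounds its coefficients relative to al and the
   common factors of 2 al and 2 be. *)
Definition good_family (kp : nat) (C : nat -> nat -> nat -> Prop) : Prop :=
  forall al be ga, C al be ga ->
  [/\ (0 < al)%N, (be <= kp * al)%N, (ga <= kp * al)%N,
     forall G, (G %| 2 * al -> G %| 2 * be -> G <= kp)%N &
     forall q, (0 < q)%N -> exists lam r al' be' ga', [/\ (q %| lam)%N, (0 < lam <= q ^ 2)%N,
       C al' be' ga', (al' <= al * q)%N &
       forall x, quad al be ga (r + q * x) = (lam * quad al' be' ga' x)%N]].

Definition no_diff (N : nat) (A : nat -> bool) (al be ga : nat) : Prop :=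
  forall n x, (x + quad al be ga n < N)%N -> A x -> A (x + quad al be ga n)%N -> False.

(** M is the integer part of the square root of (N / 8) / ((1 + 2 kp) al): the quadratic stays below
    N / 8 up to M, and N exceeds al M^2 by at most a factor depending on kp. *)
Lemma choose_range (R : realType) (kp al be ga N : nat) :
  (0 < al)%N -> (be <= kp * al)%N -> (ga <= kp * al)%N -> (8 <= N)%N ->
  16 * (1 + 2 * kp%:R) * al%:R <= N%:R :> R ->
  exists M, [/\ (0 < M)%N, (quad al be ga M <= N %/ 8)%N &
     N%:R <= 64 * (1 + 2 * kp%:R) * al%:R * M%:R ^+ 2 :> R].
Proof.
move=> al0 hbe hga N8 hN; set H := (N %/ 8)%N.
have HN : (N < 8 * H.+1)%N by rewrite mulnC ltn_ceil.
have H1 : (1 <= H)%N by rewrite divn_gt0.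
have H16 : N%:R <= 16 * H%:R :> R by rewrite -[16 * _]natrM ler_nat; lia.
pose w : R := (1 + 2 * kp%:R) * al%:R.
have w0 : 0 < w by rewrite mulr_gt0 ?ltr0n // ltr_wpDr // mulr_ge0.
have hw : w <= H%:R by move: hN H16; rewrite /w; clear; lra.
pose X := Num.sqrt (H%:R / w).
have X1 : 1 <= X.
  by rewrite -[1]sqrtr1 ler_wsqrtr // ler_pdivlMr // mul1r.
have X2 : X ^+ 2 * w = H%:R by rewrite sqr_sqrtr ?divfK ?gt_eqF // divr_ge0 // ltW.
have X0 : 0 <= X by rewrite sqrtr_ge0.
exists (Num.truncn X); have /andP[t1 t2] := truncn_itv X0; set M := Num.truncn X in t1 t2 *.
have M0 : (0 < M)%N by rewrite truncn_gt0.
have M1 : 1 <= M%:R :> R by rewrite ler1n.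
split => //.
  have h1 : (quad al be ga M <= (1 + 2 * kp) * al * M ^ 2)%N.
    have -> : ((1 + 2 * kp) * al * M ^ 2 = al * M ^ 2 + (kp * al * M ^ 2 + kp * al * M ^ 2))%N by clear; lia.
    rewrite /quad -addnA leq_add2l.
    apply: leq_add; first by rewrite -mulnn mulnA leq_mul // (leq_trans hbe) // leq_pmulr.
    by apply: (leq_trans hga); rewrite leq_pmulr // expn_gt0 M0.
  apply: (leq_trans h1); rewrite -(ler_nat R).
  have -> : ((1 + 2 * kp) * al * M ^ 2)%:R = M%:R ^+ 2 * w :> R.
    by rewrite -mulnn !natrM natrD natrM /w; ring.
  rewrite -X2 ler_wpM2r ?(ltW w0) // lerXn2r ?nnegrE //.
have XM : X <= 2 * M%:R by move: t2 M1; rewrite -natr1; clear; lra.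
have : X ^+ 2 <= (2 * M%:R) ^+ 2 by rewrite lerXn2r ?nnegrE // mulr_ge0.
move=> /(ler_wpM2r (ltW w0)); rewrite X2 exprMn => h.
apply: (le_trans H16); rewrite /w in h; move: h; clear; lra.
Qed.

(** By contradiction from [no_increment]. The progressions it inspects have step lam q, where the
    quadratic on some class modulo q is lam times a member of the family; an increment there,
    rescaled by lam, again gives a set that avoids a member of the family. *)
Lemma increment_step (R : realType) (kp B m : nat) (C : nat -> nat -> nat -> Prop)
    (nu de0 La Y : R) (c1 := 64 * (1 + 2 * kp%:R)) (al be ga N : nat) (A : nat -> bool) :
  good_family kp C -> (0 < kp)%N -> (0 < B)%N -> 0 < nu <= 1 -> 0 < de0 ->
  32 * kp%:R * c1 / (de0 / 4) ^+ 2 <= Num.sqrt (B%:R : R) ->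
  1 + m.+1%:R * ln B%:R <= La ->
  3 * (256 * 17 * 18 * kp%:R * c1 * (1 + ln B%:R) ^+ 2 * nu) ^+ m.+1 * La ^+ (2 * 16 ^ m.+1) < 2 * de0 ->
  1 <= Y -> (5500 * c1 ^+ 2 * Y ^+ 2 * B%:R / (de0 / 4) ^+ 2) ^+ 4 * (c1 * Y) <= N%:R ->
  (B ^ m.+1 * B ^ m.+1)%:R * (2 * m.+1%:R * B%:R) < N%:R :> R ->
  8 * B%:R ^+ 3 <= nu * N%:R ->
  C al be ga -> al%:R <= Y -> no_diff N A al be ga -> de0 <= density R N A ->
  exists al' be' ga' N' A', [/\ C al' be' ga', (al' <= al * B)%N, no_diff N' A' al' be' ga',
    (1 + nu) * density R N A <= density R N' A' & nu * N%:R <= 16 * B%:R ^+ 3 * N'%:R].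
Proof.
have ec1 : c1 = 64 * (1 + 2 * kp%:R) by [].
clearbody c1.
move=> hC kp0 B0 /andP[nu0 nu1] de00 hB hLa hfail Y1 hN1 hN2 hN3 Cal alY hA hde.
have [al0 hbe hga hcont hclos] := hC _ _ _ Cal.
set de := density R N A in hde *.
have de_gt0 : 0 < de := lt_le_trans de00 hde.
have Bp : 0 < B%:R :> R by rewrite ltr0n.
have B1 : 1 <= B%:R :> R by rewrite ler1n.
have c10 : 64 <= c1 by rewrite ec1 ler_peMr // lerDl mulr_ge0.
have c1p : 0 < c1 by apply: lt_le_trans c10.
have hN8 : 8 <= N%:R :> R.
  have B31 : 1 <= B%:R ^+ 3 :> R by rewrite exprn_ege1.
  have : nu * N%:R <= N%:R by rewrite ler_piMl.
  by move: hN3 B31; clear; lra.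
have Np : 0 < N%:R :> R by apply: lt_le_trans hN8.
have N0 : (0 < N)%N by rewrite -(ltr0n R).
have N8 : (8 <= N)%N by rewrite -(ler_nat R).
have Yp : 0 < Y by apply: lt_le_trans Y1.
have de41 : de0 / 4 <= 1.
  have /andP[_ h] := density_itv R N A; move: h hde; rewrite /de.
  by move: (density R N A) => x; clear; lra.
have d4p : 0 < de0 / 4 by rewrite divr_gt0.
have d42 : 0 < (de0 / 4) ^+ 2 by rewrite exprn_gt0.
pose Z := 5500 * c1 ^+ 2 * Y ^+ 2 * B%:R / (de0 / 4) ^+ 2.
have Z1 : 1 <= Z.
  rewrite ler_pdivlMr // mul1r; apply: (@le_trans _ _ 1).
    by rewrite exprn_ile1 // ltW.
  have h1 : 1 <= c1 by apply: le_trans c10; clear; lra.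
  by rewrite !mulr_ege1 ?exprn_ege1 //; clear; lra.
have hNY : c1 * Y <= N%:R.
  by apply: le_trans hN1; rewrite ler_peMl ?exprn_ege1 // mulr_ge0 // ltW.
have [M [M0 hqM hNM]] := @choose_range R kp al be ga N al0 hbe hga N8 (ltac:(
  apply: le_trans hNY; rewrite ec1; apply: (@le_trans _ _ (64 * (1 + 2 * kp%:R) * al%:R));
  [by rewrite -!mulrA ler_wpM2r ?mulr_ge0 ?addr_ge0 ?mulr_ge0 //; clear; lra
  |by rewrite ler_wpM2l // mulr_ge0 // addr_ge0 // mulr_ge0])).
rewrite -ec1 in hNM.
have Mp : 0 < M%:R :> R by rewrite ltr0n.
pose H := (N %/ 8)%N.
have [D hD] := @choice nat (nat * nat * (nat * nat * nat))%type (fun q d => (0 < q)%N ->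
   let: (lam, r, (al', be', ga')) := d in [/\ (q %| lam)%N, (0 < lam <= q ^ 2)%N,
       C al' be' ga', (al' <= al * q)%N &
       forall x, quad al be ga (r + q * x) = (lam * quad al' be' ga' x)%N]) (ltac:(
  move=> q; case: (posnP q) => [->|q0]; [by exists (0, 0, (0, 0, 0))%N|];
  by have [lam [r [al' [be' [ga' h]]]]] := hclos q q0; exists (lam, r, (al', be', ga')))).
pose lam q := (D q).1.1.
(* The largest length with 8 B lam ell <= nu N; because lam <= B^2 it is still at least nu N / (16
   B^3). *)
pose ell q : nat := Num.truncn (nu * N%:R / (8 * B%:R * (lam q)%:R) : R).
have lamP q : (0 < q <= B)%N -> (q %| lam q)%N /\ (0 < lam q <= B ^ 2)%N.
  move=> /andP[q0 qB]; have := hD q q0; rewrite /lam; case: (D q) => -[la r] [[a b] c] [h1 /andP[h2 h3] _ _ _].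
  by split=> //=; rewrite h2 (leq_trans h3) // leq_exp2r.
have ellP q : (0 < q <= B)%N -> [/\ (0 < ell q)%N, 8 * B%:R * (lam q * ell q)%:R <= nu * N%:R &
    nu * N%:R <= 16 * B%:R ^+ 3 * (ell q)%:R].
  move=> qB; have [_ /andP[l0 lB]] := lamP q qB.
  have lp : 0 < (lam q)%:R :> R by rewrite ltr0n.
  have lB2 : (lam q)%:R <= B%:R ^+ 2 :> R by rewrite -natrX ler_nat.
  have w0 : 0 < 8 * B%:R * (lam q)%:R :> R by rewrite !mulr_gt0.
  have w1 : 8 * B%:R * (lam q)%:R <= 8 * B%:R ^+ 3 :> R.
    by rewrite [_ ^+ 3]exprS mulrA ler_wpM2l // mulr_ge0.
  have x1 : 1 <= nu * N%:R / (8 * B%:R * (lam q)%:R).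
    by rewrite ler_pdivlMr // mul1r (le_trans w1).
  have x0 : 0 <= nu * N%:R / (8 * B%:R * (lam q)%:R) := le_trans ler01 x1.
  have /andP[t1 t2] := truncn_itv x0; rewrite -/(ell q) in t1 t2.
  have e1 : 1 <= (ell q)%:R :> R by rewrite ler1n truncn_gt0.
  split; first by rewrite truncn_gt0.
    move: t1; rewrite ler_pdivlMr // natrM; clear; lra.
  move: t2; rewrite ltr_pdivrMr // -natr1 => t2; apply: (le_trans (ltW t2)).
  have := ler_pM (ltW (addr_gt0 (lt_le_trans ltr01 e1) ltr01)) (ltW w0) _ w1 => /(_ (2 * (ell q)%:R)) h.
  apply: le_trans (h _) _; last by clear; lra.
  by move: e1; clear; lra.
have goal q x0 l : (0 < q <= B)%N -> (0 < l)%N -> (x0 + lam q * l.-1 < N)%N ->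
    (1 + nu) * de * l%:R <= \sum_(j < l) (A (x0 + lam q * j)%N)%:R ->
    nu * N%:R <= 16 * B%:R ^+ 3 * l%:R ->
    exists al' be' ga' N' A', [/\ C al' be' ga', (al' <= al * B)%N, no_diff N' A' al' be' ga',
    (1 + nu) * de <= density R N' A' & nu * N%:R <= 16 * B%:R ^+ 3 * N'%:R].
  move=> /andP[q0 qB] l0 hx hinc hl; have := hD q q0; rewrite /lam in hx hinc.
  case: (D q) hx hinc => -[la r] [[a b] c] /= hx hinc [h1 /andP[h2 h3] h4 h5 h6].
  exists a, b, c, l, (fun j => A (x0 + la * j)%N); split => //.
  - by apply: (leq_trans h5); rewrite leq_mul2l qB orbT.
  - move=> n j hj a1 a2; apply: (hA (r + q * n)%N (x0 + la * j)%N _ a1); rewrite h6 -addnA -mulnDr //.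
    apply: leq_ltn_trans hx; rewrite leq_add2l leq_mul2l.
    by apply/orP; right; rewrite -ltnS prednK.
  - by rewrite /density natr_sum ler_pdivlMr ?ltr0n.
have [//|none] := pselect (exists al' be' ga' N' A', [/\ C al' be' ga', (al' <= al * B)%N, no_diff N' A' al' be' ga',
    (1 + nu) * de <= density R N' A' & nu * N%:R <= 16 * B%:R ^+ 3 * N'%:R]).
exfalso.
have noinc q x0 l : (0 < q <= B)%N -> (0 < l)%N -> (x0 + lam q * l.-1 < N)%N ->
    nu * N%:R <= 16 * B%:R ^+ 3 * l%:R ->
    \sum_(j < l) (A (x0 + lam q * j)%N)%:R <= (1 + nu) * de * l%:R.
  move=> h1 h2 h3 h4; rewrite leNgt; apply/negP => h5; apply: none.
  exact: (goal q x0 l h1 h2 h3 (ltW h5) h4).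
have oneB : (0 < 1 <= B)%N by [].
(* Intervals are thus among the inspected progressions. Absence of increment on the intervals of
   length N / 8 at both ends leaves at most a quarter of A in each, the boundary condition of
   [bal_correlation]. *)
have lam1 : lam 1%N = 1%N.
  have := hD 1%N isT; rewrite /lam; case: (D 1%N) => -[la r] [[a b] c] /= [_ /andP[h1 h2] _ _ _].
  by apply/eqP; rewrite eqn_leq h1 h2.
have H1 : (0 < H)%N by rewrite divn_gt0.
have HN8 : (8 * H <= N)%N by rewrite mulnC leq_trunc_div.
have H16 : (N <= 16 * H)%N.
  have : (N < 8 * H.+1)%N by rewrite mulnC ltn_ceil.
  by move: H1; clear; lia.
have edge x0 : (x0 + H <= N)%N -> (4 * \sum_(j < H) A (x0 + j)%N <= \sum_(x < N) A x)%N.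
  move=> hx; rewrite -(ler_nat R) natrM.
  have := noinc 1%N x0 H oneB H1; rewrite lam1 mul1n => h.
  have {h} : \sum_(j < H) (A (x0 + 1 * j)%N)%:R <= (1 + nu) * de * H%:R.
    apply: h; first by move: hx H1; clear; lia.
    have B31 : 1 <= B%:R ^+ 3 :> R by rewrite exprn_ege1.
    have : N%:R <= 16 * H%:R :> R by rewrite -[16 * _]natrM ler_nat.
    have h1 : nu * N%:R <= N%:R by rewrite ler_piMl.
    have h2 : H%:R <= B%:R ^+ 3 * H%:R :> R by rewrite ler_peMl.
    by move: h1 h2; clear; lra.
  rewrite !natr_sum -densityM -/de => h.
  have -> : \sum_(i < H) (A (x0 + i)%N)%:R = \sum_(j < H) (A (x0 + 1 * j)%N)%:R :> R.
    by apply: eq_bigr => j _; rewrite mul1n.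
  apply: le_trans (ler_wpM2l _ h) _ => //.
  have h8 : 8 * H%:R <= N%:R :> R by rewrite -[8 * _]natrM ler_nat.
  have := ler_wpM2l (ltW de_gt0) h8.
  have : 0 <= (1 - nu) * (de * H%:R) by rewrite mulr_ge0 ?subr_ge0 // mulr_ge0 // ltW.
  by clear; lra.
have dd : (de0 / 4) ^+ 2 <= (de / 4) ^+ 2.
  rewrite lerXn2r ?nnegrE ?divr_ge0 // ?(ltW de_gt0) ?(ltW de00) //.
  by rewrite ler_wpM2r // invr_ge0.
have de42 : 0 < (de / 4) ^+ 2 by apply: lt_le_trans dd.
have := @no_increment R al be ga kp M N B H m A nu c1 La lam ell N0 al0 M0 kp0 B0.
move=> /(_ _ _ de_gt0 hcont _ hNM).
have hfin : 3 * (256 * 17 * 18 * kp%:R * c1 * (1 + ln B%:R) ^+ 2 * nu) ^+ m.+1 * La ^+ (2 * 16 ^ m.+1) < 2 * de.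
  by apply: lt_le_trans hfail _; rewrite ler_pM2l.
move=> hni; move: hfin; rewrite ltNge => /negP; apply; apply: hni.
- by apply: le_trans c10; clear; lra.
- by rewrite (ltW nu0).
- by apply: (leq_trans hqM); exact: leq_div.
- apply: le_trans hB; rewrite ler_wpM2l ?lef_pV2 ?posrE //.
  by rewrite mulr_ge0 ?(ltW c1p) // mulr_ge0.
- apply: (@le_trans _ _ Z).
    rewrite /Z; apply: ler_pM; rewrite ?lef_pV2 ?posrE // ?invr_ge0 ?(ltW de42) //.
      by rewrite !mulr_ge0 ?exprn_ge0 // ltW.
    rewrite ler_wpM2r // ler_wpM2l ?lerXn2r ?nnegrE ?(ltW Yp) //.
    by rewrite mulr_ge0 // exprn_ge0 // ltW.
  have hM2 : Z ^+ 4 <= M%:R ^+ 2.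
    have h1 : Z ^+ 4 * (c1 * Y) <= c1 * Y * M%:R ^+ 2.
      apply: (le_trans hN1); apply: (le_trans hNM).
      by rewrite ler_wpM2r ?exprn_ge0 // ler_wpM2l // ltW.
    by move: h1; rewrite mulrC ler_pM2l // mulr_gt0.
  have Z0 : 0 <= Z by apply: le_trans Z1.
  rewrite -(ger0_norm Z0) -sqrtr_sqr; apply: ler_wsqrtr.
  rewrite -ler_sqr ?nnegrE ?exprn_ge0 //; apply: le_trans hM2; rewrite -exprM //.
- exact: leq_div.
- move=> n nM; apply: leq_trans hqM; apply: quad_mono; exact: ltnW.
- by move=> n x _; exact: hA.
- have := edge 0%N; rewrite add0n; apply; exact: leq_div.
- by apply: edge; rewrite subnK // leq_div.
- by move=> s hs; have [h1 /andP[h2 _]] := lamP s hs; have [h3 h4 _] := ellP s hs; split.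
- by move=> s x0 hs hx; have [h3 h4 h5] := ellP s hs; exact: noinc.
- have -> : (B ^ m.+1 * B ^ m.+1)%:R * (2 * m.+1%:R * (B%:R / N%:R)) =
     (B ^ m.+1 * B ^ m.+1)%:R * (2 * m.+1%:R * B%:R) / N%:R :> R by ring.
  by rewrite ltr_pdivrMr // mul1r.
- exact: hLa.
Qed.

(** A step divides the length by at most 16 B^3 / nu, multiplies al by at most B and the density by
    at least 1 + nu. N1 and Y are the budgets for length and leading coefficient that all k steps
    must respect. *)
Lemma increment_iter (R : realType) (kp B m : nat) (C : nat -> nat -> nat -> Prop)
    (nu de0 La Y N1 : R) (c1 := 64 * (1 + 2 * kp%:R)) :
  good_family kp C -> (0 < kp)%N -> (0 < B)%N -> 0 < nu <= 1 -> 0 < de0 ->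
  32 * kp%:R * c1 / (de0 / 4) ^+ 2 <= Num.sqrt (B%:R : R) ->
  1 + m.+1%:R * ln B%:R <= La ->
  3 * (256 * 17 * 18 * kp%:R * c1 * (1 + ln B%:R) ^+ 2 * nu) ^+ m.+1 * La ^+ (2 * 16 ^ m.+1) < 2 * de0 ->
  1 <= Y -> (5500 * c1 ^+ 2 * Y ^+ 2 * B%:R / (de0 / 4) ^+ 2) ^+ 4 * (c1 * Y) <= N1 ->
  (B ^ m.+1 * B ^ m.+1)%:R * (2 * m.+1%:R * B%:R) < N1 ->
  8 * B%:R ^+ 3 <= nu * N1 ->
  forall k al be ga N A, N1 * (16 * B%:R ^+ 3 / nu) ^+ k <= N%:R ->
  C al be ga -> (al * B ^ k)%:R <= Y -> no_diff N A al be ga -> de0 <= density R N A ->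
  density R N A * (1 + nu) ^+ k <= 1.
Proof.
move=> hC kp0 B0 hnu de00 hB hLa hfail Y1 h1 h2 h3; have /andP[nu0 nu1] := hnu.
have Bp : 0 < B%:R :> R by rewrite ltr0n.
have B1 : 1 <= B%:R :> R by rewrite ler1n.
have D1 : 1 <= 16 * B%:R ^+ 3 / nu.
  rewrite ler_pdivlMr // mul1r; apply: (le_trans nu1).
  by rewrite mulr_ege1 ?exprn_ege1 //; clear; lra.
have N10 : 0 <= N1.
  apply: ltW; rewrite -(pmulr_rgt0 _ nu0); apply: lt_le_trans h3.
  by rewrite mulr_gt0 // exprn_gt0.
elim=> [|k IH] al be ga N A hN Cal hal hA hde.
  by rewrite expr0 mulr1; have /andP[] := density_itv R N A.
have hNN : N1 <= N%:R by apply: le_trans hN; rewrite ler_peMr // exprn_ege1.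
have halY : al%:R <= Y by apply: le_trans hal; rewrite ler_nat leq_pmulr // expn_gt0 B0.
have [al' [be' [ga' [N' [A' [c1' c2 c3 c4 c5]]]]]] :=
  @increment_step R kp B m C nu de0 La Y al be ga N A hC kp0 B0 hnu de00 hB hLa hfail Y1
   (le_trans h1 hNN) (lt_le_trans h2 hNN) (le_trans h3 (ler_wpM2l (ltW nu0) hNN)) Cal halY hA hde.
have d0 : 0 <= density R N A := le_trans (ltW de00) hde.
have hIH := IH al' be' ga' N' A' _ c1' _ c3 _.
have nu10 : 0 <= 1 + nu by rewrite addr_ge0 // ltW.
apply: le_trans (hIH _ _ _).
- by rewrite exprS mulrA [density R N A * _]mulrC ler_wpM2r ?exprn_ge0.
- have Dp : 0 < 16 * B%:R ^+ 3 / nu := lt_le_trans ltr01 D1.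
  rewrite -(ler_pM2l Dp) mulrCA -exprS; apply: (le_trans hN).
  by rewrite mulrAC ler_pdivlMr // mulrC.
- apply: le_trans hal; rewrite ler_nat expnS mulnA leq_mul2r c2 orbT //.
- apply: (le_trans hde); apply: le_trans c4; rewrite ler_peMl // lerDl; exact: ltW.
Qed.

(** * Families of quadratics *)

(** The single polynomial (n + 1)^2, positive for all n >= 0. *)
Definition square_family (al be ga : nat) : Prop := [/\ al = 1%N, be = 2%N & ga = 1%N].

(** On the class of q - 1 modulo q one has r + q x + 1 = q (x + 1), so the square reproduces itself
    with lam = q^2. *)
Lemma square_family_good : good_family 2 square_family.
Proof.
move=> _ _ _ [-> -> ->]; split=> // [G h _|q q0]; first exact: dvdn_leq h.
exists (q ^ 2)%N, q.-1, 1%N, 2%N, 1%N; split=> //; last 2 first.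
- by rewrite mul1n.
- by move=> x; rewrite /quad; case: q q0 => // q _; rewrite -pred_Sn; ring.
- by rewrite dvdn_exp.
- by rewrite leqnn expn_gt0 q0.
Qed.

(** The products (a n + b)(c n + d). Fixing ad - bc bounds the common factors of the coefficients,
    and K bounds the roots; both survive restriction to progressions. *)
Definition linear_family (K : nat) (Dl : int) (al be ga : nat) : Prop :=
  exists a b c d : nat,
  [/\ [/\ 0 < a, 0 < b, 0 < c & 0 < d]%N, coprime a c /\ coprime a b,
      (b <= K * a)%N /\ (d <= K * c)%N,
      (a * d)%:Z - (b * c)%:Z = Dl &
      [/\ al = a * c, be = a * d + b * c & ga = b * d]%N].

(** A common divisor of both coefficients is coprime to a, because a is coprime to b and to c; hence
    it divides c, and then d. *)
Lemma linear_content (a b c d : nat) : coprime a c -> coprime a b ->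
  (gcdn (a * c) (a * d + b * c) %| `|(a * d)%:Z - (b * c)%:Z|)%N.
Proof.
move=> cac cab; set e := gcdn _ _.
have e1 : (e %| a * c)%N by exact: dvdn_gcdl.
have e2 : (e %| a * d + b * c)%N by exact: dvdn_gcdr.
have cea : coprime e a.
  rewrite /coprime -dvdn1.
  have t1 : (gcdn e a %| a)%N by exact: dvdn_gcdr.
  have : (gcdn e a %| b * c)%N.
    have : (gcdn e a %| a * d + b * c)%N by apply: dvdn_trans e2; exact: dvdn_gcdl.
    by rewrite dvdn_addr // dvdn_mulr.
  by rewrite -[(b * c)%N]mul1n Gauss_dvdl // coprimeMr !(coprime_dvdl t1).
have ec : (e %| c)%N by move: e1; rewrite Gauss_dvdr.
have ed : (e %| d)%N.
  have bc : (e %| b * c)%N by exact: dvdn_mull ec.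
  by move: e2; rewrite dvdn_addl // Gauss_dvdr.
have : (e%:Z %| (a * d)%:Z - (b * c)%:Z)%Z.
  by apply: rpredB; rewrite dvdzE /= dvdn_mull.
by rewrite /dvdz /=.
Qed.

Lemma neg_residue (a q b : nat) : (0 < a)%N -> (0 < q)%N -> coprime a q ->
  exists r : nat, (q %| a * r + b)%N.
Proof.
move=> a0 q0 caq.
have ca0 : (chinese a q 0 (b * q.-1) == 0 %[mod a])%N by rewrite chinese_modl // !mod0n.
exists (chinese a q 0 (b * q.-1) %/ a)%N.
have -> : (a * (chinese a q 0 (b * q.-1) %/ a) = chinese a q 0 (b * q.-1))%N.
  by rewrite mulnC divnK // /dvdn (eqP ca0) mod0n.
rewrite /dvdn -modnDml chinese_modr // modnDml.
by rewrite -{2}[b]muln1 -mulnDr addn1 prednK // modnMl.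
Qed.

(* Write q = q1 q2 with q1 prime to a and q2 composed of primes dividing a. These
   do not divide c, so some r satisfies q1 | a r + b and q2 | c r + d; the factors
   lost in the two linear forms have product exactly q, and ad - bc is unchanged. *)
Lemma linear_family_good (K : nat) (Dl : int) : (0 < K)%N -> Dl != 0 ->
  good_family (2 * K + K ^ 2 + 2 * `|Dl|) (linear_family K Dl).
Proof.
move=> K0 D0 _ _ _ [a [b [c [d [[a0 b0 c0 d0] [cac cab] [hb hd] hD [-> -> ->]]]]]].
have ac0 : (0 < a * c)%N by rewrite muln_gt0 a0.
split=> //.
- have h1 : (a * d <= K * (a * c))%N by rewrite mulnCA leq_mul2l hd orbT.
  have h2 : (b * c <= K * (a * c))%N by rewrite mulnA leq_mul2r hb orbT.
  apply: leq_trans (leq_add h1 h2) _; rewrite addnn -mul2n mulnA leq_mul2r.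
  by rewrite -addnA leq_addr orbT.
- apply: leq_trans (leq_mul hb hd) _; rewrite mulnACA mulnn leq_mul2r.
  by rewrite addnAC leq_addl orbT.
- move=> G h1 h2; have hG : (G %| 2 * `|Dl|)%N.
    have : (G %| 2 * gcdn (a * c) (a * d + b * c))%N by rewrite muln_gcdr dvdn_gcd h1.
    by move/dvdn_trans; apply; rewrite dvdn_pmul2l // -hD linear_content.
  by apply: leq_trans (leq_addl _ _); apply: dvdn_leq => //; rewrite muln_gt0 absz_gt0.
move=> q q0.
pose q1 := (q`_\pi(a)^')%N; pose q2 := (q`_\pi(a))%N.
have eq_ : q = (q1 * q2)%N by rewrite mulnC partnC.
have [q10 q20] : (0 < q1)%N /\ (0 < q2)%N by rewrite !part_gt0.
have c12 : coprime q1 q2 by rewrite coprime_sym coprime_partC.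
have caq1 : coprime a q1 by rewrite coprime_pi' // part_pnat.
have cq2 (u : nat) : (0 < u)%N -> coprime a u -> coprime q2 u.
  by move=> u0; rewrite coprime_pi' // => h; apply: pnat_coprime h; exact: part_pnat.
have cq2c : coprime q2 c by exact: cq2.
have [r1 hr1] := neg_residue b a0 q10 caq1.
have [r2 hr2] := neg_residue d c0 q20 (etrans (coprime_sym _ _) cq2c).
pose r := (chinese q1 q2 r1 r2 %% q)%N.
have rq : (r < q)%N by rewrite ltn_pmod.
have hu : (q1 %| a * r + b)%N.
  have er : (r = r1 %[mod q1])%N by rewrite /r eq_ modn_dvdm ?dvdn_mulr // chinese_modl.
  by rewrite /dvdn -modnDml -modnMmr er modnMmr modnDml.
have hv : (q2 %| c * r + d)%N.
  have er : (r = r2 %[mod q2])%N by rewrite /r eq_ modn_dvdm ?dvdn_mull // chinese_modr.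
  by rewrite /dvdn -modnDml -modnMmr er modnMmr modnDml.
pose u := ((a * r + b) %/ q1)%N; pose v := ((c * r + d) %/ q2)%N.
have eu : (a * r + b = q1 * u)%N by rewrite [RHS]mulnC divnK.
have ev : (c * r + d = q2 * v)%N by rewrite [RHS]mulnC divnK.
have u0 : (0 < u)%N.
  have : (0 < q1 * u)%N by rewrite -eu addn_gt0 b0 orbT.
  by rewrite muln_gt0 => /andP[].
have v0 : (0 < v)%N.
  have : (0 < q2 * v)%N by rewrite -ev addn_gt0 d0 orbT.
  by rewrite muln_gt0 => /andP[].
have cau : coprime a u.
  rewrite /coprime -dvdn1 -(eqP cab) dvdn_gcd dvdn_gcdl /=.
  have : (gcdn a u %| a * r + b)%N by rewrite eu dvdn_mull // dvdn_gcdr.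
  by rewrite dvdn_addr // dvdn_mulr // dvdn_gcdl.
exists q, r, (a * q2 * (c * q1))%N, (a * q2 * v + u * (c * q1))%N, (u * v)%N; split=> //.
- by rewrite q0 /= -mulnn leq_pmulr.
- exists (a * q2)%N, u, (c * q1)%N, v; split=> //.
  + by rewrite !muln_gt0 a0 q20 c0 q10.
  + split; first by rewrite !coprimeMl !coprimeMr cac caq1 cq2c coprime_sym c12.
    by rewrite coprimeMl cau cq2.
  (* Since r < q, y <= K x gives x r + y <= K x q; dividing by p preserves the ratio bound K. *)
  + have bound (x y p p' : nat) : (0 < p)%N -> (p * p' = q)%N -> (y <= K * x)%N ->
        forall w, (x * r + y = p * w)%N -> (w <= K * (x * p'))%N.
      move=> p0 epq hy w hw; rewrite -(leq_pmul2l p0) -hw.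
      have h1 : (x * r + x <= x * q)%N by rewrite -mulnSr leq_mul2l rq orbT.
      have h2 : (x * r + K * x <= K * (x * q))%N.
        apply: (@leq_trans (K * (x * r + x))); last by rewrite leq_mul2l h1 orbT.
        by rewrite mulnDr leq_add2r leq_pmull.
      apply: (@leq_trans (x * r + K * x)); first by rewrite leq_add2l.
      by apply: (leq_trans h2); rewrite -epq [leqRHS]mulnCA [(p * (x * _))%N]mulnCA.
    split; first exact: (bound a b q1 q2 q10 (esym eq_) hb u eu).
    by apply: (bound c d q2 q1 q20 _ hd v ev); rewrite mulnC.
  + rewrite -hD -mulnA -ev [(u * _)%N]mulnCA [(u * q1)%N]mulnC -eu !PoszM !PoszD !PoszM.
    by ring.
- by rewrite eq_ mulnACA [(q2 * q1)%N]mulnC.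
- move=> x; rewrite /quad.
  transitivity ((a * (r + q * x) + b) * (c * (r + q * x) + d))%N; first by ring.
  have -> : (a * (r + q * x) + b = q1 * (u + a * q2 * x))%N.
    by rewrite [RHS]mulnDr -eu [in LHS]eq_; ring.
  have -> : (c * (r + q * x) + d = q2 * (v + c * q1 * x))%N.
    by rewrite [RHS]mulnDr -ev [in LHS]eq_; ring.
  by rewrite [in RHS]eq_; ring.
Qed.

(** * Intersective quadratics *)

(** As a and b are coprime, a = gcd (a^2, a b) = gcd (a^2, s^2) = gcd (a, s)^2. *)
Lemma coprime_mul_square (a b s : nat) : coprime a b -> (a * b = s ^ 2)%N ->
  a = (gcdn a s ^ 2)%N.
Proof.
move=> cab e.
have [s0|s0] := posnP s.
  move: cab; rewrite s0 gcdn0; move/eqP: e; rewrite s0 exp0n // muln_eq0.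
  case/orP=> /eqP ->; first by [].
  by rewrite /coprime gcdn0 => /eqP ->.
have g0 : (0 < gcdn a s)%N by rewrite gcdn_gt0 s0 orbT.
set g := gcdn a s in g0 *.
have ea : a = (a %/ g * g)%N by rewrite divnK // dvdn_gcdl.
have es : s = (s %/ g * g)%N by rewrite divnK // dvdn_gcdr.
have c1 : coprime (a %/ g) (s %/ g).
  by rewrite /coprime -(eqn_pmul2r g0) muln_gcdl -ea -es mul1n.
transitivity (gcdn (a * a) (s ^ 2)); first by rewrite -e -muln_gcdr (eqP cab) muln1.
rewrite mulnn {1}ea {1}es !expnMn -muln_gcdl.
have : coprime ((a %/ g) ^ 2) ((s %/ g) ^ 2) by rewrite coprimeXl // coprimeXr.
by move/eqP => ->; rewrite mul1n.
Qed.

(* A square root s of D modulo 4 D^2 gives s^2 = D (1 + 4 D k) with coprime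
   factors, which are thus squares up to a common sign; the sign is positive
   because -1 is not a square modulo 4. *)
Lemma disc_square (D : int) :
  (forall q : nat, (0 < q)%N -> exists s : int, (q%:Z %| s ^+ 2 - D)%Z) ->
  exists e : int, e ^+ 2 = D.
Proof.
move=> h; have [->|D0] := eqVneq D 0; first by exists 0; rewrite expr0n.
have q0 : (0 < 4 * `|D| ^ 2)%N by rewrite muln_gt0 expn_gt0 absz_gt0 D0.
have [s /dvdzP[k ek]] := h _ q0.
have es : s ^+ 2 = D * (1 + 4 * D * k).
  have -> : s ^+ 2 = D + (s ^+ 2 - D) by ring.
  have eq_ : (4 * `|D| ^ 2)%:Z = 4 * D ^+ 2.
    by rewrite PoszM -mulnn PoszM abszE -expr2 real_normK // num_real.
  by rewrite ek eq_; ring.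
have m0 : 1 + 4 * D * k != 0 by apply/eqP; lia.
have cop : coprime `|D| `|1 + 4 * D * k|.
  rewrite -/(coprimez _ _); apply/coprimezP; exists (- (4 * k), 1) => /=; ring.
have en : (`|D| * `|(1 + 4 * D * k)%R| = `|s| ^ 2)%N.
  by rewrite -abszM -es abszX.
have e1 := coprime_mul_square cop en.
have e2 : `|(1 + 4 * D * k)%R|%N = (gcdn `|(1 + 4 * D * k)%R| `|s| ^ 2)%N.
  by apply: (@coprime_mul_square _ `|D|%N); rewrite 1?coprime_sym // mulnC.
move: e1; move: (gcdn _ _) => w1 e1; exists w1%:Z.
have [Dp|Dn] := ltrP 0 D.
  by rewrite -[RHS](gtz0_abs Dp) e1 -mulnn PoszM expr2.
exfalso.
have Dn' : D < 0 by rewrite lt_neqAle D0.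
have mn : 1 + 4 * D * k < 0.
  rewrite lt_neqAle m0 /= -(nmulr_rge0 _ Dn') -es; exact: sqr_ge0.
move: e2 mn; move: (gcdn _ _) => w e2 mn.
have : (1 + 4 * D * k) = - ((w ^ 2)%N%:Z) by rewrite -e2; lia.
rewrite -mulnn -[w](odd_double_half w); case: (odd w); move: (w./2) => v; clear; nia.
Qed.

(* The ideal (ac, ad + bc, bd) contains (ad)^2, (bc)^2 and (ad)(bc), and modulo it
   1 = (u a + v b) (w c + z d) is a combination of ad and bc; squaring, it is the
   unit ideal. *)
Lemma primitive_prod_dvd (a b c d m h : int) : coprimez a b -> coprimez c d ->
  (m %| h * (a * c))%Z -> (m %| h * (a * d + b * c))%Z -> (m %| h * (b * d))%Z ->
  (m %| h)%Z.
Proof.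
move=> /coprimezP[[u v] /= euv] /coprimezP[[w z] /= ewz] h1 h2 h3.

pose t := u * z * (a * d) + v * w * (b * c).
pose i := u * w * (a * c) + v * z * (b * d).
have eit : i = 1 - t.
  have : (u * a + v * b) * (w * c + z * d) = 1 by rewrite euv ewz mulr1.
  by rewrite /i /t => <-; ring.
pose X := u * w * (1 + t) + b * d * (2 * u * z * v * w - u ^+ 2 * z ^+ 2 - v ^+ 2 * w ^+ 2).
pose Y := v * z * (1 + t).
pose Z := u ^+ 2 * z ^+ 2 * (a * d) + v ^+ 2 * w ^+ 2 * (b * c).
have e1 : X * (a * c) + Y * (b * d) + Z * (a * d + b * c) = i * (1 + t) + t * t.
  by rewrite /X /Y /Z /i /t; ring.
have -> : h = X * (h * (a * c)) + Y * (h * (b * d)) + Z * (h * (a * d + b * c)).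
  transitivity (h * (i * (1 + t) + t * t)); first by rewrite eit; ring.
  by rewrite -e1; ring.
by rewrite !rpredD // dvdz_mull.
Qed.

(** Completing the square turns roots of f modulo q into square roots of the discriminant modulo q,
    so the discriminant is a square and f splits over the rationals; Gauss's lemma makes the factors
    integral and primitive. A prime p dividing both a and c would leave f without a root modulo |g|
    p. *)
Lemma quad_factor (f : {poly int}) : intersective f -> size f = 3%N ->
  exists g a b c d : int, [/\ g != 0, (0 < a) && (0 < c), coprimez a c,
    coprimez a b /\ coprimez c d &
    forall x, f.[x] = g * ((a * x + b) * (c * x + d))].
Proof.
move=> fi fs.
pose A := f`_2; pose B := f`_1; pose C := f`_0.
have A0 : A != 0 by rewrite /A -[2%N]/(3.-1) -fs -/(lead_coef f) lead_coef_eq0 -size_poly_eq0 fs.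
have fx x : f.[x] = A * x ^+ 2 + B * x + C.
  by rewrite horner_coef fs !big_ord_recl big_ord0 /= addr0 expr0 mulr1 expr1 addrC [X in X + _]addrC.
have [e ee] : exists e, e ^+ 2 = B ^+ 2 - 4 * A * C.
  apply: disc_square => q q0; have [r hr] := fi q q0; exists (2 * A * r + B).
  have -> : (2 * A * r + B) ^+ 2 - (B ^+ 2 - 4 * A * C) = 4 * A * f.[r] by rewrite fx; ring.
  exact: dvdz_mull.
(* The primitive part of 2 A x + y, with the sign of A moved into u to make a positive. *)
have split_ (y : int) : exists u a b : int, [/\ 2 * A = u * a, y = u * b, 0 < a & coprimez a b].
  pose g := gcdz (2 * A) y; pose u := sgz A * g.
  have A20 : 2 * A != 0 by rewrite mulf_neq0.
  have g0 : 0 < g by rewrite ltz_nat gcdn_gt0 absz_gt0 A20.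
  have s2 : sgz A * sgz A = 1 by move: A0; rewrite /sgz; case: (A == 0) => // _; case: (A < 0).
  have ea : 2 * A = g * (2 * A %/ g)%Z by rewrite [RHS]mulrC divzK // dvdz_gcdl.
  have eb : y = g * (y %/ g)%Z by rewrite [RHS]mulrC divzK // dvdz_gcdr.
  exists u, (sgz A * (2 * A %/ g)%Z), (sgz A * (y %/ g)%Z); split.
  - by rewrite /u mulrACA s2 mul1r.
  - by rewrite /u mulrACA s2 mul1r.
  - rewrite -(pmulr_rgt0 _ g0) mulrCA -ea mulrCA pmulr_rgt0 //.
    by rewrite -abszEsg ltz_nat absz_gt0.
  have cg : coprimez (2 * A %/ g)%Z (y %/ g)%Z.
    rewrite /coprimez -(inj_eq (mulfI (lt0r_neq0 g0))) mulr1.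
    by have := mulz_gcdr g (2 * A %/ g)%Z (y %/ g)%Z; rewrite -ea -eb gtz0_abs // => ->.
  have [[p q] /= epq] := coprimezP _ _ cg.
  by apply/coprimezP; exists (sgz A * p, sgz A * q) => /=; rewrite -[RHS]epq -[RHS]mul1r -s2; ring.
have [u [a [b [ea eb a0 cab]]]] := split_ (B - e).
have [v [c [d [ec ed c0 ccd]]]] := split_ (B + e).
have e1 : 4 * A * A = u * v * (a * c) by rewrite mulrACA -ea -ec; ring.
have e3 : 4 * A * C = u * v * (b * d).
  by rewrite mulrACA -eb -ed; transitivity (B ^+ 2 - e ^+ 2); [rewrite ee|]; ring.
have e2 : 4 * A * B = u * v * (a * d + b * c).
  rewrite mulrDr [X in X + _]mulrACA [X in _ + X]mulrACA -ea -eb -ec -ed; ring.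
have /dvdzP[g eg] : (4 * A %| u * v)%Z.
  by apply: (primitive_prod_dvd cab ccd); rewrite -?e1 -?e2 -?e3 dvdz_mulr.
have A40 : 4 * A != 0 by rewrite mulf_neq0.
have fg x : f.[x] = g * ((a * x + b) * (c * x + d)).
  apply: (mulfI A40); rewrite [RHS]mulrA [4 * A * g]mulrC -eg fx.
  transitivity (4 * A * A * x ^+ 2 + 4 * A * B * x + 4 * A * C); first by ring.
  by rewrite e1 e2 e3; ring.
have g0 : g != 0.
  apply: contraNneq (mulf_neq0 A40 A0) => g0.
  by rewrite e1 eg g0 !mul0r.
exists g, a, b, c, d; split=> //; rewrite ?a0 //.
rewrite /coprimez /gcdz -[1]/(1%N%:Z); apply/eqP; congr Posz; apply/eqP.
rewrite -/(coprime _ _) coprime_has_primes ?absz_gt0 ?lt0r_neq0 //.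
apply/hasPn => p; rewrite !mem_primes => /and3P[pp _ pc]; apply/negP => /and3P[_ _ pa].
have q0 : (0 < `|g| * p)%N by rewrite muln_gt0 absz_gt0 g0 prime_gt0.
have [r] := fi _ q0; rewrite fg dvdzE !abszM /= dvdn_pmul2l ?absz_gt0 // Euclid_dvdM //.
have key (y z : int) : (p%:Z %| y)%Z -> coprimez y z -> (p%:Z %| y * r + z)%Z -> False.
  move=> py cyz pyz; have pz : (p%:Z %| z)%Z.
    have -> : z = (y * r + z) - y * r by ring.
    by rewrite rpredB // dvdz_mulr.
  have : (p%:Z %| gcdz y z)%Z by rewrite dvdz_gcd py.
  by rewrite (eqP cyz) dvdzE /= dvdn1 => /eqP p1; rewrite p1 in pp.
by case/orP; [exact: (key a b pa cab)|exact: (key c d pc ccd)].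
Qed.

(* When the two linear factors of f coincide, f = g (x + b)^2 is moved to the
   progression where it becomes a multiple of (x + 1)^2; otherwise a translation
   makes both factors positive. *)
Lemma quad_reduce (f : {poly int}) : intersective f -> size f = 3%N ->
  exists kp C al be ga G, [/\ good_family kp C, C al be ga, (0 < kp)%N && (0 < G)%N &
    forall x : nat, (0 < quad al be ga x)%N /\
      exists2 n : nat, (0 < n)%N & (`|f.[n%:Z]| = G * quad al be ga x)%N].
Proof.
move=> fi fs; have [g [a [b [c [d [g0 /andP[a0 c0] cac [cab ccd] fx]]]]]] := quad_factor fi fs.
have [D0|D0] := eqVneq (a * d - b * c) 0.
  have adbc : a * d = b * c by apply/eqP; rewrite -subr_eq0 D0.
  have da : (a %| 1)%Z.
    have : (a %| b * c)%Z by rewrite -adbc dvdz_mulr.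
    rewrite mulrC Gauss_dvdzr // => h.
    by have : (a %| gcdz a b)%Z; [rewrite dvdz_gcd dvdzz|rewrite (eqP cab)].
  have dc : (c %| 1)%Z.
    have : (c %| a * d)%Z by rewrite adbc dvdz_mull.
    rewrite Gauss_dvdzr; last by rewrite /coprimez gcdzC.
    by move=> h; have : (c %| gcdz c d)%Z; [rewrite dvdz_gcd dvdzz|rewrite (eqP ccd)].
  have a1 : a = 1 by rewrite -(gtz0_abs a0); congr Posz; apply/eqP; rewrite -dvdn1.
  have c1 : c = 1 by rewrite -(gtz0_abs c0); congr Posz; apply/eqP; rewrite -dvdn1.
  have bd : d = b by move: adbc; rewrite a1 c1 mul1r mulr1.
  (* With this e > 0, 1 + |b| + e x + b = e (x + 1): the root moves to -1 in the new variable. *)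
  pose e := `|(1 + `|b|%N%:Z + b)%R|%N.
  have e0 : (0 < e)%N by rewrite /e; lia.
  exists 2%N, square_family, 1%N, 2%N, 1%N, (`|g| * e ^ 2)%N; split=> //.
  - exact: square_family_good.
  - by rewrite muln_gt0 absz_gt0 g0 expn_gt0 e0.
  move=> x; split; first by rewrite /quad addn1.
  exists (1 + `|b| + e * x)%N => //.
  have -> : f.[(1 + `|b| + e * x)%N%:Z] = g * (e * (x + 1))%N%:Z ^+ 2.
    rewrite fx a1 c1 bd expr2; congr (g * (_ * _)); rewrite !PoszD PoszM !PoszM ?PoszD;
    by rewrite mul1r mulrDr mulr1 [RHS]addrC addrAC; congr (_ + _); rewrite /e; lia.
  by rewrite abszM abszX /= expnMn mulnA /quad; congr (_ * _)%N; ring.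
(* To the right of both roots, so both factors are positive; a translation changes neither ad - bc
   nor the coprimality conditions. *)
pose n0 : nat := (1 + `|b| + `|d|)%N.
pose b' := `|(a * n0%:Z + b)%R|%N; pose d' := `|(c * n0%:Z + d)%R|%N.
pose a' := `|a|%N; pose c' := `|c|%N.
have ea : a'%:Z = a by rewrite /a' gtz0_abs.
have ec : c'%:Z = c by rewrite /c' gtz0_abs.
have hb : 0 < a * n0%:Z + b by rewrite /n0; move: a0; clear; nia.
have hd : 0 < c * n0%:Z + d by rewrite /n0; move: c0; clear; nia.
have eb : b'%:Z = a * n0%:Z + b by rewrite /b' gtz0_abs.
have ed : d'%:Z = c * n0%:Z + d by rewrite /d' gtz0_abs.
have b'0 : (0 < b')%N by rewrite -ltz_nat eb.
have d'0 : (0 < d')%N by rewrite -ltz_nat ed.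
have a'0 : (0 < a')%N by rewrite -ltz_nat ea.
have c'0 : (0 < c')%N by rewrite -ltz_nat ec.
pose K := (b' + d')%N; pose Dl := (a' * d')%:Z - (b' * c')%:Z.
have eD : Dl = a * d - b * c by rewrite /Dl !PoszM ea ec eb ed; ring.
have K0 : (0 < K)%N by rewrite addn_gt0 b'0.
exists (2 * K + K ^ 2 + 2 * `|Dl|)%N, (linear_family K Dl), (a' * c')%N, (a' * d' + b' * c')%N,
  (b' * d')%N, `|g|%N; split.
- by apply: linear_family_good; rewrite ?eD.
- exists a', b', c', d'; split=> //.
    split; first exact: cac.
    suff : coprimez a'%:Z b'%:Z by [].
    have [[u v] /= euv] := coprimezP _ _ cab; apply/coprimezP.
    by exists (u - v * n0%:Z, v) => /=; rewrite ea eb -euv; ring.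
  by split; [apply: leq_trans (leq_addr d' b') _|apply: leq_trans (leq_addl b' d') _];
    rewrite leq_pmulr.
- by rewrite absz_gt0 g0 -addnA addn_gt0 muln_gt0 K0.
move=> x.
have eq_ : quad (a' * c') (a' * d' + b' * c') (b' * d') x = ((a' * x + b') * (c' * x + d'))%N.
  by rewrite /quad; ring.
split; first by rewrite eq_ muln_gt0 !addn_gt0 b'0 d'0 !orbT.
exists (n0 + x)%N => //.
rewrite fx abszM eq_; congr (_ * _)%N.
have -> : a * (n0 + x)%N%:Z + b = (a' * x + b')%N%:Z by rewrite 2!PoszD PoszM ea eb mulrDr addrAC [RHS]addrC.
have -> : c * (n0 + x)%N%:Z + d = (c' * x + d')%N%:Z by rewrite 2!PoszD PoszM ec ed mulrDr addrAC [RHS]addrC.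
by [].
Qed.

(** Up to sign, f takes the values G times the quadratic, and A - A is symmetric; so every class
    modulo G, rescaled, avoids the quadratic. The densest class is taken, and G / N pays for the
    incomplete last block. *)
Lemma diff_reduce (R : realType) (f : {poly int}) (N G al be ga : nat) (A : {fset int}) :
  (0 < G)%N ->
  (forall x : nat, (0 < quad al be ga x)%N /\
      exists2 n : nat, (0 < n)%N & (`|f.[n%:Z]| = G * quad al be ga x)%N) ->
  (0 < N)%N -> (forall a : int, a \in A -> 1 <= a <= N%:Z) ->
  (forall n : nat, (0 < n)%N -> f.[n%:Z] != 0 -> f.[n%:Z] \notin diffset A) ->
  exists2 A' : nat -> bool, no_diff (N %/ G) A' al be ga &
    #|` A|%:R / N%:R <= density R (N %/ G) A' + G%:R / N%:R.
Proof.
move=> G0 hq N0 hA hf; set N' := (N %/ G)%N.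
pose A0 (y : nat) := y.+1%:Z \in A.
pose S (u : 'I_G) := (\sum_(x < N') A0 (u + G * x))%N.
have hno (u : nat) : no_diff N' (fun x => A0 (u + G * x)%N) al be ga.
  move=> n x _ h1 h2; have [q0 [k k0 ek]] := hq n.
  have fk0 : f.[k%:Z] != 0 by rewrite -absz_gt0 ek muln_gt0 G0.
  have /negP := hf k k0 fk0; apply.
  have ed : (u + G * (x + quad al be ga n)).+1%:Z - (u + G * x).+1%:Z = (`|f.[k%:Z]|)%N%:Z.
    by rewrite ek; lia.
  have [s|s] := ltrP 0 f.[k%:Z].
    rewrite -(gtz0_abs s) -ed; apply/imfset2P.
    by exists (u + G * (x + quad al be ga n)).+1%:Z => //; exists (u + G * x).+1%:Z.
  rewrite -[f.[_]]opprK -(lez0_abs s) -ed opprB; apply/imfset2P.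
  by exists (u + G * x).+1%:Z => //; exists (u + G * (x + quad al be ga n)).+1%:Z.
have hcard : (#|` A| <= \sum_(u < G) (S u + 1))%N.
  have h1 : (#|` A| <= \sum_(y < (N' + 1) * G) A0 y)%N.
    have -> : (\sum_(y < (N' + 1) * G) A0 y)%N
            = size [seq y.+1%:Z | y <- iota 0 ((N' + 1) * G) & A0 y].
      rewrite size_map size_filter -sum1_count [RHS]big_mkcond.
      rewrite -(big_mkord xpredT (fun y => A0 y : nat)) /index_iota subn0.
      by apply: eq_bigr => y _; case: (A0 _).
    apply: uniq_leq_size => [|z zA]; first exact: fset_uniq.
    have /andP[z1 zN] := hA z zA.
    have ez : z = (`|z|.-1).+1%:Z by lia.
    rewrite ez; apply: map_f; rewrite mem_filter mem_iota /A0 -ez zA /= add0n.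
    have : (N < (N' + 1) * G)%N by rewrite addn1 ltn_ceil.
    by move: z1 zN; clear; lia.
  apply: (leq_trans h1); rewrite -(big_mkord xpredT (fun y => A0 y : nat)).
  rewrite big_nat_mul big_mkord.
  have -> : (\sum_(i < N' + 1) \sum_(i * G <= j < i.+1 * G) A0 j
    = \sum_(i < N' + 1) \sum_(u < G) A0 (u + G * i))%N.
    apply: eq_bigr => i _; rewrite -{1}[(i * G)%N]add0n big_addn mulSn addnK big_mkord.
    by apply: eq_bigr => u _; rewrite mulnC.
  rewrite exchange_big addn1 /=; apply: leq_sum => u _.
  by rewrite big_ord_recr /= leq_add2l; case: (A0 _).
have [u hu] : exists u : 'I_G, forall v, (S v <= S u)%N.
  have [u _ h] := @arg_maxnP _ (Ordinal G0) xpredT S isT.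
  by exists u => v; exact: h.
exists (fun x => A0 (u + G * x)%N); first exact: hno.
have h1 : #|` A|%:R <= density R N' (fun x => A0 (u + G * x)%N) * (G * N')%:R + G%:R :> R.
  rewrite natrM mulrCA densityM -natr_sum -natrM -natrD ler_nat.
  apply: (leq_trans hcard); apply: (@leq_trans (\sum_(v < G) (S u + 1))).
    by apply: leq_sum => v _; rewrite leq_add2r.
  by rewrite sum_nat_const card_ord mulnDr muln1.
have Np : 0 < N%:R :> R by rewrite ltr0n.
rewrite ler_pdivrMr // mulrDl divfK ?gt_eqF //; apply: (le_trans h1).
rewrite lerD2r; apply: ler_wpM2l; first by have /andP[] := density_itv R N' (fun x => A0 (u + G * x)%N).
by rewrite ler_nat mulnC leq_divM.
Qed.

(** * Choice of parameters *)

Lemma pow_le_expR (R : realType) (n : nat) (M : R) : 0 <= M ->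
  exists X0 : R, 0 <= X0 /\ forall x, X0 <= x -> M * x ^+ n <= expR x.
Proof.
move=> M0; exists (M * n.+1`!%:R); split=> [|x hx]; first by rewrite mulr_ge0.
have x0 : 0 <= x by apply: le_trans hx; rewrite mulr_ge0.
have h := expR_ge1Dxn n x0.
have f0 : 0 < n.+1`!%:R :> R by rewrite ltr0n fact_gt0.
apply: (@le_trans _ _ (x ^+ n.+1 / n.+1`!%:R)); last by apply: le_trans h; rewrite lerDr ler01.
by rewrite ler_pdivlMr // exprS mulrAC ler_wpM2r // exprn_ge0.
Qed.

Lemma expR_half_le (R : realType) (y : R) : 0 <= y -> y <= 1 -> expR (y / 2) <= 1 + y.
Proof.
move=> y0 y1; have := expR_ge1Dx (- (y / 2)); rewrite expRN => h.
have h2 : (1 + - (y / 2)) * expR (y / 2) <= 1.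
  by rewrite -ler_pdivlMr ?expR_gt0 // div1r.
have := expR_gt0 (y / 2); move: h2 y0 y1; clear; move: (expR _) => e; nra.
Qed.

(* Here t, x, L and exp L are the fourfold, threefold, twofold and simple logarithm
   of the length of the original interval. The increment factor is 1 + exp (- L / 2),
   the major arc cutoff B is about exp (5 L t), and 4 exp (L / 2) L t steps are made. *)
Lemma density_small (R : realType) (kp al be ga m : nat) (C : nat -> nat -> nat -> Prop)
    (kap t x L : R) (c1 := 64 * (1 + 2 * kp%:R) : R) :
  good_family kp C -> C al be ga -> (0 < kp)%N ->
  1 <= t -> t <= L -> 0 <= kap <= L ->
  2 * (2048 * kp%:R * c1) ^+ 2 <= expR kap -> 256 * 17 * 18 * kp%:R * c1 <= expR kap ->
  (5500 * c1 ^+ 2 * 64) ^+ 4 * c1 <= expR kap -> al%:R <= expR kap ->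
  4 * t + 8 <= m.+1%:R -> m.+1%:R <= 4 * t + 9 ->
  expR kap * (1 + 5 * (L * t)) ^+ 2 <= expR (L / 4) ->
  L = expR x -> 4 * 16 ^+ m.+1 * x <= L ->
  1 + (4 * t + 9) * (5 * (L * t)) <= L ^+ 2 ->
  1664 * (L * t) ^+ 2 * expR (L / 2) <= expR L ->
  forall N A, expR (expR L - kap) <= N%:R -> no_diff N A al be ga ->
  density R N A < expR (- (L * t)) / 2.
Proof.
move=> hC Cal kp0 t1 tL /andP[k0 kL] K1 K2 K3 K4 m1 m2 H1 eL H3 H4 H6 N A hN hA.
set Q := L * t in H1 H4 H6 *; set s := expR (L / 2) in H6.
have L1 : 1 <= L by exact: le_trans tL.
have Q1 : 1 <= Q by move: L1 t1; rewrite /Q; clear; nra.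
have LQ : L <= Q by move: L1 t1; rewrite /Q; clear; nra.
have tQ : t <= Q by move: L1 t1; rewrite /Q; clear; nra.
have s1 : 1 <= s by rewrite -expR0 ler_expR; move: L1; clear; lra.
have hs : s * s = expR L by rewrite -expRD; congr expR; field.
have hsn : 1 / s = expR (- (L / 2)) by rewrite expRN div1r.
have c10 : 0 < c1 by rewrite /c1; have : 0 <= kp%:R :> R by []; clear; lra.
have kp1 : 0 < kp%:R :> R by rewrite ltr0n.
have eQ : Q = L * t by [].
clearbody Q.
have L8 : 8 <= L.
  have : 13 * 5 <= (4 * t + 9) * (5 * Q) by move: t1 Q1; clear; nra.
  by move: H4 L1; clear; move: (_ * (5 * Q)) => z; nra.
rewrite ltNge; apply/negP => hde.
set de0 := expR (- Q) / 2 in hde.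
have de00 : 0 < de0 by rewrite divr_gt0 ?expR_gt0.
have ede : (de0 / 4) ^+ 2 = expR (- (2 * Q)) / 64.
  rewrite /de0; have -> : - (2 * Q) = - Q + - Q by ring.
  by rewrite expRD; field.
pose B := (Num.truncn (expR (5 * Q) / 2)).+1.
have [B0 B1 Blo Bhi] : [/\ (0 < B)%N, 1 <= B%:R :> R, expR (5 * Q) / 2 <= B%:R & B%:R <= expR (5 * Q)].
  have e0 : 0 <= expR (5 * Q) / 2 by rewrite divr_ge0 ?expR_ge0.
  have /andP[h1 h2] := truncn_itv e0.
  have h3 : 1 + 5 * Q <= expR (5 * Q) := expR_ge1Dx _.
  split=> //; first by rewrite ler1n.
    exact: ltW.
  by rewrite /B -natr1; move: h1 h3 Q1; clear; lra.
have Bp : 0 < B%:R :> R by exact: lt_le_trans B1.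
have lnB0 : 0 <= ln B%:R :> R by exact: ln_ge0.
have lnB : ln B%:R <= 5 * Q by rewrite -[leRHS]expRK ler_ln // posrE expR_gt0.
(* For this k, (1 + 1 / s)^k >= exp (k / (2 s)) >= exp (2 Q), too much for a density of at least exp
   (- Q) / 2. *)
pose k := (Num.truncn (4 * Q * s)).+1.
have [k1 k2] : 4 * Q * s <= k%:R /\ k%:R <= 5 * Q * s :> R.
  have e0 : 0 <= 4 * Q * s by move: Q1 s1; clear; nra.
  have /andP[h1 h2] := truncn_itv e0; split; first exact: ltW.
  by rewrite /k -natr1; move: h1 Q1 s1; clear; nra.
have Bn (n : nat) : B%:R ^+ n <= expR (n%:R * (5 * Q)).
  by rewrite expRM_natl lerXn2r // ?nnegrE ?expR_ge0.
have key : density R N A * (1 + s^-1) ^+ k <= 1.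
  have nu01 : 0 < s^-1 <= 1 by rewrite invr_gt0 invf_le1 ?(lt_le_trans ltr01 s1).
  have Qs : Q * Q <= Q ^+ 2 * s by rewrite expr2 ler_peMr //; move: Q1; clear; nra.
  have QQ : Q <= Q * Q by move: Q1; clear; nra.
  have hH6 : 1664 * (Q ^+ 2 * s) <= s * s by rewrite hs mulrA.
  have sp : 0 < s by exact: lt_le_trans s1.
  (* The leading coefficient may grow to exp (e^L / 64) and the length may shrink to exp (e^L / 2),
     about the square root of the original one. The size condition involves the ninth power of the
     former, and 9 / 64 < 1 / 2. *)
  apply: (@increment_iter R kp B m C s^-1 de0 (L ^+ 2) (expR (expR L / 64)) (expR (expR L / 2))
    hC kp0 B0 nu01 de00 _ _ _ _ _ _ _ k al be ga N A _ Cal) => //.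
  - rewrite ede; set X := (X in X <= _).
    have eX : X = 2048 * kp%:R * c1 * expR (2 * Q).
      rewrite /X -/c1 expRN; have := lt0r_neq0 (expR_gt0 (2 * Q)).
      move: (expR _) (c1) => e2 c e20.
      by field.
    have X0 : 0 <= X by rewrite eX mulr_ge0 ?expR_ge0 // mulr_ge0 ?(ltW c10) // mulr_ge0.
    rewrite -(ger0_norm X0) -sqrtr_sqr; apply: ler_wsqrtr; rewrite eX exprMn -expRM_natl.
    apply: le_trans Blo; have -> : 5 * Q = Q + 2 * (2 * Q) by ring.
    rewrite expRD [leRHS]mulrAC ler_wpM2r ?expR_ge0 //.
    have : expR kap <= expR Q by rewrite ler_expR (le_trans kL).
    by move: K1; clear; lra.
  - apply: le_trans H4; rewrite lerD2l; apply: ler_pM => //.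
  - rewrite -/c1; have base : 256 * 17 * 18 * kp%:R * c1 * (1 + ln B%:R) ^+ 2 * s^-1 <= expR (- (L / 4)).
      have -> : - (L / 4) = L / 4 + - (L / 2) by field.
      rewrite expRD -hsn div1r ler_wpM2r ?invr_ge0 ?(ltW sp) //; apply: le_trans H1.
      apply: ler_pM => //; rewrite ?sqr_ge0 //; first by rewrite mulr_ge0 ?(ltW c10) // !mulr_ge0.
      by rewrite lerXn2r ?nnegrE; move: lnB lnB0 Q1; clear; lra.
    have base0 : 0 <= 256 * 17 * 18 * kp%:R * c1 * (1 + ln B%:R) ^+ 2 * s^-1.
      by rewrite mulr_ge0 ?invr_ge0 ?(ltW sp) // mulr_ge0 ?sqr_ge0 // mulr_ge0 ?(ltW c10) // !mulr_ge0.
    have p1 := lerXn2r m.+1 base0 (expR_ge0 _) base.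
    have p2 : (L ^+ 2) ^+ (2 * 16 ^ m.+1) <= expR L.
      rewrite eL -exprM mulnA -expRM_natl ler_expR -eL; apply: le_trans H3.
      by rewrite natrM natrX.
    (* Here m + 1 >= 4 t + 8 enters: (m + 1) L / 4 >= L t + 2 L. One L compensates [p2], the other
       leaves the factor exp (- L). *)
    have p3 : expR (- (L / 4)) ^+ m.+1 <= expR (- Q - 2 * L).
      by rewrite -expRM_natl ler_expR eQ; move: m1 L1; clear; move: (m.+1%:R : R) => z; nra.
    have p4 : expR (- Q - 2 * L) * expR L = expR (- Q) * expR (- L) by rewrite -!expRD; congr expR; ring.
    have p5 : 3 * expR (- L) < 1.
      rewrite expRN ltr_pdivrMr ?expR_gt0 // mul1r; apply: lt_le_trans (expR_ge1Dx L).
      by move: L8; clear; lra.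
    have -> : 2 * de0 = expR (- Q) by rewrite /de0; field.
    apply: (@le_lt_trans _ _ (3 * (expR (- Q - 2 * L) * expR L))); last first.
      by rewrite p4 mulrCA gtr_pMr ?expR_gt0.
    rewrite -mulrA ler_pM2l //; apply: ler_pM => //; [exact: exprn_ge0| |exact: (le_trans p1 p3)].
    by rewrite -exprM exprn_ge0 // (le_trans ler01).
  - by rewrite -[leLHS]expR0 ler_expR divr_ge0 // expR_ge0.
  - have e2 : expR (8 * Q) = expR (2 * Q) ^+ 4 by rewrite -expRM_natl; congr expR; ring.
    rewrite -/c1 ede; set Y := expR (expR L / 64).
    apply: (@le_trans _ _ (((5500 * c1 ^+ 2 * 64) ^+ 4 * c1) * (Y ^+ 9 * B%:R ^+ 4 * expR (8 * Q)))).
      rewrite le_eqVlt; apply/orP; left; apply/eqP; rewrite e2 expRN.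
      have := lt0r_neq0 (expR_gt0 (2 * Q)); move: (expR (2 * Q)) (Y) (B%:R : R) (c1) => e3 y b c e30.
      by field.
    apply: (@le_trans _ _ (expR kap * (expR (9%:R * (expR L / 64)) * expR (4%:R * (5 * Q)) * expR (8 * Q)))).
      apply: ler_pM => //.
      - apply: mulr_ge0 (ltW c10); apply: exprn_ge0; apply: mulr_ge0; last exact: ler0n.
        by apply: mulr_ge0; [exact: ler0n|exact: sqr_ge0].
      - by rewrite mulr_ge0 ?expR_ge0 // mulr_ge0 // exprn_ge0 // expR_ge0.
      - by rewrite ler_wpM2r ?expR_ge0 // expRM_natl ler_wpM2l ?exprn_ge0 ?expR_ge0.
    rewrite -!expRD ler_expR -hs; move: hH6 Qs QQ kL LQ Q1; clear.
    by move: (Q ^+ 2 * s) (s * s) (Q * Q) => u v w; lra.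
  - rewrite natrM natrX -exprD.
    have h1 : 2 * m.+1%:R <= expR (26 * Q).
      apply: le_trans (expR_ge1Dx _); move: m2 tQ Q1; clear; lra.
    apply: (@le_lt_trans _ _ (expR ((m.+1 + m.+1)%:R * (5 * Q)) * (expR (26 * Q) * expR (5 * Q)))).
      apply: ler_pM => //; rewrite ?exprn_ge0 ?(ltW Bp) //.
        by rewrite !mulr_ge0 ?(ltW Bp).
      by apply: ler_pM => //; rewrite ?mulr_ge0 ?(ltW Bp).
    rewrite -!expRD ltr_expR -hs natrD.
    have h2 : m.+1%:R * Q <= 13 * (Q * Q).
      by rewrite mulrA ler_wpM2r //; move: m2 tQ Q1; clear; lra.
    move: h2 hH6 Qs QQ Q1; clear; move: (m.+1%:R : R) => z.
    have -> : (z + z) * (5 * Q) + (26 * Q + 5 * Q) = 10 * (z * Q) + 31 * Q by ring.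
    by move: (Q ^+ 2 * s) (s * s) (Q * Q) (z * Q) => u v w y; lra.
  - have h1 : 8 <= expR (8 * Q) by apply: le_trans (expR_ge1Dx _); move: Q1; clear; lra.
    apply: (@le_trans _ _ (expR (8 * Q) * expR (3%:R * (5 * Q)))).
      by apply: ler_pM => //; rewrite ?exprn_ge0 ?(ltW Bp).
    rewrite -div1r hsn -!expRD ler_expR -hs; move: hH6 Qs QQ LQ Q1; clear.
    by move: (Q ^+ 2 * s) (s * s) (Q * Q) => u v w; lra.
  - apply: le_trans hN.
    have b1 : 16 * B%:R ^+ 3 / s^-1 <= expR (32 * Q).
      rewrite invrK; apply: (@le_trans _ _ (expR (16 * Q) * expR (3%:R * (5 * Q)) * expR (L / 2))).
        apply: ler_pM => //; rewrite ?(ltW sp) ?mulr_ge0 ?exprn_ge0 ?(ltW Bp) //.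
        apply: ler_pM => //; rewrite ?exprn_ge0 ?(ltW Bp) //.
        by apply: le_trans (expR_ge1Dx _); move: Q1; clear; lra.
      by rewrite -!expRD ler_expR; move: LQ Q1; clear; lra.
    have b0 : 0 <= 16 * B%:R ^+ 3 / s^-1.
      by rewrite invrK ?mulr_ge0 ?exprn_ge0 ?(ltW Bp) ?(ltW sp).
    have p1 := lerXn2r k b0 (expR_ge0 _) b1.
    apply: le_trans (ler_wpM2l (expR_ge0 _) p1) _.
    rewrite -expRM_natl -expRD ler_expR -hs.
    have h2 : k%:R * (32 * Q) <= 160 * (Q ^+ 2 * s).
      have -> : 160 * (Q ^+ 2 * s) = (5 * Q * s) * (32 * Q) by ring.
      by rewrite ler_wpM2r //; move: Q1; clear; lra.
    move: h2 hH6 Qs QQ Q1 kL LQ; clear; move: (k%:R * _) => z.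
    by move: (Q ^+ 2 * s) (s * s) (Q * Q) => u v w; lra.
  - rewrite natrM natrX; apply: (@le_trans _ _ (expR kap * expR (k%:R * (5 * Q)))).
      by apply: ler_pM => //; rewrite ?exprn_ge0 ?(ltW Bp).
    rewrite -expRD ler_expR -hs.
    have h2 : k%:R * (5 * Q) <= 25 * (Q ^+ 2 * s).
      have -> : 25 * (Q ^+ 2 * s) = (5 * Q * s) * (5 * Q) by ring.
      by rewrite ler_wpM2r //; move: Q1; clear; lra.
    move: h2 hH6 Qs QQ Q1 kL LQ; clear; move: (k%:R * _) => z.
    by move: (Q ^+ 2 * s) (s * s) (Q * Q) => u v w; lra.
have sp : 0 < s by exact: lt_le_trans s1.
have g1 : expR (2 * Q) <= (1 + s^-1) ^+ k.
  apply: (@le_trans _ _ (expR (s^-1 / 2) ^+ k)).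
    rewrite -expRM_natl ler_expR; apply: (@le_trans _ _ (4 * Q * s * (s^-1 / 2))).
      by rewrite le_eqVlt; apply/orP; left; apply/eqP; field; exact: lt0r_neq0.
    by rewrite ler_wpM2r // divr_ge0 // invr_ge0 ltW.
  rewrite lerXn2r ?nnegrE ?expR_ge0 ?addr_ge0 ?invr_ge0 ?(ltW sp) //.
  by apply: expR_half_le; rewrite ?invr_ge0 ?(ltW sp) // invf_le1.
have : de0 * expR (2 * Q) <= 1.
  by apply: le_trans key; apply: ler_pM => //; rewrite ?ltW ?expR_gt0.
have -> : de0 * expR (2 * Q) = expR Q / 2.
  by rewrite /de0 mulrAC -expRD; congr (expR _ / 2); ring.
have := expR_ge1Dx Q; move: L8 LQ; clear; move: (expR Q) => e; lra.
Qed.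

(** Exponentials outgrow powers: t <= L gives L t <= L^2, to be compared with exp L, and 16 <= e^4
    gives 16^(m + 1) <= e^36 x^16 for m + 1 <= 4 t + 9, to be compared with L = exp x. *)
Lemma param_thresholds (R : realType) (kap : R) : 0 <= kap ->
  exists T0 : R, 1 <= T0 /\ forall t, T0 <= t -> let x := expR t in let L := expR x in
  [/\ t <= L, kap <= L,
    expR kap * (1 + 5 * (L * t)) ^+ 2 <= expR (L / 4),
    1664 * (L * t) ^+ 2 * expR (L / 2) <= expR L &
    1 + (4 * t + 9) * (5 * (L * t)) <= L ^+ 2 /\
    exists m : nat, [/\ 4 * t + 8 <= m.+1%:R, m.+1%:R <= 4 * t + 9 & 4 * 16 ^+ m.+1 * x <= L]].
Proof.
move=> k0.
(* 36 comes from (1 + 5 z)^2 <= 36 z^2 for z >= 1, and 256 = 4^4 turns (L / 4)^4 back into L^4. *)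
have a0 : 0 <= expR kap * (36 * 256) by rewrite mulr_ge0 ?expR_ge0 // mulr_ge0.
have b0 : 0 <= 1664 * 16 :> R by rewrite mulr_ge0.
have [Xa [Xa0 ha]] := @pow_le_expR R 4 _ a0.
have [Xb [Xb0 hb]] := @pow_le_expR R 4 _ b0.
have c0 : 0 <= 4 * expR 36%:R :> R by rewrite mulr_ge0 ?expR_ge0.
have [Xc [Xc0 hc]] := @pow_le_expR R 17 _ c0.
(* 66 = 20 + 45 + 1 is the sum of the coefficients of 5 t (4 t + 9) + 1. *)
have [Xd [Xd0 hd]] := @pow_le_expR R 2 66 (ler0n _ _).
exists (1 + kap + 4 * Xa + 2 * Xb + Xc + Xd); split=> [|t ht].
  by move: k0 Xa0 Xb0 Xc0 Xd0; clear; lra.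
move=> x L.
have [t1 tk [ta [tb [tc td]]]] : [/\ 1 <= t, kap <= t & 4 * Xa <= t /\ 2 * Xb <= t /\ (Xc <= t /\ Xd <= t)].
  by move: ht k0 Xa0 Xb0 Xc0 Xd0; clear => ht k0 Xa0 Xb0 Xc0 Xd0; do ?split; lra.
have tx : t + 1 <= x by rewrite addrC /x expR_ge1Dx.
have xL : x + 1 <= L by rewrite addrC /L expR_ge1Dx.
have tL : t <= L by move: tx xL; clear; lra.
have L1 : 1 <= L by exact: le_trans tL.
have L0 : 0 <= L by exact: le_trans L1.
have P4 : (L * t) ^+ 2 <= L ^+ 4.
  rewrite exprMn (_ : L ^+ 4 = L ^+ 2 * L ^+ 2); last by rewrite -exprD.
  by rewrite ler_wpM2l ?sqr_ge0 // lerXn2r ?nnegrE // (le_trans ler01).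
have Lt1 : 1 <= L * t by rewrite mulr_ege1.
split; first exact: tL.
- exact: le_trans tL.
- apply: le_trans (ha (L / 4) _); last by rewrite ler_pdivlMr // mulrC (le_trans ta).
  rewrite -[leRHS]mulrA ler_wpM2l ?expR_ge0 //.
  have -> : 36 * 256 * (L / 4) ^+ 4 = 36 * L ^+ 4 by field.
  apply: (@le_trans _ _ (36 * (L * t) ^+ 2)); last by rewrite ler_wpM2l.
  by move: Lt1; clear; move: (L * t) => z; nra.
- have -> : expR L = expR (L / 2) * expR (L / 2) by rewrite -expRD; congr expR; field.
  rewrite ler_wpM2r ?expR_ge0 //; apply: le_trans (hb (L / 2) _); last first.
    by rewrite ler_pdivlMr // mulrC (le_trans tb).
  have -> : 1664 * 16 * (L / 2) ^+ 4 = 1664 * L ^+ 4 by field.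
  by rewrite ler_wpM2l.
split.
  have h : 66 * x ^+ 2 <= L by apply: hd; move: td tx; clear; lra.
  apply: (@le_trans _ _ (L * (66 * x ^+ 2))); last by rewrite expr2 ler_wpM2l.
  have h1 : 5 * t * (4 * t + 9) + 1 <= 66 * x ^+ 2.
    by move: tx t1; clear; move: x => x; nra.
  have -> : 1 + (4 * t + 9) * (5 * (L * t)) = L * (5 * t * (4 * t + 9)) + 1 by ring.
  apply: (@le_trans _ _ (L * (5 * t * (4 * t + 9) + 1))); last by rewrite ler_wpM2l.
  by rewrite [leRHS]mulrDr mulr1 lerD2l.
exists (Num.truncn (4 * t) + 8)%N.
have t40 : 0 <= 4 * t by move: t1; clear; lra.
have /andP[m1 m2] := truncn_itv t40.
have em : (Num.truncn (4 * t) + 8).+1%:R = (Num.truncn (4 * t))%:R + 9 :> R by rewrite -addnS natrD.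
have hm : (Num.truncn (4 * t) + 8).+1%:R <= 4 * t + 9 by rewrite em lerD2r.
split=> //; first by move: m2; rewrite em -natr1; clear; lra.
have h16 : 16 <= expR 4%:R :> R.
  rewrite -[4%:R]mulr1 expRM_natl (_ : 16 = 2 ^+ 4); last by rewrite -natrX.
  by rewrite lerXn2r ?nnegrE ?expR_ge0 //; have := @expR_ge1Dx R 1; clear; lra.
apply: le_trans (hc x _); last by move: tc tx; clear; lra.
have -> : 4 * expR 36%:R * x ^+ 17 = 4 * (expR 36%:R * x ^+ 16) * x by ring.
rewrite ler_wpM2r ?expR_ge0 // ler_wpM2l //.
rewrite -expRM_natl -expRD; apply: (@le_trans _ _ (expR 4%:R ^+ (Num.truncn (4 * t) + 8).+1)).
  by rewrite lerXn2r ?nnegrE ?expR_ge0.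
by rewrite -expRM_natl ler_expR; move: hm; clear; move: (_.+1%:R) => z; lra.
Qed.

Lemma ln_gt0_gt1 (R : realType) (z : R) : 0 < ln z -> 1 < z.
Proof. by move=> h; rewrite ltNge; apply: contraTN h => h; rewrite -leNgt ln_le0. Qed.

(** The bound with exponent 1, for large N. [density_small] gives half of it for the densest class
    modulo G, and the boundary loss G / N is at most the other half. *)
Lemma density_large (R : realType) (f : {poly int}) : intersective f -> size f = 3%N ->
  exists T0 : R, 1 <= T0 /\ forall (N : nat) (A : {fset int}),
  (0 < N)%N -> 0 < ln (ln (ln (N%:R : R))) -> T0 <= ln (ln (ln (ln (N%:R : R)))) ->
  (forall a : int, a \in A -> 1 <= a <= N%:Z) ->
  (forall n : nat, (0 < n)%N -> f.[n%:Z] != 0 -> f.[n%:Z] \notin diffset A) ->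
  #|` A|%:R / N%:R <= expR (- (ln (ln (N%:R : R)) * ln (ln (ln (ln (N%:R : R)))))).
Proof.
move=> fi fs; have [kp [C [al [be [ga [G [hC Cal /andP[kp0 G0] hq]]]]]]] := quad_reduce fi fs.
pose c1 : R := 64 * (1 + 2 * kp%:R).
pose k1 := 2 * (2048 * kp%:R * c1) ^+ 2; pose k2 := 256 * 17 * 18 * kp%:R * c1.
pose k3 := (5500 * c1 ^+ 2 * 64) ^+ 4 * c1.
have c10 : 0 <= c1 by rewrite /c1; have : 0 <= kp%:R :> R by []; clear; lra.
have k10 : 0 <= k1 by rewrite /k1 mulr_ge0 // sqr_ge0.
have k20 : 0 <= k2 by rewrite /k2; apply: mulr_ge0 => //; rewrite !mulr_ge0.
have k30 : 0 <= k3.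
  by rewrite /k3 mulr_ge0 // -[4%N]/(2 * 2)%N exprM sqr_ge0.
pose kap := k1 + k2 + k3 + al%:R + 2 * G%:R.
have al0 : 0 <= al%:R :> R by [].
have Gr1 : 1 <= G%:R :> R by rewrite ler1n.
have hkap : [/\ 0 <= kap, k1 <= kap, k2 <= kap, k3 <= kap & al%:R <= kap /\ 2 * G%:R <= kap].
  rewrite /kap; move: (k1) (k2) (k3) k10 k20 k30 al0 Gr1; clear => k1 k2 k3 k10 k20 k30 al0 Gr1.
  by do ?split; lra.
clearbody kap; case: hkap => kap0 h1 h2 h3 [h4 h5].
have hexp (z : R) : z <= kap -> z <= expR kap.
  by move=> h; apply: le_trans (expR_ge1Dx kap); move: h; clear; lra.
have [T0 [T01 hT]] := param_thresholds kap0; exists T0; split=> // N A N0 l30 ht hA hf.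
set l1 := ln N%:R in l30 ht *; set L := ln l1 in l30 ht *; set x := ln L in l30 ht *.
set t := ln x in ht *.
have Np : 0 < N%:R :> R by rewrite ltr0n.
have L1 : 1 < L := ln_gt0_gt1 l30.
have l11 : 1 < l1 by apply: ln_gt0_gt1; exact: lt_trans L1.
have ex : x = expR t by rewrite lnK.
have eL : L = expR x by rewrite lnK // posrE (lt_trans ltr01).
have el1 : l1 = expR L by rewrite lnK // posrE (lt_trans ltr01).
have eN : N%:R = expR (expR L) by rewrite -el1 lnK.
clearbody t; have := hT t ht; rewrite /= -ex -eL => -[tL kL H1 H6 [H4 [m [m1 m2 H3]]]].
have t1 : 1 <= t := le_trans T01 ht.
have [A' nd hd] := diff_reduce R G0 hq N0 hA hf.
have hLt : kap + L * t <= expR L.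
  apply: le_trans H6; have s1 : 1 <= expR (L / 2).
    by rewrite -[leLHS]expR0 ler_expR divr_ge0 // ltW // (lt_trans ltr01).
  have LQ : L <= L * t by rewrite ler_peMr // ltW // (lt_trans ltr01).
  apply: (@le_trans _ _ (1664 * (L * t) ^+ 2)); last by rewrite ler_peMr // mulr_ge0 // sqr_ge0.
  by move: LQ kL L1; clear; move: (L * t) => Q; nra.
have Gr0 : 0 < G%:R :> R by rewrite ltr0n.
have hG : 2 * G%:R <= expR kap := hexp _ h5.
have hN : expR (expR L - kap) <= (N %/ G)%:R.
  have hh : N%:R < ((N %/ G)%:R + 1) * G%:R :> R.
    by rewrite natr1 -natrM ltr_nat ltn_ceil.
  have hm : expR (expR L - kap) * (2 * G%:R) <= N%:R.
    have -> : N%:R = expR (expR L - kap) * expR kap by rewrite -expRD subrK.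
    by rewrite ler_wpM2l ?expR_ge0.
  have h6 : 1 <= expR (expR L - kap).
    rewrite -[leLHS]expR0 ler_expR subr_ge0; apply: le_trans hLt; rewrite lerDl.
    by rewrite mulr_ge0 ?(le_trans ler01) // ltW.
  have : expR (expR L - kap) * 2 < (N %/ G)%:R + 1.
    by rewrite -(ltr_pM2r Gr0) -mulrA; exact: le_lt_trans hm hh.
  by move: h6; clear; lra.
have := density_small hC Cal kp0 t1 tL _ (hexp _ h1) (hexp _ h2) (hexp _ h3) (hexp _ h4)
  m1 m2 H1 eL H3 H4 H6 hN nd.
rewrite kap0 kL => /(_ isT) hdens.
apply: (le_trans hd); have hGN : G%:R / N%:R <= expR (- (L * t)) / 2.
  rewrite ler_pdivrMr // mulrAC ler_pdivlMr // mulrC eN -expRD.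
  by apply: (le_trans hG); rewrite ler_expR; move: hLt; clear; lra.
by move: hdens hGN; clear; move: (expR _) => e; lra.
Qed.

(** Makes 1 / log 3 smaller than the exponent 1 of [density_large]. The eighth root of e is at most
    8 / 7, and (8 / 7)^8 < 3. *)
Lemma expR1_lt3 (R : realType) : expR 1 < 3 :> R.
Proof.
have h := expR_ge1Dx (- (1 / 8) : R); rewrite expRN in h.
have e0 := expR_gt0 (1 / 8 : R).
have h1 : expR (1 / 8) <= 8 / 7 :> R.
  have : (1 + - (1 / 8)) * expR (1 / 8) <= 1 :> R by rewrite -ler_pdivlMr // [leRHS]div1r.
  by clear; lra.
have e1 : expR 1 = expR (1 / 8) ^+ 8 :> R by rewrite -expRM_natl; congr expR; field.
rewrite e1; move: e0 h1; clear; move: (expR _) => e e0 h1.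
have h2 : e ^+ 2 <= 131 / 100 by nra.
have h4 : e ^+ 4 <= 172 / 100.
  have : 0 <= e ^+ 2 by exact: sqr_ge0.
  by rewrite (_ : e ^+ 4 = e ^+ 2 * e ^+ 2); [nra|ring].
have : 0 <= e ^+ 4 by rewrite exprn_ge0 // ltW.
by rewrite (_ : e ^+ 8 = e ^+ 4 * e ^+ 4); [nra|ring].
Qed.

(* MathComp world.  Since [ln x = 0] for [x <= 0], the hypothesis
   [0 < ln (ln (ln N%:R))] forces all the inner logarithms to be positive. *)
Theorem theorem1 (R : realType) (f : {poly int}) (rho : R)
    (f_intersective : intersective f) (f_deg2 : size f = 3%N)
    (rho_lt : rho < 1 / ln 3) :
  exists2 C : R, 0 < C &
    forall (N : nat) (A : {fset int}),
      (0 < N)%N ->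
      0 < ln (ln (ln (N%:R : R))) ->
      (forall a : int, a \in A -> 1 <= a <= N%:Z) ->
      (forall n : nat, (0 < n)%N -> f.[n%:Z] != 0 ->
         f.[n%:Z] \notin diffset A) ->
      #|` A|%:R / N%:R
        <= C * ln (N%:R : R) `^ (- rho * ln (ln (ln (ln (N%:R : R))))).
Proof.
have rho1 : rho < 1.
  apply: (lt_trans rho_lt); have l3 : 1 < ln 3 :> R.
    by rewrite -[ltLHS]expRK ltr_ln ?posrE ?expR_gt0 // expR1_lt3.
  by rewrite ltr_pdivrMr ?mul1r // (lt_trans ltr01).
have [T0 [T01 hT]] := density_large R f_intersective f_deg2.
pose rhs (n : nat) := ln (n%:R : R) `^ (- rho * ln (ln (ln (ln (n%:R : R))))).
(* The admissible N below the threshold T0 are less than N0; for them the density is at most 1, and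
   C contains the inverse of the right-hand side. *)
pose N0 := (Num.truncn (expR (expR (expR (expR T0)))) : nat).+1.
have rhs0 n : 0 <= (rhs n)^-1 by rewrite invr_ge0 powR_ge0.
have C1 : 1 <= 1 + \sum_(i < N0) (rhs i)^-1 by rewrite lerDl sumr_ge0.
exists (1 + \sum_(i < N0) (rhs i)^-1); first exact: lt_le_trans C1.
move=> N A Npos l30 hA hf.
have Np : 0 < N%:R :> R by rewrite ltr0n.
have L1 : 1 < ln (ln N%:R) :> R := ln_gt0_gt1 l30.
have l11 : 1 < ln N%:R :> R by apply: ln_gt0_gt1; exact: lt_trans L1.
have rhsE : rhs N = expR (- rho * ln (ln (ln (ln (N%:R : R)))) * ln (ln N%:R)).
  by rewrite -ln_powR lnK // posrE powR_gt0 // (lt_trans ltr01).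
rewrite -/(rhs N); have [ht|ht] := leP T0 (ln (ln (ln (ln N%:R)))).
  apply: (le_trans (hT N A Npos l30 ht hA hf)); apply: (@le_trans _ _ (rhs N)).
    rewrite rhsE ler_expR -mulrA mulNr lerN2 [leRHS]mulrC ler_piMl ?(ltW rho1) //.
    by apply: mulr_ge0; apply: le_trans ler01 _; [exact: le_trans ht|exact: ltW].
  by rewrite ler_peMl // powR_ge0.
have NN0 : (N < N0)%N.
  rewrite -(ltr_nat R); apply: lt_trans (truncnS_gt _).
  rewrite -[ltLHS]lnK ?posrE // ltr_expR -[ltLHS]lnK ?posrE ?(lt_trans ltr01) //.
  rewrite ltr_expR -[ltLHS]lnK ?posrE ?(lt_trans ltr01) // ltr_expR.
  by rewrite -[ltLHS]lnK ?posrE // ltr_expR.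
have cA : (#|` A| <= N)%N.
  rewrite -[N in leqRHS](size_iota 0) -(size_map (fun i : nat => i.+1%:Z)).
  apply: uniq_leq_size => [|z zA]; first exact: fset_uniq.
  have /andP[z1 zN] := hA z zA; have -> : z = (`|z|.-1).+1%:Z by move: z1; clear; lia.
  by apply: map_f; rewrite mem_iota; move: z1 zN; clear; lia.
apply: (@le_trans _ _ 1); first by rewrite ler_pdivrMr // mul1r ler_nat.
have r0 : 0 < rhs N by rewrite rhsE expR_gt0.
rewrite -[leLHS](mulVf (lt0r_neq0 r0)) ler_wpM2r ?(ltW r0) //.
rewrite (bigD1 (Ordinal NN0)) //= addrCA lerDl; apply: addr_ge0; first exact: ler01.
by apply: sumr_ge0 => i _; exact: rhs0.
Qed.
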